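(* Let $p>3$ and let $\bar H$ be an ordinary CY3 crystal over $\bar A_0$ such that the map $T_{\bar A/\bar W}\to\mathrm{Hom}(\bar H^3,\bar H^2)$ induced by $\nabla$ is an isomorphism (so $n=h$). Let $e_0,\ldots,e_{2h+1}$, $\mathcal T$, $Z$ and $\tau_1,\ldots,\tau_h$ be an adapted basis with its matrix and components as described in the context. Define $$q_i=\exp(\tau_i)\qquad\text{for } i=1,\ldots,h.$$ Then $$q_i\in\bar A\qquad\text{and}\qquad q_i(0)-1\in p\bar W ,$$ and $p,q_1-1,\ldots,q_h-1$ is a regular system of parameters for the ring $\bar A$, i.e. $$\bar A=\bar W[[t_1,\ldots,t_h]]=\bar W[[q_1-1,\ldots,q_h-1]].$$ There is an associated lift of Frobenius (the canonical lift of Frobenius) $$\varphi:\bar A\to\bar A,\qquad \varphi|_{\bar W}=\sigma,\qquad \varphi(q_i)=q_i^p\quad\text{for } i=1,\ldots,h.$$ Moreover $$\langle e_{2h+1},F(\varphi)\varphi^*(e_{2h+1})\rangle=\varphi(Z)-p^3Z$$ and $$p^{-3}\varphi(Z)-Z\in\bar A=\bar W[[t_1,\ldots,t_h]].$$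
   Context: Rings. $p$ is a prime, $\bar k$ an algebraically closed field of characteristic $p$, $\bar W$ its ring of Witt vectors, $K^{\mathrm u}=\bar W[1/p]$, $\sigma$ the Frobenius automorphism of $\bar W$ (lifting $x\mapsto x^p$ on $\bar k$), $\bar A_0=\bar k[[t_1,\ldots,t_n]]$, $\bar A=\bar W[[t_1,\ldots,t_n]]$. $\Omega^1_{\bar A/\bar W}$ denotes the module of (continuous) differentials, free over $\bar A$ on $dt_1,\ldots,dt_n$; $T_{\bar A/\bar W}=\mathrm{Hom}(\Omega^1_{\bar A/\bar W},\bar A)$. A lift of Frobenius is a ring endomorphism $\phi$ of $\bar A$ that restricts to $\sigma$ on $\bar W$ and reduces modulo $p$ to $x\mapsto x^p$ on $\bar A_0$. For an $\bar A$-module $H$, $\phi^*H=\bar A\otimes_{\phi,\bar A}H$ and $\phi^*:H\to\phi^*H$, $h\mapsto 1\otimes h$, is $\phi$-linear. Crystals. A crystal over $\bar A_0$ is a finitely generated free $\bar A$-module $H$ with a connection $\nabla:H\to\Omega^1_{\bar A/\bar W}\otimes_{\bar A} H$ such that the operators $D_i=(\frac{d}{dt_i}\otimes1)\circ\nabla$ satisfy $D_iD_j=D_jD_i$ and $\lim_{m\to\infty}D_i^m=0$ in the $p$-adic topology of $\mathrm{End}_{\bar W}(H)$. For two lifts of Frobenius $\phi,\psi$ there is a canonical isomorphism $\chi(\phi,\psi):\phi^*H\to\psi^*H$ given by $$\chi(\phi,\psi)\phi^*(x)=\sum_{m_1,\ldots,m_n\ge0}\ \prod_{j=1}^n\frac{p^{m_j}}{m_j!}\Big(\frac{\phi(t_j)-\psi(t_j)}{p}\Big)^{m_j}\psi^*(D_1^{m_1}\circ\cdots\circ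 D_n^{m_n}(x)).$$ $F$-crystals. An $F$-crystal over $\bar A_0$ is a crystal $(H,\nabla)$ together with, for every lift of Frobenius $\phi$, an $\bar A$-linear map $F(\phi):\phi^*H\to H$ such that: $\nabla\circ F(\phi)\phi^*=(\phi\otimes F(\phi)\phi^* )\circ\nabla$, where $\phi(b\,da)=\phi(b)\,d(\phi(a))$ on forms; $F(\psi)\circ\chi(\phi,\psi)=F(\phi)$ for all lifts $\phi,\psi$; and $F(\phi)\otimes\mathbb Q_p$ is an isomorphism. It is a unit $F$-crystal if $F(\phi)$ is an isomorphism for one (equivalently every) $\phi$. For a unit $F$-crystal $V$, the Tate twist $V(-i)$ is the same module with connection, with $F(\phi)\phi^*$ replaced by $p^iF(\phi)\phi^*$. Filtrations. Let $H_0=H\otimes_{\bar A}\bar A_0$. Put $\mathrm{Fil}_iH_0=\{x\in H_0\mid \exists y\in H\text{ lifting }x\text{ with }p^iy\in\mathrm{Im}\,F(\phi)\}$ (conjugate filtration) and $\mathrm{Fil}^iH_0=\{x\in H_0\mid\exists y\in H\text{ lifting }x\text{ with }F(\phi)\phi^*y\in p^iH\}$ (Hodge filtration); these are independent of $\phi$. $H$ is of level $\le N$ if $\mathrm{Fil}_NH_0=H_0$ and $\mathrm{Fil}^{N+1}H_0=0$. A Hodge $F$-crystal over $\bar A_0$ is an $F$-crystal $H$ with a decreasing filtration $H=\mathrm{Fil}^0H\supset\mathrm{Fil}^1H\supset\cdots$ by free $\bar A$-submodules such that for all $i$: $\mathrm{Fil}^iH\otimes_{\bar A}\bar A_0=\mathrm{Fil}^iH_0$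 (via the natural map to $H_0$) and $\nabla\mathrm{Fil}^iH\subset\Omega^1_{\bar A/\bar W}\otimes\mathrm{Fil}^{i-1}H$. An $F$-crystal $H$ is ordinary if the graded module $\mathrm{gr}_\bullet H_0$ of the conjugate filtration is a free $\bar A_0$-module and $H_0=\mathrm{Fil}_iH_0\oplus\mathrm{Fil}^{i+1}H_0$ for every $i$. An ordinary $F$-crystal has a unique filtration by sub-$F$-crystals $0=U_{-1}\subset U_0\subset U_1\subset\cdots$ with $U_i\otimes_{\bar A}\bar A_0=\mathrm{Fil}_iH_0$ and $U_i/U_{i-1}\simeq V_i(-i)$ for unit $F$-crystals $V_i$; an ordinary Hodge $F$-crystal decomposes as $H=\bigoplus_iH^i$, $H^i=U_i\cap\mathrm{Fil}^iH$. A Hodge $F$-crystal of level $\le N$ is divisible if for some lift of Frobenius $\phi$ one has $F(\phi)\phi^*\mathrm{Fil}^iH\subset p^iH$ for $i=0,\ldots,N$ (if $p>N$ this then holds for every lift). Ordinary CY3 crystals ($p>3$). An ordinary CY3 crystal over $\bar A_0$ is a divisible ordinary Hodge $F$-crystal $\bar H$ of level $3$ over $\bar A_0$ (with filtrations $0\subset\bar U_0\subset\bar U_1\subset\bar U_2\subset\bar U_3=\bar H$ and $\bar H=\mathrm{Fil}^0\bar H\supset\cdots\supset\mathrm{Fil}^3\bar H\supset0$, and $\bar H^i=\bar U_i\cap\mathrm{Fil}^i\bar H$) with a non-degenerate (i.e. perfect over $\bar A$) alternating bilinear form $\langle\,,\,\rangle:\bar H\times\bar H\to\bar A$ such that: $\mathrm{rank}\,\bar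 H^0=\mathrm{rank}\,\bar H^3=1$ and $\mathrm{rank}\,\bar H^1=\mathrm{rank}\,\bar H^2=h$; for all $x,y\in\bar H$ and every lift of Frobenius $\phi$, $\langle\nabla x,y\rangle+\langle x,\nabla y\rangle=d\langle x,y\rangle$ and $\langle F(\phi)\phi^*(x),F(\phi)\phi^*(y)\rangle=p^3\phi(\langle x,y\rangle)$; and $(\mathrm{Fil}^3\bar H)^\perp=\mathrm{Fil}^1\bar H$, $(\mathrm{Fil}^2\bar H)^\perp=\mathrm{Fil}^2\bar H$. By Griffiths transversality $\nabla$ induces an $\bar A$-linear map $T_{\bar A/\bar W}\to\mathrm{Hom}(\bar H^3,\bar H^2)$ (contract $\nabla:\mathrm{Fil}^3\bar H\to\Omega^1\otimes\mathrm{Fil}^2\bar H$ with a derivation and project to $\mathrm{Fil}^2\bar H/\mathrm{Fil}^3\bar H\simeq\bar H^2$; $\mathrm{Fil}^3\bar H=\bar H^3$). Adapted basis. For an ordinary CY3 crystal for which this map is an isomorphism (so $n=h$) there exist, and we fix, an $\bar A$-basis $e_0,\ldots,e_{2h+1}$ of $\bar H$ with $e_0\in\bar H^0$, $e_1,\ldots,e_h\in\bar H^1$, $e_{h+1},\ldots,e_{2h}\in\bar H^2$, $e_{2h+1}\in\bar H^3$, and a matrix $\mathcal T$ over $K^{\mathrm u}[[t_1,\ldots,t_h]]$ such that (blocks of sizes $1,h,h,1$; $I_h$ identity; $\star$ transpose): (i) $(\langle e_i,e_j\rangle)=\begin{pmatrix}0&0&0&-1\\0&0&I_h&0\\0&-I_h&0&0\\1&0&0&0\end{pmatrix}$;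 (ii) the matrix of $\nabla$ is $\mathcal T^{-1}d\mathcal T$; (iii) for every lift of Frobenius $\psi$ the matrix of $F(\psi)\psi^*$ is $\mathcal T^{-1}P\psi(\mathcal T)$, $P=\mathrm{diag}(1,pI_h,p^2I_h,p^3)$; (iv) $\mathcal T=\begin{pmatrix}1&\tau_{23}^\star&0&0\\0&I_h&0&0\\0&0&I_h&\tau_{23}\\0&0&0&1\end{pmatrix}\begin{pmatrix}1&0&-\tau_{13}^\star&Z\\0&I_h&\tau_{12}&\tau_{13}\\0&0&I_h&0\\0&0&0&1\end{pmatrix}$ with $Z,\tau_{23},\tau_{13},\tau_{12}$ of sizes $1\times1,h\times1,h\times1,h\times h$. Columns of matrices give images of basis vectors: $\nabla e_b=\sum_aM_{ab}\otimes e_a$, $F(\psi)\psi^*e_b=\sum_aM_{ab}e_a$. Write $\tau_{23}=(\tau_1,\ldots,\tau_h)^\star$; the constant terms satisfy $\tau_i(0)\in p\bar W$, so that $\exp(\tau_i)=\exp(\tau_i(0))\exp(\tau_i-\tau_i(0))$ is a well-defined element of $K^{\mathrm u}[[t_1,\ldots,t_h]]$. For a lift of Frobenius $\psi$ and a series $g$ over $K^{\mathrm u}$ among the entries of $\mathcal T$ or the series $Z,\tau_{ij}$, $\psi(g)$ is obtained by applying $\sigma$ to coefficients and substituting $\psi(t_i)$ for $t_i$ (with $p$-adic convergence coefficient by coefficient). For $g$ a power series, $g(0)$ is its constant term at $t_1=\cdots=t_h=0$. *)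

(* Defs.v *)
From HB Require Import structures.
From mathcomp Require Import all_boot all_order all_algebra.
From mathcomp Require Import boolp generic_quotient.
From mathcomp Require Import fraction mpoly.
Set Implicit Arguments.
Unset Strict Implicit.
Unset Printing Implicit Defensive.
Import GRing.Theory.
Local Open Scope ring_scope.

(* Formal power series in n commuting variables, as coefficient families
   indexed by the monomials 'X_{1..n}. *)
Record mps (n : nat) (R : Type) := MPS { mpsfun :> 'X_{1..n} -> R }.

Notation "'{mps' R [ n ] }" := (mps n R)
  (at level 0, R at level 2, n at level 2, format "{mps  R [ n ] }").

HB.instance Definition _ n R := gen_eqMixin (mps n R).
HB.instance Definition _ n R := gen_choiceMixin (mps n R).

Lemma mpsP n R (f g : {mps R[n]}) : (forall m, f m = g m) -> f = g.
Proof. by case: f g => f [g] /= fg; congr MPS; apply: funext. Qed.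

Section MpsRing.
Variables (n : nat) (R : comNzRingType).
Implicit Types (f g h : {mps R[n]}) (m : 'X_{1..n}).

Definition mpsC (c : R) : {mps R[n]} := MPS (fun m => if m == 0%MM then c else 0).
Definition mps_add f g : {mps R[n]} := MPS (fun m => f m + g m).
Definition mps_opp f : {mps R[n]} := MPS (fun m => - f m).
Definition mps_mul f g : {mps R[n]} := MPS (fun m =>
  \sum_(k : 'X_{1..n < (mdeg m).+1, (mdeg m).+1} | m == (k.1 + k.2)%MM)
    f k.1 * g k.2).

Fact mps_addA : associative mps_add.
Proof. by move=> f g h; apply: mpsP => m /=; rewrite addrA. Qed.
Fact mps_addC : commutative mps_add.
Proof. by move=> f g; apply: mpsP => m /=; rewrite addrC. Qed.
Fact mps_add0 : left_id (mpsC 0) mps_add.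
Proof. by move=> f; apply: mpsP => m /=; rewrite if_same add0r. Qed.
Fact mps_addN : left_inverse (mpsC 0) mps_opp mps_add.
Proof. by move=> f; apply: mpsP => m /=; rewrite if_same addNr. Qed.

HB.instance Definition _ := GRing.isZmodule.Build {mps R[n]}
  mps_addA mps_addC mps_add0 mps_addN.

(* The ring axioms are inherited from polynomials by truncation. *)
Definition mps_trunc d f : {mpoly R[n]} :=
  \sum_(k : 'X_{1..n < d}) f k *: 'X_[k].

Lemma mcoeff_trunc d f m : (mdeg m < d)%N -> (mps_trunc d f)@_m = f m.
Proof.
move=> md; rewrite linear_sum (bigD1 (BMultinom md)) //=.
rewrite mcoeffZ mcoeffX eqxx mulr1 big1 ?addr0 // => k nk.
rewrite mcoeffZ mcoeffX; case: eqP => [km|]; last by rewrite mulr0.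
by case/negP: nk; apply/eqP/val_inj.
Qed.

Lemma mps_mulE f g m (P Q : {mpoly R[n]}) :
  (forall k, (mdeg k <= mdeg m)%N -> P@_k = f k) ->
  (forall k, (mdeg k <= mdeg m)%N -> Q@_k = g k) ->
  mps_mul f g m = (P * Q)@_m.
Proof.
move=> Pf Qg; rewrite (mcoeff_poly_mul _ _ (k := (mdeg m).+1)) //=.
by apply: eq_bigr => k _; rewrite Pf ?Qg // -ltnS bmdeg.
Qed.

Lemma mps_mulT d f g m : (mdeg m < d)%N ->
  mps_mul f g m = (mps_trunc d f * mps_trunc d g)@_m.
Proof.
by move=> md; apply: mps_mulE => k km; rewrite mcoeff_trunc // (leq_ltn_trans km).
Qed.

Fact mps_mulA : associative mps_mul.
Proof.
move=> f g h; apply: mpsP => m; pose d := (mdeg m).+1.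
have T u k : (mdeg k <= mdeg m)%N -> (mps_trunc d u)@_k = u k.
  by move=> km; rewrite mcoeff_trunc.
rewrite (@mps_mulE _ _ _ (mps_trunc d f) (mps_trunc d g * mps_trunc d h)); last 2 first.
- exact: T.
- by move=> k km; rewrite (mps_mulT (d := d)).
rewrite (@mps_mulE _ _ _ (mps_trunc d f * mps_trunc d g) (mps_trunc d h)) ?mulrA //.
- by move=> k km; rewrite (mps_mulT (d := d)).
- exact: T.
Qed.

Fact mps_mulC : commutative mps_mul.
Proof.
by move=> f g; apply: mpsP => m; rewrite !(mps_mulT (d := (mdeg m).+1)) // mulrC.
Qed.

Fact mps_mul1 : left_id (mpsC 1) mps_mul.
Proof.
move=> f; apply: mpsP => m.
rewrite (@mps_mulE _ _ _ 1 (mps_trunc (mdeg m).+1 f)).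
- by rewrite mul1r mcoeff_trunc.
- by move=> k _; rewrite mcoeff1 /=; case: eqP.
- by move=> k km; rewrite mcoeff_trunc.
Qed.

Fact mps_mulDl : left_distributive mps_mul mps_add.
Proof.
move=> f g h; apply: mpsP => m /=; rewrite -big_split /=.
by apply: eq_bigr => k _; rewrite mulrDl.
Qed.

Fact mps_oner_neq0 : mpsC 1 != mpsC 0.
Proof.
apply/eqP => /(congr1 (fun f : {mps R[n]} => f 0%MM)) /= /eqP.
by rewrite eqxx oner_eq0.
Qed.

HB.instance Definition _ := GRing.Zmodule_isComNzRing.Build {mps R[n]}
  mps_mulA mps_mulC mps_mul1 mps_mulDl mps_oner_neq0.

Definition mps_unit : pred {mps R[n]} := fun f => `[< exists g, g * f = 1 >].
Definition mps_inv f : {mps R[n]} :=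
  if pselect (exists g, g * f = 1) is left e then projT1 (cid e) else f.

Fact mps_mulV : {in mps_unit, left_inverse 1 mps_inv *%R}.
Proof.
move=> f /asboolP e; rewrite /mps_inv.
by case: pselect => // e'; case: cid.
Qed.
Fact mps_unitP f g : g * f = 1 -> mps_unit f.
Proof. by move=> e; apply/asboolP; exists g. Qed.
Fact mps_inv_out : {in [predC mps_unit], mps_inv =1 id}.
Proof.
move=> f /asboolP ne; rewrite /mps_inv.
by case: pselect => // e'; case: ne.
Qed.

HB.instance Definition _ := GRing.ComNzRing_hasMulInverse.Build {mps R[n]}
  mps_mulV mps_unitP mps_inv_out.

Definition mpsX (i : 'I_n) : {mps R[n]} := MPS (fun m => (m == U_(i)%MM)%:R).
Definition mps_deriv (i : 'I_n) f : {mps R[n]} :=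
  MPS (fun m => f (m + U_(i))%MM *+ (m i).+1).
End MpsRing.

Definition mps_map n (R S : Type) (u : R -> S) (f : {mps R[n]}) : {mps S[n]} :=
  MPS (fun m => u (f m)).

(* Unconditional summability for the group topology in which the sets nb N,
   N : nat, form a basis of neighbourhoods of 0. *)
Definition has_sum (V : zmodType) (nb : nat -> V -> Prop) (I : eqType)
    (f : I -> V) (s : V) : Prop :=
  forall N, exists E0 : seq I, forall E : seq I, uniq E -> {subset E0 <= E} ->
    nb N (s - \sum_(i <- E) f i).

Definition ghost (R : comNzRingType) (p : nat) (x : nat -> R) (n : nat) : R :=
  \sum_(i < n.+1) p%:R ^+ i * x i ^+ (p ^ (n - i)).

(* P(x_0, .., x_n; y_0, .., y_n) *)
Definition eval2 (R : comNzRingType) (n : nat) (P : {mpoly int[n.+1 + n.+1]})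
    (x y : nat -> R) : R :=
  mmap intr
    (fun i => match split i with inl j => x (val j) | inr j => y (val j) end) P.

(* The integral polynomials S_0, S_1, .. are determined by this universal
   identity between ghost components. *)
Definition witt_law (p : nat) (op : forall R : comNzRingType, R -> R -> R)
    (S : forall n, {mpoly int[n.+1 + n.+1]}) : Prop :=
  forall (R : comNzRingType) (x y : nat -> R) (n : nat),
    ghost p (fun i => eval2 (S i) x y) n = op R (ghost p x n) (ghost p y n).

(* The ring of p-typical Witt vectors of k: the set k^nat (through the
   bijection witt_coord), with sum and product given by the Witt polynomials. *)
Record witt_vectors (p : nat) (k : fieldType) := WittVectors {
  witt_ring :> idomainType;
  witt_coord : witt_ring -> nat -> k;
  witt_coord_bij : bijective witt_coord;
  witt_coord_add : exists2 S, witt_law p (fun R => @GRing.add R) S &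
    forall a b n, witt_coord (a + b) n = eval2 (S n) (witt_coord a) (witt_coord b);
  witt_coord_mul : exists2 M, witt_law p (fun R => @GRing.mul R) M &
    forall a b n, witt_coord (a * b) n = eval2 (M n) (witt_coord a) (witt_coord b)
}.

Section Crystals.
Variables (p : nat) (k : fieldType) (W : witt_vectors p k).

(* W[1/p]: p is a uniformizer of the discrete valuation ring W, so that this
   is the fraction field. *)
Local Notation K := {fraction W}.

Definition residue (w : W) : k := witt_coord w 0%N.
Definition toK (w : W) : K := tofrac w.

Definition is_frobenius (sigma : {rmorphism W -> W}) : Prop :=
  bijective sigma /\ forall w, residue (sigma w) = residue w ^+ p.

Definition padicW (N : nat) (x : W) : Prop := exists w : W, x = p%:R ^+ N * w.
Definition padicK (N : nat) (x : K) : Prop :=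
  exists w : W, x = toK (p%:R ^+ N * w).

Variables (sigma : {rmorphism W -> W}) (n : nat).

Definition sigmaK (x : K) : K :=
  toK (sigma \n_(repr x)) / toK (sigma \d_(repr x)).

Local Notation A := {mps W[n]}.
Local Notation A0 := {mps k[n]}.
Local Notation AK := {mps K[n]}.
Local Notation t := (@mpsX n W).

Definition reduction : A -> A0 := mps_map residue.
Definition toAK : A -> AK := mps_map toK.

Record frob_lift := FrobLift {
  frob_lift_fun :> {rmorphism A -> A};
  frob_liftC : forall w, frob_lift_fun (mpsC n w) = mpsC n (sigma w);
  frob_lift_red : forall a, reduction (frob_lift_fun a) = reduction a ^+ p
}.
Implicit Types phi psi : frob_lift.

(* g' = phi(g) for a series g over K. *)
Definition frob_ext phi (g g' : AK) : Prop :=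
  forall m, has_sum padicK
    (fun l : 'X_{1..n} => sigmaK (g l) * toAK (mmap1 (fun i => phi (t i)) l) m)
    (g' m).

(* A free module of rank r is taken to be H = A^r.  The module of differentials
   is identified with 'rV[A]_n through the basis dt_1, .., dt_n, and its tensor
   product with H with 'M[A]_(r, n), the tensor of w and x being x *m w.
   The base change phi^*H is A^r again, with 1 (x) h the vector map_mx phi h. *)

Definition dform (a : A) : 'rV[A]_n := \row_i mps_deriv i a.

Record fcrystal_data (r : nat) := FCrystalData {
  conn : 'cV[A]_r -> 'M[A]_(r, n);
  frob : frob_lift -> 'M[A]_r
}.

Section Rank.
Variable r : nat.
Implicit Types (H : fcrystal_data r) (x y : 'cV[A]_r) (xb : 'cV[A0]_r).

Definition Dop H (i : 'I_n) x : 'cV[A]_r := col i (conn H x).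

Definition frobs H phi x : 'cV[A]_r := frob H phi *m map_mx phi x.

Definition is_crystal H : Prop :=
  [/\ forall x y, conn H (x + y) = conn H x + conn H y,
      forall (a : A) x, conn H (a *: x) = x *m dform a + a *: conn H x,
      forall i j x, Dop H i (Dop H j x) = Dop H j (Dop H i x) &
      forall i N, exists M, forall m, (M <= m)%N -> forall x,
        exists y, iter m (Dop H i) x = p%:R ^+ N *: y].

Definition Dmon H (m : 'X_{1..n}) x : 'cV[A]_r :=
  foldr (fun j y => iter (m j) (Dop H j) y) x (enum 'I_n).

Definition chi_coef phi psi (m : 'X_{1..n}) : AK :=
  \prod_(j < n) (mpsC n (p%:R ^+ m j / (m j)`!%:R) *
                 (mpsC n p%:R^-1 * toAK (phi (t j) - psi (t j))) ^+ m j).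

Definition padicHK (N : nat) (v : 'cV[AK]_r) : Prop :=
  exists y : 'cV[A]_r, v = map_mx toAK (p%:R ^+ N *: y).

(* X is the matrix of chi(phi, psi); the series is summed after inverting p. *)
Definition is_chi H phi psi (X : 'M[A]_r) : Prop :=
  forall x, has_sum padicHK
    (fun m : 'X_{1..n} =>
       chi_coef phi psi m *: map_mx toAK (map_mx psi (Dmon H m x)))
    (map_mx toAK (X *m map_mx phi x)).

Definition is_fcrystal H : Prop :=
  [/\ is_crystal H,
      forall phi x, conn H (frobs H phi x) =
        \sum_(j < n) frobs H phi (Dop H j x) *m dform (phi (t j)),
      forall phi psi, exists2 X, is_chi H phi psi X &
        frob H psi *m X = frob H phi &
      (* F(phi) is invertible over A[1/p] *)
      forall phi, exists (G : 'M[A]_r) (m : nat),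
        frob H phi *m G = (p%:R ^+ m)%:M /\ G *m frob H phi = (p%:R ^+ m)%:M].

Definition is_unit_fcrystal H : Prop :=
  is_fcrystal H /\ exists phi, frob H phi \in unitmx.

Definition tate_twist H (i : nat) : fcrystal_data r :=
  FCrystalData (conn H) (fun phi => p%:R ^+ i *: frob H phi).

Definition is_basis_of (U : 'cV[A]_r -> Prop) (d : nat) (b : 'M[A]_(r, d)) :=
  (forall x, U x <-> exists c, x = b *m c) /\
  (forall c : 'cV[A]_d, b *m c = 0 -> c = 0).

Definition free_of_rank (U : 'cV[A]_r -> Prop) (d : nat) : Prop :=
  exists b : 'M[A]_(r, d), is_basis_of U b.

(* The natural map from U (x) A0 = U/pU to H0 is injective with image U0. *)
Definition tensor_eq (U : 'cV[A]_r -> Prop) (U0 : 'cV[A0]_r -> Prop) : Prop :=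
  (forall xb, U0 xb <-> exists2 x, U x & map_mx reduction x = xb) /\
  (forall x, U x -> map_mx reduction x = 0 -> exists2 y, U y & x = p%:R *: y).

(* Both filtrations are independent of phi. *)
Definition conj_fil H (i : nat) xb : Prop :=
  exists phi y z, map_mx reduction y = xb /\ p%:R ^+ i *: y = frob H phi *m z.
Definition hodge_fil H (i : nat) xb : Prop :=
  exists phi y z, map_mx reduction y = xb /\ frobs H phi y = p%:R ^+ i *: z.

(* Fil_(i-1) H0 *)
Definition conj_fil_pred H (i : nat) xb : Prop :=
  if i is j.+1 then conj_fil H j xb else xb = 0.

Definition level_le H (N : nat) : Prop :=
  (forall xb, conj_fil H N xb) /\ (forall xb, hodge_fil H N.+1 xb -> xb = 0).

Definition is_hodge_fcrystal H (Fil : nat -> 'cV[A]_r -> Prop) : Prop :=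
  [/\ is_fcrystal H,
      (forall x, Fil 0%N x) /\ (forall i x, Fil i.+1 x -> Fil i x),
      forall i, exists d, free_of_rank (Fil i) d,
      forall i, tensor_eq (Fil i) (hodge_fil H i) &
      forall i x, Fil i.+1 x -> forall j, Fil i (Dop H j x)].

Definition is_ordinary H : Prop :=
  (forall i, exists (d : nat) (b : 'M[A0]_(r, d)),
     (forall j, conj_fil H i (col j b)) /\
     (forall xb, conj_fil H i xb ->
        exists! c : 'cV[A0]_d, conj_fil_pred H i (xb - b *m c))) /\
  (forall i,
     (forall xb, exists a b, [/\ conj_fil H i a, hodge_fil H i.+1 b & xb = a + b]) /\
     (forall xb, conj_fil H i xb -> hodge_fil H i.+1 xb -> xb = 0)).

Definition is_divisible H (Fil : nat -> 'cV[A]_r -> Prop) (N : nat) : Prop :=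
  exists phi, forall i, (i <= N)%N -> forall x, Fil i x ->
    exists y, frobs H phi x = p%:R ^+ i *: y.

Definition hom_on (P Q : 'cV[A]_r -> Prop) (g : 'cV[A]_r -> 'cV[A]_r) : Prop :=
  (forall x, P x -> Q (g x)) /\
  (forall (a : A) x y, P x -> P y -> g (a *: x + y) = a *: g x + g y).

Definition perfect_alternating (form : 'cV[A]_r -> 'cV[A]_r -> A) : Prop :=
  [/\ forall (a : A) x x' y, form (a *: x + x') y = a * form x y + form x' y,
      forall (a : A) x y y', form x (a *: y + y') = a * form x y + form x y',
      forall x, form x x = 0 &
      forall f : 'cV[A]_r -> A,
        (forall (a : A) y y', f (a *: y + y') = a * f y + f y') ->
        exists! x, forall y, form x y = f y].

End Rank.

(* U is a sub-F-crystal of H, i.e. the image of an F-crystal under an injective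
   linear map that commutes with nabla and F. *)
Definition is_sub_fcrystal r (H : fcrystal_data r) (U : 'cV[A]_r -> Prop) : Prop :=
  exists (d : nat) (V : fcrystal_data d) (b : 'M[A]_(r, d)),
    [/\ is_fcrystal V, is_basis_of U b,
        forall c, conn H (b *m c) = b *m conn V c &
        forall phi c, frobs H phi (b *m c) = b *m frobs V phi c].

(* U/U' is isomorphic to V: f is linear on U, onto V, with kernel U'. *)
Definition quotient_iso r d (H : fcrystal_data r) (U U' : 'cV[A]_r -> Prop)
    (V : fcrystal_data d) : Prop :=
  exists f : 'cV[A]_r -> 'cV[A]_d,
    [/\ forall (a : A) x y, U x -> U y -> f (a *: x + y) = a *: f x + f y,
        forall v, exists2 x, U x & f x = v,
        forall x, U x -> (f x = 0 <-> U' x),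
        forall x, U x -> forall j, f (Dop H j x) = Dop V j (f x) &
        forall x, U x -> forall phi, f (frobs H phi x) = frobs V phi (f x)].

Definition fil_pred r (U : nat -> 'cV[A]_r -> Prop) (i : nat) x : Prop :=
  if i is j.+1 then U j x else x = 0.

(* The filtration U_0, U_1, .. of an ordinary F-crystal; it is unique. *)
Definition is_slope_filtration r (H : fcrystal_data r)
    (U : nat -> 'cV[A]_r -> Prop) : Prop :=
  forall i,
    [/\ is_sub_fcrystal H (U i),
        forall x, fil_pred U i x -> U i x,
        tensor_eq (U i) (conj_fil H i) &
        exists (d : nat) (V : fcrystal_data d), is_unit_fcrystal V /\
          quotient_iso H (U i) (fil_pred U i) (tate_twist V i)].

Section CY3.
Variables (h r : nat) (H : fcrystal_data r).
Variables (U Fil : nat -> 'cV[A]_r -> Prop).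
Variable form : 'cV[A]_r -> 'cV[A]_r -> A.

Definition Hpart (i : nat) (x : 'cV[A]_r) : Prop := U i x /\ Fil i x.

Record is_ordinary_CY3 : Prop := IsOrdinaryCY3 {
  cy3_hodge : is_hodge_fcrystal H Fil;
  cy3_ordinary : is_ordinary H;
  cy3_slope : is_slope_filtration H U;
  cy3_level : level_le H 3;
  cy3_divisible : is_divisible H Fil 3;
  cy3_top : (forall x, U 3%N x) /\ (forall x, Fil 4%N x -> x = 0);
  cy3_form : perfect_alternating form;
  cy3_rank : [/\ free_of_rank (Hpart 0) 1, free_of_rank (Hpart 1) h,
                 free_of_rank (Hpart 2) h & free_of_rank (Hpart 3) 1];
  cy3_form_conn : forall x y,
    (\row_j (form (Dop H j x) y + form x (Dop H j y)) : 'rV[A]_n)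
      = dform (form x y);
  cy3_form_frob : forall phi x y,
    form (frobs H phi x) (frobs H phi y) = p%:R ^+ 3 * phi (form x y);
  cy3_perp31 : forall y, (forall x, Fil 3%N x -> form x y = 0) <-> Fil 1%N y;
  cy3_perp22 : forall y, (forall x, Fil 2%N x -> form x y = 0) <-> Fil 2%N y
}.

(* The map from T = Hom(Omega, A) = 'cV[A]_n to Hom(H^3, H^2) sends theta to
   the g such that g x = theta(nabla x) modulo Fil^3 for all x in H^3. *)
Definition kodaira_spencer_iso : Prop :=
  forall g, hom_on (Hpart 3) (Hpart 2) g ->
    exists! theta : 'cV[A]_n,
      forall x, Hpart 3 x -> Fil 3%N (conn H x *m theta - g x).

Definition cy3_gram : 'M[A]_((1 + h) + (h + 1)) :=
  block_mx 0 (block_mx 0 (- 1%:M) 1%:M 0) (block_mx 0 (- 1%:M) 1%:M 0) 0.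

Definition cy3_slopes : 'M[AK]_((1 + h) + (h + 1)) :=
  block_mx (block_mx 1%:M 0 0 (p%:R)%:M) 0
           0 (block_mx (p%:R ^+ 2)%:M 0 0 (p%:R ^+ 3)%:M).

Definition cy3_periods (Z : AK) (tau23 tau13 : 'cV[AK]_h) (tau12 : 'M[AK]_h) :
    'M[AK]_((1 + h) + (h + 1)) :=
  block_mx (block_mx 1%:M tau23^T 0 1%:M) 0 0 (block_mx 1%:M tau23 0 1%:M) *m
  block_mx 1%:M (block_mx (- tau13^T) Z%:M tau12 tau13) 0 1%:M.

(* The columns of e0, e1, e2, e3 are e_0; e_1, .., e_h; e_(h+1), .., e_(2h);
   e_(2h+1). *)
Record is_adapted_basis (e0 : 'cV[A]_r) (e1 e2 : 'M[A]_(r, h)) (e3 : 'cV[A]_r)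
    (T : 'M[AK]_((1 + h) + (h + 1))) : Prop := IsAdaptedBasis {
  adapted_basis : is_basis_of (fun _ => True) (row_mx (row_mx e0 e1) (row_mx e2 e3));
  adapted_parts : [/\ Hpart 0 e0, forall j, Hpart 1 (col j e1),
                      forall j, Hpart 2 (col j e2) & Hpart 3 e3];
  adapted_gram : let e := row_mx (row_mx e0 e1) (row_mx e2 e3) in
    \matrix_(i, j) form (col i e) (col j e) = cy3_gram;
  adapted_conn : let e := row_mx (row_mx e0 e1) (row_mx e2 e3) in
    forall (i : 'I_n) j,
      map_mx toAK (Dop H i (col j e)) =
      map_mx toAK e *m col j (invmx T *m map_mx (mps_deriv i) T);
  adapted_frob : let e := row_mx (row_mx e0 e1) (row_mx e2 e3) in
    forall psi, exists Tpsi : 'M[AK]_((1 + h) + (h + 1)),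
      (forall i j, frob_ext psi (T i j) (Tpsi i j)) /\
      (forall j, map_mx toAK (frobs H psi (col j e)) =
        map_mx toAK e *m col j (invmx T *m cy3_slopes *m Tpsi))
}.
End CY3.

(* q = exp(tau(0)) exp(tau - tau(0)): the first factor is a p-adic sum; in the
   second one only the terms of index <= deg m contribute to the coefficient
   of a monomial m. *)
Definition is_exp (tau q : AK) : Prop :=
  exists2 c : K, has_sum padicK (fun l : nat => tau 0%MM ^+ l / l`!%:R) c &
    forall m, q m = c * \sum_(l < (mdeg m).+1)
                          ((tau - mpsC n (tau 0%MM)) ^+ l) m / l`!%:R.

(* A = W[[t_1, .., t_n]] is a regular local ring of dimension n + 1, so that a
   regular system of parameters is a sequence of n + 1 elements which
   generates the ideal of non-units. *)
Definition regular_parameters (s : seq A) : Prop :=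
  size s = n.+1 /\
  forall a : A, a \isn't a GRing.unit <->
    exists c : 'I_(size s) -> A, a = \sum_i c i * s`_i.

(* a is the value at x_1, .., x_h of the power series c; the coefficientwise
   p-adic topology on A is that of its maximal ideal. *)
Definition is_expansion h (x : 'I_h -> A) (c : {mps W[h]}) (a : A) : Prop :=
  forall m, has_sum padicW (fun l : 'X_{1..h} => c l * mmap1 x l m) (a m).

(* A = W[[x_1, .., x_h]] *)
Definition power_series_coordinates h (x : 'I_h -> A) : Prop :=
  (forall c, exists a, is_expansion x c a) /\
  (forall a, exists! c, is_expansion x c a).

End Crystals.

(* Main.v *)
(* Since p > 3, p^|m|/m! has valuation at least min(|m|, 3), so by Griffiths
   transversality and the series for chi every lift of Frobenius phi satisfies
   F(phi) phi^* Fil^i H <= p^i H.  Read in the adapted basis, this and the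
   integrality of nabla give d tau_i = sum_j g_ij dt_j with g_ij in A and
   phi(tau_i) - p tau_i in p A; Dwork's lemma then shows that q_i = exp(tau_i)
   lies in A.  The Kodaira-Spencer map has the matrix g, so n = h and g is
   invertible; as dq_i = q_i sum_j g_ij dt_j, the Jacobian of the q_i is
   invertible and the q_i - 1 are coordinates.  If phi(q_i) = q_i^p, horizontality
   of F and the injectivity of the p-adic exponential give phi(tau_i) = p tau_i.
   The last entry in the first row of T^-1 P phi(T) is then phi(Z) - p^3 Z; it is
   divisible by p^3 because e_(2h+1) lies in Fil^3. *)
Require Import Defs.
From HB Require Import structures.
From mathcomp Require Import all_boot all_order all_algebra.
From mathcomp Require Import boolp generic_quotient.
From mathcomp Require Import fraction mpoly zify ring.
Set Implicit Arguments.
Unset Strict Implicit.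
Unset Printing Implicit Defensive.
Import GRing.Theory.
Local Open Scope ring_scope.

(** * Witt vectors *)

Section UniversalWitt.

(** [W] is known only through Witt coordinates, so its p-adic topology is recovered from one fact:
    multiplication by p shifts the coordinates and raises them to the power p. The main obstacle is
    that series over K such as tau_i and Z have unbounded denominators: for a general lift phi the
    value phi(t)(0) is merely divisible by p, each coefficient of phi(f) is an infinite p-adic sum
    that need not exist, and its compatibility with exp is not formal. Two devices avoid a general
    theory. Integrality of the q_i is proved with the lift t_i -> t_i^p alone, for which a
    coefficient of psi(f) comes from a single coefficient of f. For a lift with phi(q_i) = q_i^p,
    phi and exp are compared only at t = 0; the rest is read off derivatives in A, where phi is a
    ring morphism. The value at 0 is indispensable, since logarithmic derivatives leave the constant
    phi(tau_i) - p tau_i undetermined. The bound p > 3 enters as 4 v(l!) <= l, which makes a^l / l!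
    integral and small for a in pW. *)

Lemma eval2_rmorph (R S : comNzRingType) (f : {rmorphism R -> S}) n
    (P : {mpoly int[n.+1 + n.+1]}) (x y : nat -> R) :
  f (eval2 P x y) = eval2 P (f \o x) (f \o y).
Proof.
rewrite /eval2 /mmap rmorph_sum; apply: eq_bigr => m _.
rewrite rmorphM rmorph_int /mmap1 rmorph_prod; congr (_ * _).
by apply: eq_bigr => i _; rewrite rmorphXn; case: split.
Qed.

Lemma eq_eval2 (R : comNzRingType) n (P : {mpoly int[n.+1 + n.+1]})
    (x x' y y' : nat -> R) :
  (forall i, (i <= n)%N -> x i = x' i) -> (forall i, (i <= n)%N -> y i = y' i) ->
  eval2 P x y = eval2 P x' y'.
Proof.
move=> xx yy; rewrite /eval2 /mmap; apply: eq_bigr => m _; congr (_ * _).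
rewrite /mmap1; apply: eq_bigr => i _; congr (_ ^+ _).
by case: split => j; [apply: xx | apply: yy]; rewrite -ltnS ltn_ord.
Qed.

Variable p : nat.

Lemma ghost_recr (R : comNzRingType) (x : nat -> R) n :
  ghost p x n = \sum_(i < n) p%:R ^+ i * x i ^+ (p ^ (n - i)) + p%:R ^+ n * x n.
Proof. by rewrite /ghost big_ord_recr /= subnn expn0 expr1. Qed.

Lemma ghost0 (R : comNzRingType) (x : nat -> R) : ghost p x 0 = x 0%N.
Proof. by rewrite ghost_recr big_ord0 add0r expr0 mul1r. Qed.

Definition congp (R : comNzRingType) e (a b : R) := exists c, a - b = p%:R ^+ e * c.

Section Cong.
Variable R : comNzRingType.
Implicit Types a b : R.

Lemma congpD e a b a' b' : congp e a b -> congp e a' b' -> congp e (a + a') (b + b').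
Proof.
by move=> [c Hc] [c' Hc']; exists (c + c'); rewrite opprD addrACA Hc Hc' mulrDr.
Qed.

Lemma congp_sum e (I : finType) (P : pred I) (F G : I -> R) :
  (forall i, P i -> congp e (F i) (G i)) ->
  congp e (\sum_(i | P i) F i) (\sum_(i | P i) G i).
Proof.
move=> FG; elim/big_ind2: _ => //; last by move=> *; apply: congpD.
by exists 0; rewrite subrr mulr0.
Qed.

Lemma congpM e i a b : congp e a b -> congp (i + e) (p%:R ^+ i * a) (p%:R ^+ i * b).
Proof. by case=> c Hc; exists c; rewrite -mulrBr Hc mulrA exprD. Qed.

(** In a^p - b^p = (a - b) s, each of the p terms of s is congruent to b^(p-1) modulo p, so s itself
    is divisible by p. *)
Lemma congpX e a b : congp e.+1 a b -> congp e.+2 (a ^+ p) (b ^+ p).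
Proof.
case=> c Hc; pose s := \sum_(i < p) a ^+ (p.-1 - i) * b ^+ i.
have [d Hd] : exists d, s = p%:R * d.
  have [d Hd] : congp 1 s (\sum_(i < p) b ^+ p.-1).
    apply: congp_sum => i _.
    have -> : b ^+ p.-1 = b ^+ (p.-1 - i) * b ^+ i.
      by rewrite -exprD subnK // -ltnS prednK ?(leq_ltn_trans _ (ltn_ord i)).
    rewrite /congp -mulrBl subrXX Hc exprS expr1 -!mulrA.
    by eexists; reflexivity.
  exists (d + b ^+ p.-1); rewrite mulrDr -[in RHS](expr1 p%:R) -Hd expr1.
  by rewrite sumr_const card_ord mulr_natl subrK.
by exists (c * d); rewrite subrXX -/s Hc Hd mulrACA -exprSr.
Qed.

Lemma congpXn e a b : congp 1 a b -> congp e.+1 (a ^+ (p ^ e)) (b ^+ (p ^ e)).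
Proof.
by move=> ab; elim: e => [|e IH] //; rewrite expnSr !exprM; apply: congpX.
Qed.
End Cong.

(** Induction on n: congruences modulo p of the lower components become congruences modulo p^(n+1)
    of the terms p^i a_i^(p^(n-i)). This leaves p^n (a_n - b_n), from which p^n is cancelled. *)
Lemma ghost_congp (R : idomainType) (a b : nat -> R) : (p%:R : R) != 0 ->
  (forall n, congp n.+1 (ghost p a n) (ghost p b n)) -> forall n, congp 1 (a n) (b n).
Proof.
move=> p0 ab n; elim/ltn_ind: n => n IH.
have [c Hc] := ab n.
have [d Hd] : congp n.+1 (\sum_(i < n) p%:R ^+ i * a i ^+ (p ^ (n - i)))
                  (\sum_(i < n) p%:R ^+ i * b i ^+ (p ^ (n - i))).
  apply: congp_sum => i _.
  have -> : n.+1 = (i + (n - i).+1)%N by rewrite addnS subnKC // ltnW.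
  by apply: congpM; apply: congpXn; apply: IH.
exists (c - d); apply: (mulfI (expf_neq0 n p0)).
rewrite [RHS]mulrA -exprD addn1 [RHS]mulrBr -Hc -Hd !ghost_recr mulrBr.
by ring.
Qed.

(** [iter j] starts at [y], so this is the (j+1)-fold Witt sum; the multiple p is
    [witt_muln S y p.-1]. *)
Definition witt_muln (S : forall n, {mpoly int[n.+1 + n.+1]}) (R : comNzRingType)
    (y : nat -> R) j : nat -> R :=
  iter j (fun z i => eval2 (S i) z y) y.

Lemma ghost_witt_muln S (R : comNzRingType) (y : nat -> R) j n :
  witt_law p (fun R => @GRing.add R) S ->
  ghost p (witt_muln S y j) n = ghost p y n *+ j.+1.
Proof.
move=> HS; elim: j => [|j IH]; first by rewrite /witt_muln /= mulr1n.
by rewrite /witt_muln iterS -/(witt_muln S y j) HS IH -mulrSr.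
Qed.

Lemma witt_muln_rmorph S (R R' : comNzRingType) (f : {rmorphism R -> R'}) y j i :
  f (witt_muln S y j i) = witt_muln S (f \o y) j i.
Proof.
elim: j i => [|j IH] i //.
rewrite /witt_muln !iterS -/(witt_muln S y j) -/(witt_muln S (f \o y) j).
by rewrite eval2_rmorph; apply: eq_eval2 => l _ //=; rewrite IH.
Qed.

Lemma eq_witt_muln S (R : comNzRingType) (y y' : nat -> R) j n :
  (forall i, (i <= n)%N -> y i = y' i) ->
  forall i, (i <= n)%N -> witt_muln S y j i = witt_muln S y' j i.
Proof.
move=> yy; elim: j => [|j IH] i ni; first exact: yy.
rewrite /witt_muln !iterS; apply: eq_eval2 => l li; last exact/yy/(leq_trans li).
exact/IH/(leq_trans li).
Qed.

(* The shift of the p-th powers has the ghost components of p x modulo p^(n+1). *)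
Lemma witt_mulp S (k : fieldType) (y : nat -> k) n :
  p \in [pchar k] -> witt_law p (fun R => @GRing.add R) S ->
  witt_muln S y p.-1 n = if n is i.+1 then y i ^+ p else 0.
Proof.
move=> ck HS; have p_gt0 := prime_gt0 (pcharf_prime ck).
(* The congruence modulo p is proved for indeterminates over int, where p can be cancelled, and then
   specialised to [k], where p is 0. *)
pose R := {mpoly int[n.+1]}; pose x i : R := 'X_(inord i).
pose b i : R := if i is j.+1 then x j ^+ p else 0.
have p0 : (p%:R : R) != 0.
  by rewrite -mpolyC_nat mpolyC_eq0 Num.Theory.pnatr_eq0 -lt0n.
have [c Hc] : congp 1 (witt_muln S x p.-1 n) (b n).
  apply: ghost_congp => // i; exists (x i).
  rewrite ghost_witt_muln // prednK // ghost_recr /ghost big_ord_recl /=.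
  rewrite expr0n expn_eq0 (gtn_eqF p_gt0) mulr0 add0r.
  rewrite -[(_ + _) *+ p]mulr_natl mulrDr mulr_sumr mulrA -exprS addrAC.
  apply/eqP; rewrite -subr_eq0 addrK subr_eq0; apply/eqP/eq_bigr => j _.
  by rewrite mulrA -exprS -exprM -expnS /bump add0n -subSn // ltnW.
pose f : {rmorphism R -> k} := mmap intr (fun i : 'I_n.+1 => y i).
have fx i : (i <= n)%N -> f (x i) = y i.
  by move=> ni; rewrite /f /= mmapX mmap1U inordK.
have fb i : (i <= n)%N -> f (b i) = if i is j.+1 then y j ^+ p else 0.
  by case: i => [|i] ni; rewrite /b ?rmorph0 // rmorphXn fx // ltnW.
move/(congr1 f): Hc; rewrite rmorphB rmorphM rmorphXn rmorph_nat (pcharf0 ck).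
rewrite expr1 mul0r => /eqP; rewrite subr_eq0 => /eqP; rewrite witt_muln_rmorph.
rewrite (@eq_witt_muln S _ _ y _ n) //; move=> ->.
by apply: fb.
Qed.
End UniversalWitt.

Section Residue.
Variables (p : nat) (k : fieldType) (W : witt_vectors p k).

Lemma residueD (a b : W) : residue (a + b) = residue a + residue b.
Proof.
case: (witt_coord_add W) => S HS HD; rewrite /residue HD.
by have := HS _ (witt_coord a) (witt_coord b) 0%N; rewrite !ghost0.
Qed.

Lemma residueM (a b : W) : residue (a * b) = residue a * residue b.
Proof.
case: (witt_coord_mul W) => S HS HM; rewrite /residue HM.
by have := HS _ (witt_coord a) (witt_coord b) 0%N; rewrite !ghost0.
Qed.

Lemma residue_surj (c : k) : exists w : W, residue w = c.
Proof.
have [g _ gK] := witt_coord_bij W.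
by exists (g (fun=> c)); rewrite /residue gK.
Qed.

Fact residue_is_zmod_morphism : zmod_morphism (@residue p k W).
Proof.
move=> a b; apply: (addIr (residue b)).
by rewrite -residueD !subrK.
Qed.

Fact residue_is_monoid_morphism : monoid_morphism (@residue p k W).
Proof.
split; last exact: residueM.
(* The coordinates of 1 are not part of the data; an element of residue 1 forces [residue 1 = 1]. *)
have [w rw] := residue_surj 1.
by have := residueM 1 w; rewrite mul1r rw mulr1.
Qed.

HB.instance Definition _ := GRing.isZmodMorphism.Build W k (@residue p k W)
  residue_is_zmod_morphism.
HB.instance Definition _ := GRing.isMonoidMorphism.Build W k (@residue p k W)
  residue_is_monoid_morphism.

HB.instance Definition _ := GRing.isZmodMorphism.Build W {fraction W} (@toK p k W)
  (@tofrac_is_zmod_morphism W).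
HB.instance Definition _ := GRing.isMonoidMorphism.Build W {fraction W} (@toK p k W)
  (@tofrac_is_monoid_morphism W).

Lemma toK_inj : injective (@toK p k W).
Proof. by move=> a b /eqP; rewrite /toK tofrac_eq => /eqP. Qed.
End Residue.

Section WittVectors.
Variables (p : nat) (k : closedFieldType) (W : witt_vectors p k).
Hypothesis char_k : p \in [pchar k].
Implicit Types (w a b : W).

Let p_prime : prime p := pcharf_prime char_k.
Let p_gt0 : (0 < p)%N := prime_gt0 p_prime.

(** This is the identity p = VF of characteristic p, Frobenius followed by the shift of
    coordinates. *)
Lemma witt_coord_mulp w n :
  witt_coord (p%:R * w) n = if n is i.+1 then witt_coord w i ^+ p else 0.
Proof.
case: (witt_coord_add W) => S HS HD.
have H j m : witt_coord (j.+1%:R * w) m = witt_muln S (witt_coord w) j m.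
  elim: j m => [|j IH] m; first by rewrite mul1r.
  rewrite mulrSr mulrDl mul1r HD /witt_muln iterS.
  by apply: eq_eval2 => // i _; rewrite IH.
by have := H p.-1 n; rewrite witt_mulp // prednK.
Qed.

Lemma witt_coord_inj a b : witt_coord a =1 witt_coord b -> a = b.
Proof. by move=> ab; apply: (bij_inj (witt_coord_bij W)); apply: funext. Qed.

Lemma witt_coord_onto (c : nat -> k) : exists w : W, witt_coord w = c.
Proof. by have [g _ gK] := witt_coord_bij W; exists (g c). Qed.

Lemma pth_root (c : k) : exists d, d ^+ p = c.
Proof.
have [d Hd] := @solve_monicpoly k p (fun i => if i is 0%N then c else 0) p_gt0.
exists d; rewrite Hd; case: p p_gt0 => // q _.
by rewrite big_ord_recl mulr1 big1 ?addr0 // => i _; rewrite mul0r.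
Qed.

(** Dividing by p amounts to taking p-th roots of the shifted coordinates, which exist because k is
    algebraically closed. Separation, completeness and the unit criterion of W all rest on this
    description. *)
Lemma padicW_coord N w :
  padicW N w <-> forall i, (i < N)%N -> witt_coord w i = 0.
Proof.
elim: N w => [|N IH] w; first by split => // _; exists w; rewrite mul1r.
split=> [[v ->] i|w0].
  rewrite exprS -mulrA witt_coord_mulp; case: i => // i /ltnSE iN.
  have /IH -> // : padicW N (p%:R ^+ N * v) by exists v.
  by rewrite expr0n gtn_eqF.
have /choice[c Hc] i : exists d : k, d ^+ p = witt_coord w i.+1 by apply: pth_root.
have [v Hv] := witt_coord_onto c.
have {Hc} wv : w = p%:R * v.
  by apply: witt_coord_inj => -[|i]; rewrite witt_coord_mulp ?Hv ?Hc // w0.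
have [u Hu] : padicW N v.
  apply/IH => i iN; have /eqP := w0 i.+1 iN; rewrite wv witt_coord_mulp.
  by rewrite expf_eq0 => /andP[_ /eqP].
by exists u; rewrite wv Hu exprS mulrA.
Qed.

Lemma residue_eq0 w : residue w = 0 <-> padicW 1 w.
Proof.
split=> [w0|/padicW_coord]; last exact.
by apply/padicW_coord => -[].
Qed.

Lemma witt_p_neq0 : (p%:R : W) != 0.
Proof.
(* Coordinate 1 of p = p * 1 is the p-th power of [residue 1], hence nonzero, while that coordinate
   vanishes on p^2 W. *)
apply/eqP => p0; have /padicW_coord : padicW 2 (p%:R : W).
  by exists 0; rewrite p0 mulr0.
move=> /(_ 1%N isT); rewrite -[p%:R]mulr1 witt_coord_mulp.
by apply/eqP; rewrite expf_neq0 // -[witt_coord _ _]/(residue 1) rmorph1 oner_neq0.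
Qed.

Lemma padicWD N a b : padicW N a -> padicW N b -> padicW N (a + b).
Proof. by move=> [u ->] [v ->]; exists (u + v); rewrite mulrDr. Qed.
Lemma padicWN N a : padicW N a -> padicW N (- a).
Proof. by move=> [u ->]; exists (- u); rewrite mulrN. Qed.
Lemma padicWB N a b : padicW N a -> padicW N b -> padicW N (a - b).
Proof. by move=> ? ?; apply/padicWD/padicWN. Qed.
Lemma padicW0 N : padicW N (0 : W).
Proof. by exists 0; rewrite mulr0. Qed.
Lemma padicWM M N a b : padicW M a -> padicW N b -> padicW (M + N) (a * b).
Proof. by move=> [u ->] [v ->]; exists (u * v); rewrite exprD mulrACA. Qed.
Lemma padicW_0 a : padicW 0 a.
Proof. by exists a; rewrite mul1r. Qed.
Lemma padicWS M N a : (M <= N)%N -> padicW N a -> padicW M a.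
Proof.
by move=> MN [u ->]; exists (p%:R ^+ (N - M) * u); rewrite mulrA -exprD subnKC.
Qed.
Lemma padicW_sum N (I : Type) (s : seq I) (P : pred I) (F : I -> W) :
  (forall i, P i -> padicW N (F i)) -> padicW N (\sum_(i <- s | P i) F i).
Proof. by move=> H; elim/big_ind: _ => //; [apply: padicW0 | apply: padicWD]. Qed.

(** Subtraction is not coordinatewise, but coordinate n of a Witt sum depends only on coordinates of
    index at most n. *)
Lemma padicW_congr N a b : padicW N (a - b) <->
  forall i, (i < N)%N -> witt_coord a i = witt_coord b i.
Proof.
case: (witt_coord_add W) => S HS HD.
have c0 i : witt_coord (0 : W) i = 0.
  by have /padicW_coord := padicW0 i.+1; apply.
split=> [/padicW_coord ab i iN|ab].
  rewrite -[a](subrK b) HD -[in RHS](add0r b) HD; apply: eq_eval2 => // j ji.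
  by rewrite ab ?c0 // (leq_ltn_trans ji).
apply/padicW_coord => i iN; rewrite -(c0 i) -(subrr b) !HD.
by apply: eq_eval2 => // j ji; rewrite ab // (leq_ltn_trans ji).
Qed.

Lemma padicW_separated a : (forall N, padicW N a) -> a = 0.
Proof.
move=> a0; apply: witt_coord_inj => i.
by have := a0 i.+1; rewrite -{1}(subr0 a) => /padicW_congr ->.
Qed.

Lemma padicW_complete (u : nat -> W) :
  (forall N, padicW N (u N.+1 - u N)) -> exists s, forall N, padicW N (s - u N).
Proof.
(* Coordinate [i] of the sequence is stable from index [i.+1] on, so the diagonal is the limit. *)
move=> cu; have [s Hs] := witt_coord_onto (fun i => witt_coord (u i.+1) i).
exists s => N; apply/padicW_congr => i iN; rewrite Hs.
have {N iN} [d ->] : exists d, N = (i.+1 + d)%N by exists (N - i.+1)%N; rewrite subnKC.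
elim: d => [|d ->]; first by rewrite addn0.
rewrite addnS; symmetry; have /padicW_congr := cu (i.+1 + d)%N; apply.
by rewrite leq_addr.
Qed.

Lemma witt_unit a : (a \is a GRing.unit) = (residue a != 0).
Proof.
apply/idP/idP=> [/(rmorph_unit (@residue p k W))|a0]; first by rewrite unitfE.
have [v rv] := residue_surj W (residue a)^-1.
have [z Hz] : padicW 1 (1 - a * v).
  by apply/residue_eq0; rewrite rmorphB rmorph1 rmorphM /= rv mulfV // subrr.
(* Partial sums of the geometric series for the inverse of [a * v = 1 - p%:R * z]. *)
pose u N : W := \sum_(i < N) (p%:R * z) ^+ i.
have [|s Hs] := @padicW_complete u.
  move=> N; rewrite /u big_ord_recr addrC addKr exprMn; by exists (z ^+ N).
apply/unitrP; exists (v * s).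
suff e : a * v * s = 1 by split; rewrite -e; ring.
have -> : a * v = 1 - p%:R * z by rewrite -[p%:R]expr1 -Hz subKr.
apply/eqP; rewrite -subr_eq0; apply/eqP/padicW_separated => N.
have -> : (1 - p%:R * z) * s - 1 = (1 - p%:R * z) * (s - u N) - p%:R ^+ N * z ^+ N.
  have := subrX1 (p%:R * z) N; rewrite -/(u N) exprMn => /eqP.
  by rewrite subr_eq => /eqP ->; ring.
apply: padicWB; last by exists (z ^+ N).
by case: (Hs N) => c ->; exists ((1 - p%:R * z) * c); ring.
Qed.

Lemma witt_factor a : a != 0 ->
  exists N u, u \is a GRing.unit /\ a = p%:R ^+ N * u.
Proof.
move=> a0; have [N HN] : exists N, ~ padicW N a.
  apply/not_existsP => H; case/eqP: a0; apply: padicW_separated => N.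
  exact: (contrapT (H N)).
elim: N => [|N IH] in a a0 HN *; first by case: HN; apply: padicW_0.
have [ua|] := boolP (a \is a GRing.unit).
  by exists 0%N, a; rewrite mul1r.
rewrite witt_unit negbK => /eqP/residue_eq0[b ab].
have [||M [u [uu Hu]]] := IH b.
- by apply: contraNneq a0 => b0; rewrite ab b0 mulr0.
- by move=> [c Hc]; apply: HN; exists c; rewrite ab Hc expr1 mulrA -exprS.
by exists M.+1, u; split => //; rewrite ab Hu expr1 mulrA -exprS.
Qed.
End WittVectors.

(** * Power series *)

Lemma mnm_neq0 n (m : 'X_{1..n}) : m != 0%MM -> exists i, m i != 0%N.
Proof.
move=> m0; apply/existsP; move: m0; apply: contraNT; rewrite negb_exists => /forallP m0.
by apply/eqP/mnmP => i; rewrite mnm0E; apply/eqP; have := m0 i; rewrite negbK.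
Qed.

Section MpsTheory.
Variables (n : nat) (R : comNzRingType).
Implicit Types (f g : {mps R[n]}) (m l : 'X_{1..n}) (c : R).

Lemma mpsD f g m : (f + g) m = f m + g m. Proof. by []. Qed.
Lemma mpsN f m : (- f) m = - f m. Proof. by []. Qed.
Lemma mps0 m : (0 : {mps R[n]}) m = 0. Proof. by rewrite /= if_same. Qed.
Lemma mps1 m : (1 : {mps R[n]}) m = (m == 0%MM)%:R. Proof. by rewrite /=; case: eqP. Qed.

Lemma mps_sum (I : Type) (s : seq I) (P : pred I) (F : I -> {mps R[n]}) m :
  (\sum_(i <- s | P i) F i) m = \sum_(i <- s | P i) F i m.
Proof. exact: (big_morph (fun f : {mps R[n]} => f m) (fun f g => mpsD f g m) (mps0 m)). Qed.

Lemma mpsM f g m : (f * g) m =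
  \sum_(k : 'X_{1..n < (mdeg m).+1, (mdeg m).+1} | m == (k.1 + k.2)%MM) f k.1 * g k.2.
Proof. by []. Qed.

Lemma mpsMT d f g m : (mdeg m < d)%N ->
  (f * g) m = (mps_trunc d f * mps_trunc d g)@_m.
Proof. exact: mps_mulT. Qed.

Lemma mpsC_is_zmod_morphism : zmod_morphism (@mpsC n R).
Proof. by move=> a b; apply: mpsP => m /=; case: eqP; rewrite ?subr0. Qed.

Lemma mps_trunc_is_zmod_morphism d : zmod_morphism (@mps_trunc n R d).
Proof.
move=> f g; rewrite /mps_trunc -sumrB; apply: eq_bigr => k _.
by rewrite -scalerBl.
Qed.
HB.instance Definition _ d := GRing.isZmodMorphism.Build {mps R[n]} {mpoly R[n]}
  (@mps_trunc n R d) (mps_trunc_is_zmod_morphism d).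

Lemma mps_truncC d c : mps_trunc d.+1 (mpsC n c) = c%:MP.
Proof.
apply/mpolyP => m; rewrite mcoeffC; have [md|md] := ltnP (mdeg m) d.+1.
  by rewrite mcoeff_trunc //=; case: eqP; rewrite (mulr1, mulr0).
rewrite (_ : (m == 0%MM) = false); last first.
  by apply/eqP => m0; rewrite m0 mdeg0 in md.
rewrite /= mulr0n mulr0 /mps_trunc linear_sum big1 // => -[l ld] _ /=.
rewrite mcoeffZ mcoeffX; case: (l =P m) => [e|_]; last by rewrite mulr0.
by move: md; rewrite -e leqNgt ld.
Qed.

Lemma mpsCMl c f m : (mpsC n c * f) m = c * f m.
Proof.
rewrite (mpsMT (d := (mdeg m).+1)) // mps_truncC mul_mpolyC mcoeffZ.
by rewrite mcoeff_trunc.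
Qed.

Lemma mpsC_is_monoid_morphism : monoid_morphism (@mpsC n R).
Proof.
by split=> // a b; apply: mpsP => m; rewrite mpsCMl /=; case: eqP; rewrite ?mulr0.
Qed.

HB.instance Definition _ := GRing.isZmodMorphism.Build R {mps R[n]} (@mpsC n R)
  mpsC_is_zmod_morphism.
HB.instance Definition _ := GRing.isMonoidMorphism.Build R {mps R[n]} (@mpsC n R)
  mpsC_is_monoid_morphism.

Lemma mpsM0 f g : (f * g) 0%MM = f 0%MM * g 0%MM.
Proof.
by rewrite (mpsMT (d := 1)) ?mdeg0 // rmorphM /= !mcoeff_trunc ?mdeg0.
Qed.

Lemma mps_natE N m : (N%:R : {mps R[n]}) m = if m == 0%MM then N%:R else 0.
Proof. by rewrite -(rmorph_nat (@mpsC n R)). Qed.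

Lemma mps_natMl N f m : (N%:R * f) m = N%:R * f m.
Proof. by rewrite -(rmorph_nat (@mpsC n R)) mpsCMl. Qed.

Lemma mpsX0 f i : (f ^+ i) 0%MM = f 0%MM ^+ i.
Proof.
by elim: i => [|i IH]; [rewrite mps1 eqxx | rewrite !exprS mpsM0 IH].
Qed.

Lemma mps_exp_low f i m : f 0%MM = 0 -> (mdeg m < i)%N -> (f ^+ i) m = 0.
Proof.
move=> f0; elim: i m => // i IH m mi; rewrite exprS mpsM big1 // => -[k1 k2] /= /eqP mk.
have [k0|k0] := eqVneq (k1 : 'X_{1..n}) 0%MM; first by rewrite k0 f0 mul0r.
rewrite IH ?mulr0 //; have := congr1 (@mdeg n) mk; rewrite mdegD.
by move: k0 mi; rewrite -mdeg_eq0; lia.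
Qed.

Definition mpsXm l : {mps R[n]} := MPS (fun m => (m == l)%:R).

Lemma mpsXmM l f m : (mpsXm l * f) m = if (l <= m)%MM then f (m - l)%MM else 0.
Proof.
rewrite mpsM; case: ifP => lm.
  have l1 : (mdeg l < (mdeg m).+1)%N by rewrite -(submK lm) mdegD; lia.
  have l2 : (mdeg (m - l)%MM < (mdeg m).+1)%N by rewrite ltnS mdegB.
  rewrite (bigD1 (BMultinom l1, BMultinom l2)) /=; last by rewrite addmC submK.
  rewrite eqxx mul1r big1 ?addr0 // => -[k1 k2] /= /andP[/eqP mk nk].
  case: eqP => [k1l|]; last by rewrite mul0r.
  case/negP: nk; apply/eqP; congr (_, _); apply: val_inj => //=.
  by move/(congr1 (fun x => (x - l)%MM)): mk; rewrite -k1l addmC addmK => ->.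
rewrite big1 // => -[k1 k2] /= /eqP mk.
case: eqP => [k1l|]; last by rewrite mul0r.
case/negP: (negbT lm); apply/mnm_lepP => i; move/mnmP/(_ i): mk.
by rewrite k1l mnmDE => ->; exact: leq_addr.
Qed.

Lemma mpsXmD l l' : mpsXm (l + l') = mpsXm l * mpsXm l'.
Proof.
apply: mpsP => m; rewrite mpsXmM /=; case: ifP => lm.
  by rewrite -[in LHS](submK lm) [(l + l')%MM]addmC eqm_add2r.
by case: eqP => // ml; rewrite ml lem_addr in lm.
Qed.

Lemma mpsXm0 : mpsXm 0%MM = 1.
Proof. by apply: mpsP => m; rewrite mps1. Qed.

Lemma mpsXmMn l i : mpsXm (l *+ i) = mpsXm l ^+ i.
Proof. by elim: i => [|i IH]; rewrite ?mulm0n ?mpsXm0 // mulmS mpsXmD IH exprS. Qed.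

Lemma mmap1_mpsX l : mmap1 (@mpsX n R) l = mpsXm l.
Proof.
rewrite {2}[l]multinomUE_id /mmap1.
rewrite (big_morph mpsXm mpsXmD mpsXm0); apply: eq_bigr => i _.
by rewrite mpsXmMn.
Qed.

Lemma mpsXE i : mpsX R i = mpsXm U_(i) :> {mps R[n]}. Proof. by []. Qed.

(* mps_div i f is the sum of the monomials of f whose first variable is t_i,
   divided by t_i. *)
Definition mps_div (i : 'I_n) f : {mps R[n]} :=
  MPS (fun m => if [forall j : 'I_n, (j < i)%N ==> (m j == 0%N)] then f (m + U_(i))%MM
                else 0).

Lemma mps_div_sum f : f = mpsC n (f 0%MM) + \sum_(i < n) mpsX R i * mps_div i f.
Proof.
apply: mpsP => m; rewrite mpsD mps_sum (_ : mpsC n (f 0%MM) m = if m == 0%MM then f 0%MM else 0) //.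
have [->|m0] := eqVneq m 0%MM.
  rewrite big1 ?addr0 // => i _; rewrite mpsXE mpsXmM.
  by rewrite lep1mP mnm0E.
have [i0 mi0] := mnm_neq0 m0.
(* A nonconstant monomial is assigned to its first variable [i1], so exactly one summand contributes
   to it. *)
pose i1 := [arg min_(i < i0 | m i != 0%N) (i : nat)].
have [mi1 Hi1] : m i1 != 0%N /\ forall j : 'I_n, (j < i1)%N -> m j = 0%N.
  rewrite /i1; case: arg_minnP => // i mi Hi; split=> // j ji.
  by apply/eqP; apply: contraLR ji => mj; rewrite -leqNgt Hi.
transitivity (\sum_(i < n) (mpsX R i * mps_div i f) m); last by rewrite add0r.
rewrite (bigD1 i1) // big1 => [|i /andP[_ ni]]; last first.
  rewrite mpsXE mpsXmM lep1mP.
  case: ifP => // mi; rewrite /= ifF //; apply/negbTE/negP => /forallP /(_ i1).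
  have lti : (i1 < i)%N.
    rewrite ltn_neqAle eq_sym ni leqNgt; apply/negP => /Hi1 e.
    by rewrite e in mi.
  by rewrite lti mnmBE mnm1E (negbTE ni) subn0 (negbTE mi1).
rewrite Monoid.mulm1 mpsXE mpsXmM lep1mP mi1 /=.
rewrite submK ?lep1mP // ifT //; apply/forallP => j; apply/implyP => ji.
by rewrite mnmBE Hi1.
Qed.

Lemma mps_deriv_is_zmod_morphism i : zmod_morphism (@mps_deriv n R i).
Proof. by move=> f g; apply: mpsP => m /=; rewrite mulrnBl. Qed.
HB.instance Definition _ i := GRing.isZmodMorphism.Build {mps R[n]} {mps R[n]}
  (@mps_deriv n R i) (mps_deriv_is_zmod_morphism i).

Lemma mps_derivC i c : mps_deriv i (mpsC n c) = 0.
Proof.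
apply: mpsP => m; rewrite mps0 /= (_ : (_ == _) = false) ?mul0rn //.
by apply/eqP => /mnmP /(_ i); rewrite mnmDE mnm1E eqxx mnm0E addn1.
Qed.

Lemma mps_derivM i f g :
  mps_deriv i (f * g) = mps_deriv i f * g + f * mps_deriv i g.
Proof.
apply: mpsP => m; rewrite mpsD; pose d := (mdeg m).+2.
have dU k : (mdeg k <= mdeg m)%N -> (mdeg (k + U_(i))%MM < d)%N.
  by rewrite mdegD mdeg1 /d; lia.
have dE k : (mdeg k <= mdeg m)%N -> (mdeg k < d)%N by rewrite /d; lia.
transitivity ((f * g) (m + U_(i))%MM *+ (m i).+1) => //.
rewrite (mpsMT (d := d)) ?dU // -mcoeff_deriv mderivM mcoeffD.
congr (_ + _); rewrite -[RHS]/(mps_mul _ _ m); symmetry; apply: mps_mulE => l lm;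
  by rewrite ?mcoeff_deriv !mcoeff_trunc ?dU ?dE.
Qed.

Lemma mps_derivX i f (l : nat) : mps_deriv i (f ^+ l) = l%:R * f ^+ l.-1 * mps_deriv i f.
Proof.
elim: l => [|l IH].
  rewrite mul0r mul0r; exact: (mps_derivC i 1).
rewrite exprS mps_derivM IH /=; case: l {IH} => [|l] /=; first by ring.
by rewrite (mulrSr 1 l.+1) !exprS; ring.
Qed.

Lemma mps_deriv_mpsX (i j : 'I_n) : mps_deriv i (mpsX R j) = (i == j)%:R.
Proof.
apply: mpsP => m; rewrite mps_natE /=.
have [->|m0] := eqVneq m 0%MM.
  by rewrite add0m eq_mnm1 mnm0E mulr1n; case: eqVneq.
rewrite (_ : (_ == _) = false) ?mul0rn //.
by apply/eqP => /(congr1 mdeg); rewrite mdegD !mdeg1; move: m0; rewrite -mdeg_eq0; lia.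
Qed.
End MpsTheory.

Section MpsMap.
Variables (n : nat) (R S : comNzRingType) (u : {rmorphism R -> S}).

Lemma mps_map_is_zmod_morphism : zmod_morphism (@mps_map n R S u).
Proof. by move=> f g; apply: mpsP => m /=; rewrite rmorphB. Qed.

Lemma mps_mapC c : mps_map u (mpsC n c) = mpsC n (u c).
Proof. by apply: mpsP => m /=; case: eqP; rewrite ?rmorph0. Qed.

Lemma mps_map_is_monoid_morphism : monoid_morphism (@mps_map n R S u).
Proof.
split=> [|f g]; first by rewrite -[1]/(mpsC n 1) mps_mapC rmorph1.
apply: mpsP => m; rewrite /= -/(@mps_mul _ _ f g) rmorph_sum.
by apply: eq_bigr => k _; rewrite rmorphM.
Qed.

HB.instance Definition _ := GRing.isZmodMorphism.Build {mps R[n]} {mps S[n]}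
  (@mps_map n R S u) mps_map_is_zmod_morphism.
HB.instance Definition _ := GRing.isMonoidMorphism.Build {mps R[n]} {mps S[n]}
  (@mps_map n R S u) mps_map_is_monoid_morphism.

Lemma mps_map_deriv (i : 'I_n) f : mps_map u (mps_deriv i f) = mps_deriv i (mps_map u f).
Proof. by apply: mpsP => m /=; rewrite rmorphMn. Qed.

Lemma mps_mapX (i : 'I_n) : mps_map u (mpsX R i) = mpsX S i :> {mps S[n]}.
Proof. by apply: mpsP => m /=; rewrite rmorph_nat. Qed.

Lemma mps_map_inj : injective u -> injective (@mps_map n R S u).
Proof.
by move=> ui f g fg; apply: mpsP => m; apply: ui; exact: (congr1 (fun h : {mps S[n]} => h m) fg).
Qed.
End MpsMap.

Lemma mmap1_rmorph n (R S : comNzRingType) (u : {rmorphism R -> S}) (x : 'I_n -> R) l :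
  u (mmap1 x l) = mmap1 (u \o x) l.
Proof. by rewrite /mmap1 rmorph_prod; apply: eq_bigr => i _; rewrite rmorphXn. Qed.

Section MapsToMps.
Variables (p : nat) (k : fieldType) (W : witt_vectors p k) (n : nat).
HB.instance Definition _ := GRing.RMorphism.copy (@toAK p k W n) (mps_map (@toK p k W)).
HB.instance Definition _ := GRing.RMorphism.copy (@reduction p k W n) (mps_map (@residue p k W)).
Lemma toAK_inj : injective (@toAK p k W n).
Proof. exact: mps_map_inj (@toK_inj p k W). Qed.
Lemma toAKC (w : W) : toAK (mpsC n w) = mpsC n (toK w).
Proof. exact: mps_mapC. Qed.
Lemma reductionC (w : W) : reduction (mpsC n w) = mpsC n (residue w).
Proof. exact: mps_mapC. Qed.
End MapsToMps.

(** * Convergence and substitution *)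

Section HasSum.
Variables (V : zmodType) (nb : nat -> V -> Prop).
Hypotheses (nb0 : forall N, nb N 0) (nbB : forall N a b, nb N a -> nb N b -> nb N (a - b)).

Lemma nbN N a : nb N a -> nb N (- a).
Proof. by rewrite -[- a]sub0r; apply: nbB. Qed.

Lemma nbD N a b : nb N a -> nb N b -> nb N (a + b).
Proof. by move=> ha hb; rewrite -[b]opprK; apply/nbB => //; apply: nbN. Qed.

Lemma nb_sum N (I : Type) (s : seq I) (P : pred I) (F : I -> V) :
  (forall i, P i -> nb N (F i)) -> nb N (\sum_(i <- s | P i) F i).
Proof. by move=> H; elim/big_ind: _ => //; apply: nbD. Qed.

Lemma has_sum_term (I : eqType) (f : I -> V) s N : has_sum nb f s ->
  exists E0 : seq I, forall i, i \notin E0 -> nb N (f i).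
Proof.
move=> /(_ N)[E0 HE]; exists E0 => i iE.
have h1 := HE (undup E0) (undup_uniq _) (fun j => etrans (mem_undup _ _)).
have h2 : nb N (s - \sum_(j <- i :: undup E0) f j).
  apply: HE; first by rewrite /= mem_undup iE undup_uniq.
  by move=> j jE; rewrite inE mem_undup jE orbT.
by move: (nbB h1 h2); rewrite big_cons opprB addrC subrKA addrK.
Qed.

Section Multinomials.
Variable h : nat.
Implicit Types (f : 'X_{1..h} -> V) (l : 'X_{1..h}).

(** The neighbourhoods are subgroups, so any finite set of terms of large degree has a small sum.
    Nets of finite index sets are thus replaced by truncation in degree. *)
Lemma has_sum_mdeg f s : has_sum nb f s <->
  forall N, exists D0, (forall l, (D0 <= mdeg l)%N -> nb N (f l)) /\
    forall D, (D0 <= D)%N -> nb N (s - \sum_(l : 'X_{1..h < D}) f l).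
Proof.
have uD D : uniq [seq val l | l : 'X_{1..h < D}].
  by rewrite map_inj_uniq ?enum_uniq //; apply: val_inj.
have mD D l : (l \in [seq val l | l : 'X_{1..h < D}]) = (mdeg l < D)%N.
  apply/mapP/idP => [[l' _ ->]|lD]; first exact: bmdeg.
  by exists (BMultinom lD); rewrite ?mem_enum.
have sD D : \sum_(l <- [seq val l | l : 'X_{1..h < D}]) f l =
            \sum_(l : 'X_{1..h < D}) f l.
  by rewrite big_map big_enum.
split=> fs N.
  have [E1 H1] := has_sum_term N fs; have [E2 H2] := fs N.
  exists (\max_(l <- E1 ++ E2) (mdeg l)).+1.
  have mx l : l \in E1 ++ E2 -> (mdeg l <= \max_(l <- E1 ++ E2) (mdeg l))%N.
    by move=> lE; apply: leq_bigmax_seq.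
  split=> [l|D DM].
    rewrite ltnNge => lm; apply: H1; apply: contra lm => lE.
    by apply: mx; rewrite mem_cat lE.
  rewrite -sD; apply: H2 => // l lE; rewrite mD.
  by apply: leq_trans DM; rewrite ltnS mx // mem_cat lE orbT.
have [D [HD1 HD2]] := fs N.
exists [seq val l | l : 'X_{1..h < D}] => E uE sE.
rewrite (bigID (fun l => mdeg l < D)%N) /= opprD addrA.
have -> : \sum_(l <- E | (mdeg l < D)%N) f l = \sum_(l : 'X_{1..h < D}) f l.
  rewrite -sD -big_filter; apply: perm_big; apply: uniq_perm => //.
    exact: filter_uniq.
  move=> l; rewrite mem_filter mD; case: ltnP => //= lD.
  by apply: sE; rewrite mD.
apply: nbB; first exact: HD2.
by apply: nb_sum => l; rewrite -leqNgt; apply: HD1.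
Qed.
End Multinomials.

Hypothesis nb_sep : forall a, (forall N, nb N a) -> a = 0.

Lemma has_sum_unique (I : eqType) (f : I -> V) s s' :
  has_sum nb f s -> has_sum nb f s' -> s = s'.
Proof.
move=> fs fs'; apply/eqP; rewrite -subr_eq0; apply/eqP/nb_sep => N.
have [E1 H1] := fs N; have [E2 H2] := fs' N.
have h1 := H1 (undup (E1 ++ E2)) (undup_uniq _).
have h2 := H2 (undup (E1 ++ E2)) (undup_uniq _).
rewrite -(subrKA (\sum_(i <- undup (E1 ++ E2)) f i)) -[X in _ + X]opprB.
by apply: nbB; [apply: h1 | apply: h2] => i iE; rewrite mem_undup mem_cat iE ?orbT.
Qed.
End HasSum.

Section Iadic.
Variables (p : nat) (k : closedFieldType) (W : witt_vectors p k).
Hypothesis char_k : p \in [pchar k].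

Section Filtration.
Variable n : nat.
Implicit Types (f g : {mps W[n]}) (m l : 'X_{1..n}).

(* The power series of the d-th power of the maximal ideal (p, t_1, .., t_n). *)
Definition Iad d f := forall m, padicW (d - mdeg m) (f m).

Lemma Iad_0 f : Iad 0 f.
Proof. by move=> m; rewrite sub0n; apply: padicW_0. Qed.
Lemma Iad0 d : Iad d (0 : {mps W[n]}).
Proof. by move=> m; rewrite mps0; apply: padicW0. Qed.
Lemma IadD d f g : Iad d f -> Iad d g -> Iad d (f + g).
Proof. by move=> df dg m; apply: padicWD. Qed.
Lemma IadN d f : Iad d f -> Iad d (- f).
Proof. by move=> df m; apply: padicWN. Qed.
Lemma IadB d f g : Iad d f -> Iad d g -> Iad d (f - g).
Proof. by move=> df dg; apply/IadD/IadN. Qed.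
Lemma Iad_sum d (I : Type) (s : seq I) (P : pred I) (F : I -> {mps W[n]}) :
  (forall i, P i -> Iad d (F i)) -> Iad d (\sum_(i <- s | P i) F i).
Proof. by move=> H; elim/big_ind: _ => //; [apply: Iad0 | apply: IadD]. Qed.
Lemma IadS d e f : (d <= e)%N -> Iad e f -> Iad d f.
Proof. by move=> de ef m; apply: padicWS (ef m); rewrite leq_sub2r. Qed.

Lemma IadM d e f g : Iad d f -> Iad e g -> Iad (d + e) (f * g).
Proof.
move=> df eg m; rewrite mpsM; apply: padicW_sum => -[k1 k2] /= /eqP mk.
apply: padicWS (padicWM (df k1) (eg k2)).
by move/(congr1 (@mdeg n)): mk; rewrite mdegD; clear; lia.
Qed.

Lemma IadMl d f g : Iad d g -> Iad d (f * g).
Proof. by move=> dg; rewrite -[d]add0n; apply: IadM => //; apply: Iad_0. Qed.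

Lemma IadX d f : Iad 1 f -> Iad d (f ^+ d).
Proof.
move=> f1; elim: d => [|d IH]; first exact: Iad_0.
by rewrite exprS -add1n; apply: IadM.
Qed.

Lemma Iad1P f : Iad 1 f <-> padicW 1 (f 0%MM).
Proof.
split=> [/(_ 0%MM)|f0 m]; first by rewrite mdeg0.
have [->|] := eqVneq m 0%MM; first by rewrite mdeg0.
rewrite -mdeg_eq0; case: (mdeg m) => // d _; exact: padicW_0.
Qed.

Lemma Iad_mpsC d (w : W) : Iad d (mpsC n (p%:R ^+ d * w)).
Proof.
move=> m /=; case: eqP => _; last exact: padicW0.
by apply: (@padicWS _ _ _ _ d); [rewrite leq_subr | exists w].
Qed.

Lemma Iad_p : Iad 1 (p%:R : {mps W[n]}).
Proof. by rewrite -(rmorph_nat (@mpsC n W)) -[p%:R]mulr1 -{1}[p%:R]expr1; apply: Iad_mpsC. Qed.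

Lemma Iad_mpsX i : Iad 1 (mpsX W i : {mps W[n]}).
Proof.
by apply/Iad1P; rewrite /= eq_sym mnm1_eq0; apply: padicW0.
Qed.

Lemma Iad_sep f : (forall d, Iad d f) -> f = 0.
Proof.
move=> fd; apply: mpsP => m; rewrite mps0; apply: (padicW_separated char_k) => N.
by have := fd (N + mdeg m)%N m; rewrite addnK.
Qed.

Lemma Iad_complete (u : nat -> {mps W[n]}) :
  (forall d, Iad d (u d.+1 - u d)) -> exists s, forall d, Iad d (s - u d).
Proof.
move=> cu.
have /choice[s Hs] m : exists s : W, forall N, padicW N (s - u (N + mdeg m)%N m).
  apply: (@padicW_complete _ _ _ char_k (fun N => u (N + mdeg m)%N m)) => N.
  by have := cu (N + mdeg m)%N m; rewrite addnK.
exists (MPS s) => d m; have [dm|md] := leqP d (mdeg m).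
  by rewrite (eqP dm); apply: padicW_0.
by have := Hs m (d - mdeg m)%N; rewrite subnK // ltnW.
Qed.

Lemma Iad_decomp d f : Iad d.+1 f -> exists a0 (a : 'I_n -> {mps W[n]}),
  [/\ Iad d a0, forall i, Iad d (a i) & f = p%:R * a0 + \sum_i mpsX W i * a i].
Proof.
move=> fd; have [w f0] := fd 0%MM; rewrite mdeg0 subn0 in f0.
exists (mpsC n (p%:R ^+ d * w)), (fun i => mps_div i f); split.
- exact: Iad_mpsC.
- move=> i m /=; case: ifP => _; last exact: padicW0.
  by apply: padicWS (fd _); rewrite mdegD mdeg1; clear; lia.
- rewrite [LHS]mps_div_sum; congr (_ + _).
  by rewrite -(rmorph_nat (@mpsC n W)) -rmorphM /= f0 exprS mulrA.
Qed.
End Filtration.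

(** Continuity is automatic: p is mapped to p, and [Iad_decomp] peels off one generator of the ideal
    at a time. *)
Lemma Iad_rmorph n h (F : {rmorphism {mps W[n]} -> {mps W[h]}}) :
  (forall i, Iad 1 (F (mpsX W i))) -> forall d f, Iad d f -> Iad d (F f).
Proof.
move=> F1 d; elim: d => [|d IH] f; first by move=> _; apply: Iad_0.
case/Iad_decomp => a0 [a [Ha0 Ha ->]]; rewrite rmorphD rmorphM rmorph_nat rmorph_sum.
rewrite -add1n; apply: IadD; first by apply: IadM (IH _ _) => //; apply: Iad_p.
by apply: Iad_sum => i _; rewrite rmorphM; apply: IadM (IH _ _).
Qed.

Section Substitution.
Variables (n h : nat) (x : 'I_h -> {mps W[n]}).
Implicit Types (c : {mps W[h]}) (a : {mps W[n]}) (P : {mpoly W[h]}).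

(** The adic form of [is_expansion], with an explicit rate: truncation in degree d leaves an error
    in the d-th power of the maximal ideal. It is easier to manipulate, and [is_expansionP] shows
    the two to agree. *)
Definition expd c a := forall d, Iad d (a - mmap (@mpsC n W) x (mps_trunc d c)).

Lemma mmap_trunc d c : mmap (@mpsC n W) x (mps_trunc d c) =
  \sum_(l : 'X_{1..h < d}) mpsC n (c l) * mmap1 x l.
Proof. by rewrite raddf_sum; apply: eq_bigr => l _; rewrite /= mmapZ mmapX. Qed.

Hypothesis x1 : forall i, Iad 1 (x i).

Lemma Iad_mmap1 l : Iad (mdeg l) (mmap1 x l).
Proof.
rewrite mdegE /mmap1; elim/big_ind2: _ => [|d f e g df eg|i _].
- exact: Iad_0.
- exact: IadM.
- exact: IadX.
Qed.

Lemma Iad_mmap d P : (forall l, (mdeg l < d)%N -> P@_l = 0) ->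
  Iad d (mmap (@mpsC n W) x P).
Proof.
move=> P0; apply: Iad_sum => l _.
have [/P0 l0|dl] := ltnP (mdeg l) d; first by rewrite l0 rmorph0 mul0r; apply: Iad0.
by apply: IadMl; apply: IadS dl (Iad_mmap1 l).
Qed.

Lemma expd_exists c : exists a, expd c a.
Proof.
apply: Iad_complete => d; rewrite -rmorphB; apply: Iad_mmap => l ld.
by rewrite mcoeffB !mcoeff_trunc ?subrr // ltnW.
Qed.

Lemma expd_unique c a b : expd c a -> expd c b -> a = b.
Proof.
move=> ca cb; apply/eqP; rewrite -subr_eq0; apply/eqP/Iad_sep => d.
rewrite -(subrKA (mmap (@mpsC n W) x (mps_trunc d c))) -[X in _ + X]opprB.
by apply: IadB; [apply: ca | apply: cb].
Qed.

Lemma expdB c c' a a' : expd c a -> expd c' a' -> expd (c - c') (a - a').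
Proof.
move=> ca ca' d; rewrite raddfB rmorphB /=; set u := mmap _ _ _; set v := mmap _ _ _.
have -> : a - a' - (u - v) = (a - u) - (a' - v) by ring.
by apply: IadB; [apply: ca | apply: ca'].
Qed.

Lemma expdM c c' a a' : expd c a -> expd c' a' -> expd (c * c') (a * a').
Proof.
move=> ca ca' d; set P := mps_trunc d c; set Q := mps_trunc d c'.
have -> : a * a' - mmap (@mpsC n W) x (mps_trunc d (c * c')) =
   a' * (a - mmap (@mpsC n W) x P) + mmap (@mpsC n W) x P * (a' - mmap (@mpsC n W) x Q)
   + mmap (@mpsC n W) x (P * Q - mps_trunc d (c * c')).
  by rewrite rmorphB rmorphM; ring.
apply: IadD.
  by apply: IadD; apply: IadMl; [apply: ca | apply: ca'].
apply: Iad_mmap => l ld.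
by rewrite mcoeffB mcoeff_trunc // (mpsMT (d := d)) // subrr.
Qed.

Lemma expdC w : expd (mpsC h w) (mpsC n w).
Proof.
case=> [|d]; first exact: Iad_0.
by rewrite mps_truncC mmapC subrr; apply: Iad0.
Qed.

Lemma expdX i : expd (mpsX W i) (x i).
Proof.
move=> d; have -> : x i = mmap (@mpsC n W) x 'X_i by rewrite mmapX mmap1U.
rewrite -rmorphB; apply: Iad_mmap => l ld.
by rewrite mcoeffB mcoeff_trunc // mcoeffX eq_sym subrr.
Qed.

Lemma is_expansionP c a : is_expansion x c a <-> expd c a.
Proof.
(* The converse follows because an adic value exists and coefficientwise sums are unique. *)
suff ex b : expd c b -> is_expansion x c b.
  split=> [ca|]; last exact: ex.
  have [b cb] := expd_exists c; suff -> : a = b by [].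
  apply: mpsP => m; apply: has_sum_unique (ca m) (ex b cb m).
  - by move=> N u v; apply: padicWB.
  - exact: padicW_separated.
move=> cb m; apply/has_sum_mdeg.
- exact: padicW0.
- by move=> N u v; apply: padicWB.
move=> N; exists (N + mdeg m)%N; split=> [l lN|D DN].
  rewrite -[N]add0n; apply: padicWM; first exact: padicW_0.
  by apply: padicWS (Iad_mmap1 l m); lia.
have -> : b m - \sum_(l : 'X_{1..h < D}) c l * mmap1 x l m =
          (b - mmap (@mpsC n W) x (mps_trunc D c)) m.
  rewrite mpsD mpsN mmap_trunc mps_sum; congr (_ - _).
  by apply: eq_bigr => l _; rewrite mpsCMl.
by apply: padicWS (cb D m); lia.
Qed.

Definition msubst c := projT1 (cid (expd_exists c)).

Lemma msubstP c : expd c (msubst c).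
Proof. by rewrite /msubst; case: cid. Qed.

Lemma msubst_is_zmod_morphism : zmod_morphism msubst.
Proof.
by move=> c c'; apply: expd_unique (msubstP _) _; apply: expdB; apply: msubstP.
Qed.

Lemma msubst_is_monoid_morphism : monoid_morphism msubst.
Proof.
split; first by apply: expd_unique (msubstP _) _; apply: (expdC 1).
by move=> c c'; apply: expd_unique (msubstP _) _; apply: expdM; apply: msubstP.
Qed.

HB.instance Definition _ := GRing.isZmodMorphism.Build {mps W[h]} {mps W[n]}
  msubst msubst_is_zmod_morphism.
HB.instance Definition _ := GRing.isMonoidMorphism.Build {mps W[h]} {mps W[n]}
  msubst msubst_is_monoid_morphism.

Lemma msubstC w : msubst (mpsC h w) = mpsC n w.
Proof. exact: expd_unique (msubstP _) (expdC w). Qed.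

Lemma msubstX i : msubst (mpsX W i) = x i.
Proof. exact: expd_unique (msubstP _) (expdX i). Qed.
End Substitution.

Lemma expd_id n (c : {mps W[n]}) : expd (@mpsX n W) c c.
Proof.
move=> d m; have [dm|md] := leqP d (mdeg m).
  by rewrite (eqP dm); apply: padicW_0.
rewrite mpsD mpsN mmap_trunc mps_sum (bigD1 (BMultinom md)) // big1 => [|l].
  rewrite Monoid.mulm1 mmap1_mpsX mpsCMl /= eqxx mulr1 subrr; exact: padicW0.
move=> /andP[_ nl]; rewrite mmap1_mpsX mpsCMl /=.
case: (m =P l) => [e|]; last by rewrite mulr0.
by case/negP: nl; apply/eqP/val_inj.
Qed.

(** By the automatic continuity of [Iad_rmorph], such a morphism is a substitution twisted by s; in
    particular a lift of Frobenius is determined by the images of the t_i. *)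
Lemma rmorph_expd n h (s : {rmorphism W -> W})
    (F : {rmorphism {mps W[h]} -> {mps W[n]}}) (c : {mps W[h]}) :
  (forall w, F (mpsC h w) = mpsC n (s w)) -> (forall i, Iad 1 (F (mpsX W i))) ->
  expd (fun i => F (mpsX W i)) (mps_map s c) (F c).
Proof.
move=> FC F1 d; have := Iad_rmorph F1 (expd_id c d).
rewrite rmorphB !mmap_trunc rmorph_sum /=.
congr (Iad d (_ - _)); apply: eq_bigr => l _.
by rewrite rmorphM FC mmap1_rmorph.
Qed.
End Iadic.

Section LinearCoefficients.
Variables (n : nat) (R : comNzRingType).
Lemma mpsCE0 (c : R) : mpsC n c 0%MM = c. Proof. by rewrite /= eqxx. Qed.
Lemma mpsCE1 (c : R) i : mpsC n c U_(i)%MM = 0. Proof. by rewrite /= mnm1_eq0. Qed.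
Lemma mpsXE0 (i : 'I_n) : mpsX R i 0%MM = 0. Proof. by rewrite /= eq_sym mnm1_eq0. Qed.
Lemma mpsXE1 (i j : 'I_n) : mpsX R i U_(j)%MM = (i == j)%:R.
Proof. by rewrite /= eq_mnm1 eq_sym. Qed.
End LinearCoefficients.

(** * Systems of coordinates and lifts of Frobenius *)

Section Coordinates.
Variables (p : nat) (k : closedFieldType) (W : witt_vectors p k).
Hypothesis char_k : p \in [pchar k].
Variable n : nat.
Local Notation A := {mps W[n]}.

Lemma Iad2P (f : A) : padicW 2 (f 0%MM) -> (forall i, padicW 1 (f U_(i)%MM)) -> Iad 2 f.
Proof.
move=> f0 f1 m; have [m2|] := leqP 2 (mdeg m).
  by rewrite (eqP m2); apply: padicW_0.
case: (posnP (mdeg m)) => [/eqP|m0 m2].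
  by rewrite mdeg_eq0 => /eqP -> _; rewrite mdeg0.
have /mdeg1P[i /eqP ->] : mdeg m == 1%N by rewrite eqn_leq m0 andbT -ltnS.
by rewrite mdeg1.
Qed.

Definition jacobian0 (x : 'I_n -> A) : 'M[W]_n := \matrix_(i, j) x i U_(j)%MM.

Lemma mps_linear_approx (f : A) :
  Iad 1 f -> Iad 2 (f - mpsC n (f 0%MM) - \sum_i mpsC n (f U_(i)%MM) * mpsX W i).
Proof.
move=> f1; apply: Iad2P => [|i]; rewrite !mpsD !mpsN mps_sum.
  rewrite mpsCE0 subrr sub0r big1 ?oppr0 => [|i _]; first exact: padicW0.
  by rewrite mpsCMl mpsXE0 mulr0.
rewrite mpsCE1 subr0 (bigD1 i) // big1 => [|j /andP[_ nj]]; last first.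
  by rewrite mpsCMl mpsXE1 (negbTE nj) mulr0.
by rewrite Monoid.mulm1 mpsCMl mpsXE1 eqxx mulr1 subrr; apply: padicW0.
Qed.

Section Bijective.
Variables (x : 'I_n -> A) (x1 : forall i, Iad 1 (x i)) (L : 'M[W]_n).
Local Notation S := (msubst char_k x1).

Lemma Iad_msubst d c : Iad d c -> Iad d (S c).
Proof. by apply: Iad_rmorph => i; rewrite /= msubstX. Qed.

Hypothesis HL : map_mx (@residue p k W) (L *m jacobian0 x) = 1%:M.

(** Since L inverts the Jacobian modulo p, the L-combinations of the x_i - x_i(0) have the linear
    parts of the t_j modulo p; the constants x_i(0) lie in pW. *)
Lemma msubst_approx_mpsX j : exists2 c, Iad 1 c & Iad 2 (mpsX W j - S c).
Proof.
exists (\sum_i mpsC n (L j i) * (mpsX W i - mpsC n (x i 0%MM))).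
  apply: Iad_sum => i _; apply: IadMl; apply: IadB; first exact: Iad_mpsX.
  have /Iad1P[w ->] := x1 i; exact: Iad_mpsC.
have SE i : S (mpsC n (L j i) * (mpsX W i - mpsC n (x i 0%MM))) =
            mpsC n (L j i) * (x i - mpsC n (x i 0%MM)).
  by rewrite rmorphM rmorphB /= !msubstC msubstX.
rewrite rmorph_sum /=; apply: Iad2P => [|l]; rewrite mpsD mpsN mps_sum.
  rewrite mpsXE0 sub0r big1 ?oppr0 => [|i _]; first exact: padicW0.
  by rewrite SE mpsCMl mpsD mpsN mpsCE0 subrr mulr0.
have : map_mx (@residue p k W) (1%:M - L *m jacobian0 x) j l = (0 : 'M_n) j l.
  by rewrite map_mxB map_mx1 HL subrr.
rewrite mxE [RHS]mxE => /(residue_eq0 char_k); congr (padicW 1 _); rewrite mpsXE1 !mxE; congr (_ - _).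
apply: eq_bigr => i _; rewrite mxE SE mpsCMl.
by rewrite mpsD mpsN mpsCE1 subr0.
Qed.

Lemma msubst_approx d a : Iad d a -> exists c, Iad d c /\ Iad d.+1 (a - S c).
Proof.
elim: d a => [|d IH] a da.
  exists (mpsC n (a 0%MM)); split; first exact: Iad_0.
  by rewrite msubstC; apply/Iad1P; rewrite mpsD mpsN mpsCE0 subrr; apply: padicW0.
have [a0 [b [Ha0 Hb ->]]] := Iad_decomp da.
have [c0 [Hc0 Hac0]] := IH _ Ha0.
have /choice[c Hc] i := IH _ (Hb i).
have [y y1 y2] := all_sig2 (fun j => cid2 (msubst_approx_mpsX j)).
exists (p%:R * c0 + \sum_i y i * c i); split.
  rewrite -add1n; apply: IadD; first by apply: IadM => //; apply: Iad_p.
  by apply: Iad_sum => i _; apply: IadM; case: (Hc i).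
rewrite rmorphD rmorphM rmorph_nat rmorph_sum /= opprD addrACA -mulrBr -sumrB.
apply: IadD; first by rewrite -[d.+2]add1n; apply: IadM => //; apply: Iad_p.
apply: Iad_sum => i _; rewrite [S (y i * c i)](rmorphM (S)).
rewrite -(subrKA (S (y i) * b i)) -mulrBl -mulrBr.
have [ci1 ci2] := Hc i; apply: IadD; first exact: (IadM (y2 i) (Hb i)).
exact: (IadM (Iad_msubst (y1 i)) ci2).
Qed.

Lemma msubst_onto d a : Iad d a -> exists2 c, Iad d c & S c = a.
Proof.
move=> da.
(* The approximation is made a total function of degree and series, with value 0 outside the
   filtration, so that the remainders [r] can be defined by recursion. *)
have /choice[f Hf] (da' : nat * A) : exists c,
    Iad da'.1 da'.2 -> Iad da'.1 c /\ Iad da'.1.+1 (da'.2 - S c).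
  have [H|H] := pselect (Iad da'.1 da'.2); last by exists 0.
  by have [c Hc] := msubst_approx H; exists c.
pose r := fix r e := if e is e'.+1 then r e' - S (f ((d + e')%N, r e')) else a.
have Hr e : Iad (d + e) (r e).
  elim: e => [|e IH]; first by rewrite addn0.
  by rewrite addnS; case: (Hf ((d + e)%N, r e) IH).
pose u e := \sum_(i < e) f ((d + i)%N, r i).
have Hu e : a - S (u e) = r e.
  elim: e => [|e IH]; first by rewrite /u big_ord0 rmorph0 subr0.
  by rewrite /u big_ord_recr rmorphD /= -/(u e) opprD addrA IH.
have du e : Iad (d + e) (u e.+1 - u e).
  rewrite (_ : u e.+1 - u e = f ((d + e)%N, r e)); last first.
    by rewrite [u e.+1]big_ord_recr /= addrAC subrr add0r.
  by case: (Hf ((d + e)%N, r e) (Hr e)).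
have [|s Hs] := @Iad_complete _ _ _ char_k _ u.
  by move=> e; apply: IadS (du e); rewrite leq_addl.
exists s.
  have ud e : Iad d (u e).
    elim: e => [|e IH]; first by rewrite /u big_ord0; apply: Iad0.
    rewrite -[u e.+1](subrK (u e)); apply: IadD => //.
    by apply: IadS (du e); rewrite leq_addr.
  by rewrite -[s](subrK (u d)); apply: IadD.
apply/esym/eqP; rewrite -subr_eq0; apply/eqP/(Iad_sep char_k) => e.
have -> : a - S s = (a - S (u e)) - S (s - u e) by rewrite rmorphB opprB addrA subrK.
apply: IadB; last by apply: Iad_msubst.
by rewrite Hu; apply: IadS (Hr e); rewrite leq_addl.
Qed.
End Bijective.

(** Preimages y_j of the t_j give a right inverse of the substitution x, which is again a
    substitution. Its Jacobian is inverse to that of x modulo p, so it is onto as well, and a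
    surjective right inverse makes the substitution x injective. *)
Lemma msubst_inj (x : 'I_n -> A) (x1 : forall i, Iad 1 (x i)) (L : 'M[W]_n) :
  map_mx (@residue p k W) (L *m jacobian0 x) = 1%:M -> injective (msubst char_k x1).
Proof.
move=> HL.
have [y y1 y2] := all_sig2 (fun j => cid2 (msubst_onto x1 HL (Iad_mpsX W j))).
have HJ : map_mx (@residue p k W) (jacobian0 y *m jacobian0 x) = 1%:M.
  apply/matrixP => j l; have [w] : padicW 1 ((1%:M - jacobian0 y *m jacobian0 x) j l).
    have SE : msubst char_k x1 (y j - mpsC n (y j 0%MM) -
        \sum_i mpsC n (y j U_(i)%MM) * mpsX W i) =
      mpsX W j - mpsC n (y j 0%MM) - \sum_i mpsC n (y j U_(i)%MM) * x i.
      rewrite !rmorphB rmorph_sum /= y2 msubstC; congr (_ - _).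
      by apply: eq_bigr => i _; rewrite rmorphM /= msubstC msubstX.
    have := Iad_msubst x1 (mps_linear_approx (y1 j)) U_(l)%MM; rewrite mdeg1 SE.
    congr (padicW 1 _).
    rewrite !mpsD !mpsN mps_sum !mxE mpsCE1 subr0 mpsXE1; congr (_ - _).
    by apply: eq_bigr => i _; rewrite mpsCMl !mxE.
  move/(congr1 (@residue p k W)); rewrite !mxE rmorphB rmorphM rmorphXn rmorph_nat.
  rewrite (pcharf0 char_k) expr0n mul0r => /eqP; rewrite subr_eq0 => /eqP <-.
  by rewrite rmorph_nat.
have HL' : map_mx (@residue p k W) (jacobian0 x *m jacobian0 y) = 1%:M.
  by rewrite map_mxM mulmx1C // -map_mxM.
have SS a : msubst char_k x1 (msubst char_k y1 a) = a.
  apply/eqP; rewrite -subr_eq0; apply/eqP/(Iad_sep char_k) => d.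
  pose F : {rmorphism A -> A} := msubst char_k x1 \o msubst char_k y1.
  have FX i : F (mpsX W i) = mpsX W i by rewrite /F /= msubstX y2.
  have Fa : expd (fun i => F (mpsX W i)) (mps_map idfun a) (F a).
    apply: rmorph_expd => [w|i]; first by rewrite /F /= !msubstC.
    by rewrite FX; apply: Iad_mpsX.
  have -> : msubst char_k x1 (msubst char_k y1 a) - a =
    (F a - mmap (@mpsC n W) (@mpsX n W) (mps_trunc d a)) -
    (a - mmap (@mpsC n W) (@mpsX n W) (mps_trunc d a)) by rewrite opprB addrA subrK.
  apply: IadB; last exact: expd_id.
  have := Fa d; rewrite (_ : mps_map idfun a = a); last exact: mpsP.
  by rewrite (_ : (fun i => F (mpsX W i)) = @mpsX n W) //; apply/funext.
suff inj0 c : msubst char_k x1 c = 0 -> c = 0.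
  by move=> a b ab; apply/eqP; rewrite -subr_eq0; apply/eqP/inj0; rewrite rmorphB /= ab subrr.
have [b _ <-] := msubst_onto y1 HL' (Iad_0 c); rewrite SS => ->; exact: rmorph0.
Qed.

Lemma mps_unitE (a : A) : (a \is a GRing.unit) = (residue (a 0%MM) != 0).
Proof.
apply/idP/idP=> [/unitrP[b [ba _]]|a0].
  apply/eqP => a0; have := congr1 (fun f : A => residue (f 0%MM)) ba.
  by rewrite mpsM0 rmorphM mps1 eqxx rmorph1 /= a0 mulr0 => /esym/eqP; rewrite oner_eq0.
have [v rv] := residue_surj W (residue (a 0%MM))^-1.
pose z := 1 - a * mpsC n v.
have z1 : Iad 1 z.
  apply/Iad1P/(residue_eq0 char_k); rewrite /z mpsD mpsN mpsM0 mps1 eqxx mpsCE0.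
  by rewrite rmorphB rmorph1 rmorphM /= rv mulfV // subrr.
pose u N : A := \sum_(i < N) z ^+ i.
have [|s Hs] := @Iad_complete _ _ _ char_k _ u.
  by move=> N; rewrite /u big_ord_recr addrC addKr; apply: IadX.
suff e : a * mpsC n v * s = 1.
  by apply/unitrP; exists (mpsC n v * s); split; rewrite -e; ring.
have -> : a * mpsC n v = 1 - z by rewrite subKr.
apply/eqP; rewrite -subr_eq0; apply/eqP/(Iad_sep char_k) => N.
have -> : (1 - z) * s - 1 = (1 - z) * (s - u N) - z ^+ N.
  have := subrX1 z N; rewrite -/(u N) => /eqP.
  by rewrite subr_eq => /eqP ->; ring.
by apply: IadB; [apply: IadMl | apply: IadX].
Qed.

Lemma regular_parametersP (x : 'I_n -> A) (L : 'M[W]_n) : (forall i, Iad 1 (x i)) ->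
  map_mx (@residue p k W) (L *m jacobian0 x) = 1%:M ->
  regular_parameters (p%:R :: [seq x i | i <- enum 'I_n]).
Proof.
move=> x1 HL; split; first by rewrite /= size_map size_enum_ord.
move=> a; set s := _ :: _.
have ss : size s = n.+1 by rewrite /= size_map size_enum_ord.
have sx (i : 'I_n) : s`_i.+1 = x i.
  by rewrite /= (nth_map i) ?size_enum_ord // nth_ord_enum.
have sumE (c : 'I_(size s) -> A) (c' : 'I_n.+1 -> A) : (forall i, c (cast_ord (esym ss) i) = c' i) ->
    \sum_i c i * s`_i = c' ord0 * p%:R + \sum_i c' (lift ord0 i) * x i.
  move=> cc; rewrite (reindex (cast_ord (esym ss))) /=; last first.
    by exists (cast_ord ss) => i _; rewrite ?cast_ordK ?cast_ordKV.
  rewrite big_ord_recl cc; congr (_ + _); apply: eq_bigr => i _.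
  by rewrite cc -sx.
split=> [nu|[c ->]].
  have a1 : Iad 1 a.
    apply/Iad1P/(residue_eq0 char_k)/eqP.
    by move: nu; rewrite mps_unitE negbK.
  (* A non-unit is the value of a series c in the maximal ideal; the constant term p w of c and its
     pieces [mps_div j c] become the coefficients of p and of the x_j. *)
  have [c c1 <-] := msubst_onto x1 HL a1.
  have /Iad1P[w Hw] := c1.
  pose c' (i : 'I_n.+1) := if unlift ord0 i is Some j then msubst char_k x1 (mps_div j c)
                           else mpsC n w.
  exists (fun i => c' (cast_ord ss i)); rewrite (sumE _ c') => [|i]; last by rewrite cast_ordKV.
  rewrite {1}[c]mps_div_sum rmorphD rmorph_sum /= msubstC Hw /c' unlift_none.
  rewrite expr1 rmorphM /= rmorph_nat mulrC; congr (_ + _); apply: eq_bigr => i _.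
  by rewrite rmorphM /= msubstX liftK mulrC.
rewrite mps_unitE negbK (sumE _ (fun i => c (cast_ord (esym ss) i))) //.
apply/eqP/(residue_eq0 char_k)/Iad1P; apply: IadD; first by apply: IadMl; apply: Iad_p.
by apply: Iad_sum => i _; apply: IadMl.
Qed.

Lemma power_series_coordinatesP (x : 'I_n -> A) (L : 'M[W]_n) :
  (forall i, Iad 1 (x i)) ->
  map_mx (@residue p k W) (L *m jacobian0 x) = 1%:M ->
  power_series_coordinates x.
Proof.
move=> x1 HL; split=> [c|a].
  by exists (msubst char_k x1 c); apply/is_expansionP/msubstP.
have [c _ <-] := msubst_onto x1 HL (Iad_0 a); exists c; split.
  by apply/is_expansionP/msubstP.
move=> c' /(is_expansionP char_k x1) H.
apply: (@msubst_inj x x1 L HL).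
exact: (expd_unique char_k H (msubstP char_k x1 c')).
Qed.

Section FrobeniusLift.
Variable sigma : {rmorphism W -> W}.
Hypothesis sigma_frob : is_frobenius sigma.

Lemma pchar_A0 : p \in [pchar {mps k[n]}].
Proof.
rewrite inE (pcharf_prime char_k) /=; apply/eqP/mpsP => m.
by rewrite mps_natE (pcharf0 char_k) mps0 if_same.
Qed.

Lemma frobenius_A0 (f g : {mps k[n]}) : (f - g) ^+ p = f ^+ p - g ^+ p.
Proof. exact: (rmorphB (pFrobenius_aut pchar_A0) f g). Qed.

Lemma reduction_Iad d (f : A) m : Iad d f -> (mdeg m < d)%N -> reduction f m = 0.
Proof.
move=> fd md; apply/(residue_eq0 char_k).
by apply: padicWS (fd m); rewrite subn_gt0.
Qed.

Lemma mps_expn_low (R : comNzRingType) d (f : {mps R[n]}) N m : (0 < N)%N ->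
  (forall l, (mdeg l < d)%N -> f l = 0) -> (mdeg m < d)%N -> (f ^+ N) m = 0.
Proof.
case: N => // N _ f0 md; rewrite exprS mpsM big1 // => -[k1 k2] /= /eqP mk.
rewrite f0 ?mul0r //; apply: leq_ltn_trans md.
by have := congr1 (@mdeg n) mk; rewrite mdegD; clear; lia.
Qed.

(** In the coordinates x the lift applies sigma to coefficients and sends x_i to z_i. That it
    reduces to the p-th power is checked one monomial at a time on finite truncations, because the
    p-th power map of A_0 is a ring morphism. *)
Lemma frob_lift_exists (x z : 'I_n -> A) (L : 'M[W]_n) :
  (forall i, Iad 1 (x i)) ->
  map_mx (@residue p k W) (L *m jacobian0 x) = 1%:M ->
  (forall i, reduction (z i) = reduction (x i) ^+ p) ->
  exists phi : frob_lift sigma n, forall i, phi (x i) = z i.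
Proof.
move=> x1 HL zx.
have p_gt0 : (0 < p)%N by apply/prime_gt0/(pcharf_prime char_k).
have z1 i : Iad 1 (z i).
  apply/Iad1P/(residue_eq0 char_k); have := congr1 (fun f : {mps k[n]} => f 0%MM) (zx i).
  rewrite /= => ->; rewrite mpsX0 /= (_ : residue _ = 0) ?expr0n ?gtn_eqF //.
  by apply/(residue_eq0 char_k)/Iad1P.
have Sinj := msubst_inj HL (x1 := x1).
have /choice[g gK] a : exists c, msubst char_k x1 c = a.
  by have [c _ <-] := msubst_onto x1 HL (Iad_0 a); exists c.
have gS c : g (msubst char_k x1 c) = c by apply: Sinj; rewrite gK.
pose F a := msubst char_k z1 (mps_map sigma (g a)).
have FZ : zmod_morphism F.
  move=> a b; rewrite /F -!rmorphB /=; congr (msubst _ _ (mps_map _ _)).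
  by apply: Sinj; rewrite rmorphB /= !gK.
have FM : monoid_morphism F.
  split=> [|a b].
    have g1 : g 1 = 1 by apply: Sinj; rewrite gK [RHS]rmorph1.
    by rewrite /F g1 [mps_map _ _]rmorph1 [LHS]rmorph1.
  rewrite /F -!rmorphM /=; congr (msubst _ _ (mps_map _ _)).
  by apply: Sinj; rewrite rmorphM /= !gK.
pose F1 := GRing.isZmodMorphism.Build _ _ F FZ.
pose F2 := GRing.isMonoidMorphism.Build _ _ F FM.
pose FR : {rmorphism A -> A} := HB.pack F F1 F2.
have FC w : FR (mpsC n w) = mpsC n (sigma w).
  by rewrite /FR /= /F -(msubstC char_k x1 w) gS mps_mapC msubstC.
have Fred a : reduction (FR a) = reduction a ^+ p.
  apply: mpsP => m; apply/eqP; rewrite -subr_eq0.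
  pose d := (mdeg m).+1; pose c := g a.
  have Ha := msubstP char_k x1 c d; have HF := msubstP char_k z1 (mps_map sigma c) d.
  rewrite gK in Ha; rewrite -[msubst _ _ _]/(FR a) in HF.
  set P := mmap _ _ _ in Ha; set Q := mmap _ _ _ in HF.
  pose fr : {rmorphism {mps k[n]} -> {mps k[n]}} := pFrobenius_aut pchar_A0.
  have frE f : fr f = f ^+ p by [].
  have PQ : reduction Q = reduction P ^+ p.
    rewrite -frE /P /Q !mmap_trunc !rmorph_sum /=; apply: eq_bigr => l _.
    rewrite !rmorphM /= !mmap1_rmorph; congr (_ * _); last first.
      by rewrite /mmap1; apply: eq_bigr => i _; rewrite /= frE zx.
    rewrite frE !reductionC /= -rmorphXn; congr mpsC.
    by case: sigma_frob => _ ->.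
  have -> : reduction (FR a) m = reduction Q m.
    apply/eqP; rewrite -subr_eq0 -mpsN -mpsD -rmorphB; apply/eqP.
    exact: reduction_Iad HF _.
  rewrite -mpsN -mpsD PQ -frobenius_A0 -rmorphB.
  apply/eqP/(mps_expn_low (d := d)) => // l ld; apply: (reduction_Iad (d := d)) => //.
  rewrite -opprB; exact: (IadN Ha).
exists (FrobLift FC Fred) => i /=.
by rewrite /F -(msubstX char_k x1 i) gS mps_mapX msubstX.
Qed.
End FrobeniusLift.
End Coordinates.

(** * Series over the fraction field *)

Section FractionField.
Variables (p : nat) (k : closedFieldType) (W : witt_vectors p k).
Local Notation K := {fraction W}.
Implicit Types (x y : K) (w : W).

Lemma padicK_toK N w : padicK N (toK w) <-> padicW N w.
Proof.
split=> [[v /(@toK_inj p k W) ->]|[v ->]]; first by exists v.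
by exists v.
Qed.

Lemma padicK0 N : padicK N (0 : K).
Proof. by exists 0; rewrite mulr0 rmorph0. Qed.

Lemma padicKB N x y : padicK N x -> padicK N y -> padicK N (x - y).
Proof. by move=> [v ->] [w ->]; exists (v - w); rewrite mulrBr rmorphB. Qed.

Lemma padicKD N x y : padicK N x -> padicK N y -> padicK N (x + y).
Proof. by apply: nbD; [apply: padicK0 | apply: padicKB]. Qed.

Lemma padicK_sum N (I : Type) (s : seq I) (P : pred I) (F : I -> K) :
  (forall i, P i -> padicK N (F i)) -> padicK N (\sum_(i <- s | P i) F i).
Proof. by apply: nb_sum; [apply: padicK0 | apply: padicKB]. Qed.

Lemma padicKS M N x : (M <= N)%N -> padicK N x -> padicK M x.
Proof.
by move=> MN [w ->]; apply/padicK_toK; apply: padicWS MN _; exists w.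
Qed.

Lemma padicKM M N x y : padicK M x -> padicK N y -> padicK (M + N) (x * y).
Proof.
move=> [v ->] [w ->]; rewrite -rmorphM; apply/padicK_toK.
by apply: padicWM; [exists v | exists w].
Qed.

Lemma padicKX N x i : padicK N x -> padicK (N * i) (x ^+ i).
Proof.
move=> Nx; elim: i => [|i IH]; first by rewrite muln0; exists 1; rewrite mul1r rmorph1.
by rewrite mulnS exprS; apply: padicKM.
Qed.

Lemma padicK_int x : padicK 0 x <-> exists w, x = toK w.
Proof.
split=> [] [w ->]; exists w; last by rewrite mul1r.
by rewrite mul1r.
Qed.

Lemma toK_neq0 (w : W) : w != 0 -> toK w != 0.
Proof. by rewrite /toK tofrac_eq0. Qed.

Lemma fraction_repr x : x = toK (\n_(repr x)) / toK (\d_(repr x)).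
Proof.
have d0 : toK (\d_(repr x)) != 0 by apply/toK_neq0/denom_ratioP.
apply: (mulIf d0); rewrite mulfVK // -[x in LHS]reprK.
set r := repr x; rewrite /toK /tofrac /=; unlock FracField.tofrac.
rewrite -[LHS]FracField.pi_mul; apply/eqmodP; rewrite /= FracField.equivfE /FracField.mulf.
have r0 := denom_ratioP r.
rewrite !numden_Ratio ?oner_neq0 ?mulr1 //.
by rewrite /r reprK mulrC.
Qed.

Lemma fraction_ratio x : exists a b, b != 0 /\ x = toK a / toK b.
Proof.
exists (\n_(repr x)), (\d_(repr x)); split; first exact: denom_ratioP.
exact: fraction_repr.
Qed.

Hypothesis char_k : p \in [pchar k].

Lemma K_p_neq0 : (p%:R : K) != 0.
Proof.
rewrite -(rmorph_nat (@toK p k W)); apply/eqP => e.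
have /eqP[] := witt_p_neq0 W char_k.
by apply: (@toK_inj p k W); rewrite e rmorph0.
Qed.

Lemma padicK_shift B N x : padicK (B + N) (p%:R ^+ B * x) <-> padicK N x.
Proof.
have e (w : W) : toK (p%:R ^+ (B + N) * w) = p%:R ^+ B * toK (p%:R ^+ N * w).
  by rewrite exprD -mulrA rmorphM rmorphXn rmorph_nat.
split=> [[w]|[w ->]]; last by exists w; rewrite e.
by rewrite e => /(mulfI (expf_neq0 B K_p_neq0)) ->; exists w.
Qed.

Lemma padicK_sep x : (forall N, padicK N x) -> x = 0.
Proof.
move=> xN; have /padicK_int[w xw] := xN 0%N.
rewrite xw (_ : w = 0) ?rmorph0 //; apply: (padicW_separated char_k) => N.
by apply/padicK_toK; rewrite -xw.
Qed.

Lemma padicK_bounded x : exists B, padicK 0 (p%:R ^+ B * x).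
Proof.
have [a [b [b0 ->]]] := fraction_ratio x.
have [B [u [uu ->]]] := witt_factor char_k b0.
exists B; apply/padicK_int; exists (a / u).
have pB := expf_neq0 B K_p_neq0.
rewrite !rmorphM rmorphXn rmorph_nat rmorphV //= invfM mulrCA; congr (_ * _).
by rewrite mulrA mulfV // mul1r.
Qed.

Lemma padicKM_bounded B N x y :
  padicK (N + B) x -> padicK 0 (p%:R ^+ B * y) -> padicK N (x * y).
Proof.
move=> Hx Hy; apply/(padicK_shift B); rewrite mulrCA addnC -[(N + B)%N]addn0.
exact: padicKM.
Qed.

Section SigmaK.
Variable sigma : {rmorphism W -> W}.
Hypothesis sigma_frob : is_frobenius sigma.

Lemma sigma_neq0 (w : W) : w != 0 -> sigma w != 0.
Proof.
case: sigma_frob => sb _; apply: contraNneq => s0.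
by apply/eqP/(bij_inj sb); rewrite s0 rmorph0.
Qed.

(** [sigmaK] uses a chosen representative of the fraction; cross-multiplication shows the choice to
    be immaterial, whence it is a ring morphism. *)
Lemma sigmaK_ratio (a b : W) : b != 0 ->
  sigmaK sigma (toK a / toK b) = toK (sigma a) / toK (sigma b).
Proof.
move=> b0; set x := toK a / toK b.
have d0 : \d_(repr x) != 0 by exact: denom_ratioP.
have e : \n_(repr x) * b = a * \d_(repr x).
  apply: (@toK_inj p k W); rewrite !rmorphM /=.
  have := fraction_repr x.
  rewrite {1}/x => /(congr1 (fun y => y * (toK b * toK (\d_(repr x))))).
  rewrite mulrA divfK ?toK_neq0 // [toK b * _ in RHS]mulrC mulrA divfK ?toK_neq0 //.
rewrite /sigmaK -/x; apply: (mulIf (toK_neq0 (sigma_neq0 d0))).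
rewrite divfK ?toK_neq0 ?sigma_neq0 //; apply: (mulIf (toK_neq0 (sigma_neq0 b0))).
by rewrite mulrAC divfK ?toK_neq0 ?sigma_neq0 // -!rmorphM e.
Qed.

Lemma sigmaK_toK w : sigmaK sigma (toK w) = toK (sigma w).
Proof.
by have := sigmaK_ratio w (oner_neq0 W); rewrite !rmorph1 !divr1.
Qed.

Lemma sigmaK_rmorphism : exists s : {rmorphism K -> K}, sigmaK sigma =1 s.
Proof.
have key (a b c d : W) : b != 0 -> d != 0 ->
    toK a / toK b - toK c / toK d = toK (a * d - c * b) / toK (b * d).
  move=> b0 d0; rewrite -mulNr addf_div ?toK_neq0 //.
  by rewrite rmorphB !rmorphM /= mulNr.
have sZ : zmod_morphism (sigmaK sigma).
  move=> x y; have [a [b [b0 ->]]] := fraction_ratio x.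
  have [c [d [d0 ->]]] := fraction_ratio y.
  by rewrite key // !sigmaK_ratio ?mulf_neq0 // key ?sigma_neq0 // (rmorphB sigma) !(rmorphM sigma).
have sM : monoid_morphism (sigmaK sigma).
  split=> [|x y]; first by rewrite -(rmorph1 (@toK p k W)) sigmaK_toK !rmorph1.
  have [a [b [b0 ->]]] := fraction_ratio x.
  have [c [d [d0 ->]]] := fraction_ratio y.
  by rewrite mulf_div -!rmorphM !sigmaK_ratio ?mulf_neq0 // mulf_div -!rmorphM.
pose F1 := GRing.isZmodMorphism.Build _ _ _ sZ.
pose F2 := GRing.isMonoidMorphism.Build _ _ _ sM.
pose sR : {rmorphism K -> K} := HB.pack (sigmaK sigma) F1 F2.
by exists sR.
Qed.

Lemma padicK_sigmaK N x : padicK N x -> padicK N (sigmaK sigma x).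
Proof.
move=> [w ->]; rewrite sigmaK_toK rmorphM rmorphXn rmorph_nat.
by exists (sigma w).
Qed.
End SigmaK.
End FractionField.

Lemma subr_sub2 (V : zmodType) (a b u v : V) : a - b - (u - v) = (a - u) - (b - v).
Proof. by rewrite !opprB addrACA [RHS]addrACA [- b - u]addrC. Qed.

Lemma mulr_sub_approx (R : comNzRingType) (a b u v z : R) :
  a * b - z = (a - u) * b + (b - v) * u + (u * v - z).
Proof. by ring. Qed.

(** * Evaluation of series with unbounded denominators *)

Section Evaluation.
Variables (p : nat) (k : closedFieldType) (W : witt_vectors p k).
Hypothesis char_k : p \in [pchar k].
Local Notation K := {fraction W}.

Section Low.
Variables (n M : nat).
Implicit Types (f g : {mps K[n]}).

(** Coefficients over K have no common denominator, so precision ([lowK]) and denominators ([lowB])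
    are controlled only up to degree M; this suffices for products, whose coefficients of degree at
    most M involve no others. *)
Definition lowK N f := forall u, (mdeg u <= M)%N -> padicK N (f u).
Definition lowB B f := forall u, (mdeg u <= M)%N -> padicK 0 (p%:R ^+ B * f u).

Lemma lowK0 N : lowK N 0.
Proof. by move=> u _; rewrite mps0; apply: padicK0. Qed.
Lemma lowKB N f g : lowK N f -> lowK N g -> lowK N (f - g).
Proof. by move=> Hf Hg u uM; apply: padicKB; [apply: Hf | apply: Hg]. Qed.
Lemma lowKD N f g : lowK N f -> lowK N g -> lowK N (f + g).
Proof. by apply: nbD; [apply: lowK0 | apply: lowKB]. Qed.
Lemma lowK_sum N (I : Type) (s : seq I) (P : pred I) (F : I -> {mps K[n]}) :
  (forall i, P i -> lowK N (F i)) -> lowK N (\sum_(i <- s | P i) F i).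
Proof. by apply: nb_sum; [apply: lowK0 | apply: lowKB]. Qed.
Lemma lowKN N f : lowK N f -> lowK N (- f).
Proof. by apply: nbN; [apply: lowK0 | apply: lowKB]. Qed.

Lemma lowBD B f g : lowB B f -> lowB B g -> lowB B (f + g).
Proof.
by move=> Hf Hg u uM; rewrite mpsD mulrDr; apply: padicKD; [apply: Hf | apply: Hg].
Qed.

Lemma lowB_sum B (I : Type) (s : seq I) (P : pred I) (F : I -> {mps K[n]}) :
  (forall i, P i -> lowB B (F i)) -> lowB B (\sum_(i <- s | P i) F i).
Proof.
move=> H; elim/big_ind: _ => //; last exact: lowBD.
by move=> u _; rewrite mps0 mulr0; apply: padicK0.
Qed.

Lemma lowKM B N f g : lowK (N + B) f -> lowB B g -> lowK N (f * g).
Proof.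
move=> Hf Hg m mM; rewrite mpsM; apply: padicK_sum => -[k1 k2] /= /eqP mk.
have km := congr1 (@mdeg n) mk; rewrite mdegD in km.
apply: (padicKM_bounded char_k (B := B)).
  by apply: Hf; apply: leq_trans mM; move: km; clear; lia.
by apply: Hg; apply: leq_trans mM; move: km; clear; lia.
Qed.

Lemma lowK_lowB N B f : lowK N f -> lowB B f.
Proof.
move=> Hf u uM; rewrite -[0%N]addn0; apply: padicKM; last exact: padicKS (Hf u uM).
by apply/padicK_int; exists (p%:R ^+ B); rewrite rmorphXn rmorph_nat.
Qed.
End Low.

Section EvalK.
Variables (n h : nat) (x : 'I_h -> {mps K[n]}).
Implicit Types (c : {mps K[h]}) (a : {mps K[n]}) (l : 'X_{1..h}).

Definition evalK c a :=
  forall m, has_sum (@padicK p k W) (fun l => c l * mmap1 x l m) (a m).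

Definition evalK_term c l : {mps K[n]} := mpsC n (c l) * mmap1 x l.

Lemma evalK_termE c l u : evalK_term c l u = c l * mmap1 x l u.
Proof. exact: mpsCMl. Qed.

Lemma mmapK_trunc d c : mmap (@mpsC n K) x (mps_trunc d c) =
  \sum_(l : 'X_{1..h < d}) evalK_term c l.
Proof. by rewrite raddf_sum; apply: eq_bigr => l _; rewrite /= mmapZ mmapX. Qed.

(** Only finitely many monomials have degree at most M, so their separate sums converge with a
    common D0; sums and products are handled in this uniform form. *)
Lemma evalKP c a : evalK c a <-> forall M N, exists D0,
  (forall l, (D0 <= mdeg l)%N -> lowK M N (evalK_term c l)) /\
  (forall D, (D0 <= D)%N -> lowK M N (a - mmap (@mpsC n K) x (mps_trunc D c))).
Proof.
have nb0 N := padicK0 W N; have nbB := @padicKB p k W.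
split=> [ca M N|ca m].
  have /choice[D HD] (u : 'X_{1..n < M.+1}) :=
    proj1 (has_sum_mdeg nb0 nbB _ _) (ca u) N.
  have Dmax u : (D u <= \max_u D u)%N by exact: leq_bigmax.
  exists (\max_u D u); split=> [l Dl u uM|D' DD' u uM].
    rewrite evalK_termE; case: (HD (BMultinom (uM : (mdeg u < M.+1)%N))) => H _.
    by apply: H; apply: leq_trans Dl.
  case: (HD (BMultinom (uM : (mdeg u < M.+1)%N))) => _ /(_ D' (leq_trans (Dmax _) DD')).
  rewrite mpsD mpsN mmapK_trunc mps_sum; congr (padicK N (_ - _)).
  by apply: eq_bigr => l _; rewrite evalK_termE.
apply/(has_sum_mdeg nb0 nbB) => N; have [D0 [H1 H2]] := ca (mdeg m) N.
exists D0; split=> [l /H1 /(_ m (leqnn _))|D /H2 /(_ m (leqnn _))].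
  by rewrite evalK_termE.
rewrite mpsD mpsN mmapK_trunc mps_sum; congr (padicK N (_ - _)).
by apply: eq_bigr => l _; rewrite evalK_termE.
Qed.

Lemma evalK_unique c a b : evalK c a -> evalK c b -> a = b.
Proof.
move=> ca cb; apply: mpsP => m; apply: has_sum_unique (ca m) (cb m).
  exact: padicKB.
exact: padicK_sep.
Qed.

Lemma evalKB c c' a a' : evalK c a -> evalK c' a' -> evalK (c - c') (a - a').
Proof.
move=> /evalKP ca /evalKP ca'; apply/evalKP => M N.
have [D [H1 H2]] := ca M N; have [D' [H1' H2']] := ca' M N.
exists (maxn D D'); split=> [l|E]; rewrite geq_max => /andP[Dl Dl'].
  rewrite /evalK_term mpsD mpsN rmorphB mulrBl.
  by apply: lowKB; [apply: H1 | apply: H1'].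
rewrite raddfB rmorphB /=; rewrite subr_sub2.
by apply: lowKB; [apply: H2 | apply: H2'].
Qed.

(** From degree D on the terms are integral, and the finitely many others have a common denominator
    in degrees at most M. *)
Lemma evalK_bounded c a M : evalK c a ->
  exists B, lowB M B a /\ forall l, lowB M B (evalK_term c l).
Proof.
move=> /evalKP /(_ M 0%N)[D [H1 H2]].
have exB (f : {mps K[n]}) : exists B, forall B', (B <= B')%N -> lowB M B' f.
  have /choice[B HB] (u : 'X_{1..n < M.+1}) := padicK_bounded char_k (f u).
  exists (\max_u B u)%N => B' BB' u uM.
  have := HB (BMultinom (uM : (mdeg u < M.+1)%N)); set b := B _ => Hb.
  have bB : (b <= B')%N by apply: leq_trans BB'; apply: leq_bigmax.
  rewrite -(subnK bB) exprD -mulrA -[0%N]addn0; apply: padicKM Hb.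
  by apply/padicK_int; exists (p%:R ^+ (B' - b)); rewrite rmorphXn rmorph_nat.
have /choice[B HB] (l : 'X_{1..h < D}) := exB (evalK_term c l).
have [B0 HB0] := exB a.
exists (maxn B0 (\max_l B l)); split=> [|l]; first by apply: HB0; rewrite leq_max leqnn.
have [Dl|lD] := leqP D (mdeg l); first exact: (lowK_lowB _ (H1 l Dl)).
apply: (HB (BMultinom lD)); rewrite leq_max orbC.
by rewrite (leq_bigmax (BMultinom lD)).
Qed.

Lemma mcoeff_trunc_ge (R : comNzRingType) d (f : {mps R[h]}) l : (d <= mdeg l)%N ->
  (mps_trunc d f)@_l = 0.
Proof.
move=> dl; rewrite linear_sum big1 // => -[l' ld] _ /=.
rewrite mcoeffZ mcoeffX; case: (l' =P l) => [e|_]; last by rewrite mulr0.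
by move: dl; rewrite -e leqNgt ld.
Qed.

(** A Cauchy product: N + B digits of one factor compensate the denominator p^B of the other, so
    every product of terms with an index of degree at least D is small. *)
Lemma evalKM c c' a a' : evalK c a -> evalK c' a' -> evalK (c * c') (a * a').
Proof.
move=> ca ca'; apply/evalKP => M N.
have [B1 [Ba HB1]] := evalK_bounded M ca; have [B2 [Ba' HB2]] := evalK_bounded M ca'.
pose B := maxn B1 B2.
have lowBS b f : (b <= B)%N -> lowB M b f -> @lowB n M B f.
  move=> bB Hf u uM; rewrite -(subnK bB) exprD -mulrA -[0%N]addn0; apply: padicKM (Hf u uM).
  by apply/padicK_int; exists (p%:R ^+ (B - b)); rewrite rmorphXn rmorph_nat.
have {Ba HB1} [Ba HB1] : lowB M B a /\ forall l, lowB M B (evalK_term c l).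
  by split=> [|l]; apply: lowBS (leq_maxl _ _) _.
have {Ba' HB2} [Ba' HB2] : lowB M B a' /\ forall l, lowB M B (evalK_term c' l).
  by split=> [|l]; apply: lowBS (leq_maxr _ _) _.
have [D1 [T1 S1]] := proj1 (evalKP c a) ca M (N + B)%N.
have [D2 [T2 S2]] := proj1 (evalKP c' a') ca' M (N + B)%N.
pose D := maxn D1 D2.
have {}T1 l : (D <= mdeg l)%N -> lowK M (N + B) (evalK_term c l).
  by move=> Dl; apply: T1; apply: leq_trans Dl; apply: leq_maxl.
have {}T2 l : (D <= mdeg l)%N -> lowK M (N + B) (evalK_term c' l).
  by move=> Dl; apply: T2; apply: leq_trans Dl; apply: leq_maxr.
have {}S1 := S1 D (leq_maxl _ _); have {}S2 := S2 D (leq_maxr _ _).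
have TT l1 l2 : ~~ ((mdeg l1 < D)%N && (mdeg l2 < D)%N) ->
    lowK M N (mpsC n (c l1 * c' l2) * mmap1 x (l1 + l2)%MM).
  move=> l12.
  have -> : mpsC n (c l1 * c' l2) * mmap1 x (l1 + l2)%MM =
     evalK_term c l1 * evalK_term c' l2.
    rewrite /evalK_term rmorphM commr_mmap1_M; first by rewrite mulrACA.
    by move=> i y; apply: mulrC.
  move: l12; rewrite negb_and -!leqNgt => /orP[/T1 H|/T2 H].
    exact: (lowKM H (HB2 l2)).
  by rewrite mulrC; apply: (lowKM H (HB1 l1)).
(* If l1 + l2 has degree at least 2D, one of the two has degree at least D; conversely a product of
   truncations at D has degree below 2D. *)
exists (D + D)%N; split=> [l Dl|E DE].
  rewrite /evalK_term mpsM rmorph_sum mulr_suml; apply: lowK_sum => -[k1 k2] /= /eqP lk.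
  rewrite (congr1 (mmap1 x) lk); apply: TT; apply/negP => /andP[d1 d2].
  have := congr1 (@mdeg h) lk; rewrite mdegD; move: Dl d1 d2; clear; lia.
set P := mps_trunc D c; set Q := mps_trunc D c'.
set u := mmap (@mpsC n K) x P; set v := mmap (@mpsC n K) x Q.
have -> : a * a' - mmap (@mpsC n K) x (mps_trunc E (c * c')) =
    (a - u) * a' + (a' - v) * u + mmap (@mpsC n K) x (P * Q - mps_trunc E (c * c')).
  rewrite rmorphB rmorphM /= -/u -/v; exact: mulr_sub_approx.
have Hu : lowB M B u by rewrite /u mmapK_trunc; apply: lowB_sum => l _; apply: HB1.
apply: lowKD; first by apply: lowKD; [apply: (lowKM S1 Ba') | apply: (lowKM S2 Hu)].
apply: lowK_sum => l _; rewrite mcoeffB.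
have PQl : (P * Q)@_l = \sum_(k : 'X_{1..h < (mdeg l).+1, (mdeg l).+1} | l == (k.1 + k.2)%MM)
    (if ((mdeg k.1 < D) && (mdeg k.2 < D))%N then c k.1 * c' k.2 else 0).
  rewrite (mcoeff_poly_mul _ _ (k := (mdeg l).+1)) //; apply: eq_bigr => -[k1 k2] /= _.
  have [k1D|k1D] := ltnP (mdeg k1) D; last by rewrite mcoeff_trunc_ge ?mul0r.
  have [k2D|k2D] := ltnP (mdeg k2) D; last by rewrite [Q@__]mcoeff_trunc_ge ?mulr0.
  by rewrite !mcoeff_trunc.
have [lE|El] := ltnP (mdeg l) E.
  rewrite mcoeff_trunc // mpsM PQl -sumrB rmorph_sum mulr_suml.
  apply: lowK_sum => -[k1 k2] /= /eqP lk; case: ifP => [_|/negbT k12].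
    by rewrite subrr rmorph0 mul0r; apply: lowK0.
  rewrite sub0r rmorphN mulNr; apply: lowKN; rewrite (congr1 (mmap1 x) lk); exact: TT.
rewrite mcoeff_trunc_ge // PQl subr0 big1 ?rmorph0 ?mul0r; first exact: lowK0.
move=> [k1 k2] /= /eqP lk; case: ifP => // /andP[d1 d2]; exfalso.
have := congr1 (@mdeg h) lk; rewrite mdegD; move: El DE d1 d2; clear; lia.
Qed.
End EvalK.
End Evaluation.

Lemma mps_derivE n (R : comNzRingType) i (f : {mps R[n]}) m :
  mps_deriv i f m = f (m + U_(i))%MM *+ (m i).+1.
Proof. by []. Qed.

(** * Exponentials *)

Section FormalExp.
Variables (n : nat) (F : fieldType).
Hypothesis F0 : forall l, (l.+1%:R : F) != 0.
Implicit Types (f g u v : {mps F[n]}) (m : 'X_{1..n}).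

Lemma mpsM_eq_low f f' g m : (forall l, (mdeg l <= mdeg m)%N -> f l = f' l) ->
  (f * g) m = (f' * g) m.
Proof.
move=> ff; rewrite !mpsM; apply: eq_bigr => -[k1 k2] /= /eqP mk; rewrite ff //.
by have := congr1 (@mdeg n) mk; rewrite mdegD; clear; lia.
Qed.

Lemma mpsM_low f g m : (forall l, (mdeg l < mdeg m)%N -> f l = 0) ->
  (f * g) m = f m * g 0%MM.
Proof.
move=> f0; rewrite mpsM.
have m1 : (mdeg m < (mdeg m).+1)%N by [].
have m2 : (mdeg (0%MM : 'X_{1..n}) < (mdeg m).+1)%N by rewrite mdeg0.
rewrite (bigD1 (BMultinom m1, BMultinom m2)) /=; last by rewrite addm0.
rewrite big1 ?addr0 // => -[k1 k2] /= /andP[/eqP mk nk].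
have [k20|k20] := eqVneq (k2 : 'X_{1..n}) 0%MM.
  case/negP: nk; apply/eqP; congr (_, _); apply: val_inj => //=.
  by have := mk; rewrite k20 addm0.
rewrite f0 ?mul0r //; have := congr1 (@mdeg n) mk; rewrite mdegD.
by move: k20; rewrite -mdeg_eq0; clear; lia.
Qed.

(** The difference f - g vanishes below the degree of m, and its cofactor in f^N - g^N has constant
    term N. With N = p this isolates p E_m in Dwork's lemma. *)
Lemma mpsX_low f g m N : f 0%MM = 1 -> g 0%MM = 1 ->
  (forall l, (mdeg l < mdeg m)%N -> f l = g l) ->
  (f ^+ N) m - (g ^+ N) m = N%:R * (f m - g m).
Proof.
move=> f0 g0 fg; rewrite -mpsN -mpsD subrXX mpsM_low; last first.
  by move=> l lm; rewrite mpsD mpsN fg // subrr.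
rewrite mpsD mpsN mulrC mps_sum; congr (_ * _).
rewrite (eq_bigr (fun=> 1)) ?sumr_const ?card_ord // => i _.
by rewrite mpsM0 !mpsX0 f0 g0 !expr1n mulr1.
Qed.

Lemma ode_unique f g (u : 'I_n -> {mps F[n]}) : f 0%MM = g 0%MM ->
  (forall i, mps_deriv i f = f * u i) -> (forall i, mps_deriv i g = g * u i) -> f = g.
Proof.
move=> fg0 fu gu; apply/eqP; rewrite -subr_eq0; set d := f - g.
have d0 : d 0%MM = 0 by rewrite /d mpsD mpsN fg0 subrr.
have du i : mps_deriv i d = d * u i by rewrite /d raddfB /= fu gu mulrBl.
apply/eqP/mpsP => m; rewrite mps0.
have [N] := ubnP (mdeg m); elim: N m => // N IH m mN.
have [->//|m0] := eqVneq m 0%MM.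
have [i mi] := mnm_neq0 m0.
have mE : (m - U_(i) + U_(i))%MM = m by rewrite submK // lep1mP.
have := congr1 (fun h : {mps F[n]} => h (m - U_(i))%MM) (du i).
rewrite mps_derivE mE mpsM big1 => [/eqP|[k1 k2] /eqP mk].
  by rewrite -mulr_natr mulf_eq0 (negbTE (F0 _)) orbF => /eqP.
rewrite IH ?mul0r //; apply: leq_trans (mN : (mdeg m <= N)%N).
rewrite -[in X in (_ < X)%N]mE mdegD mdeg1 addn1 ltnS.
by have := congr1 (@mdeg n) mk; rewrite mdegD /=; clear; lia.
Qed.

Definition fexp u : {mps F[n]} :=
  MPS (fun m => \sum_(l < (mdeg m).+1) (u ^+ l) m / l`!%:R).

Definition fexp_trunc D u : {mps F[n]} := \sum_(l < D) mpsC n (l`!%:R)^-1 * u ^+ l.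

Lemma fexp_truncE D u m : u 0%MM = 0 -> (mdeg m < D)%N -> fexp u m = fexp_trunc D u m.
Proof.
move=> u0 mD; rewrite /fexp_trunc mps_sum -(subnKC mD) big_split_ord.
rewrite [X in _ = _ _ X]big1 => [|i _]; last first.
  by rewrite mpsCMl mps_exp_low ?mulr0 //=; clear; lia.
rewrite Monoid.mulm1 /=; apply: eq_bigr => i _.
by rewrite [RHS]mpsCMl mulrC.
Qed.

Lemma fexp_0 u : fexp u 0%MM = 1.
Proof. by rewrite /= mdeg0 big_ord1 expr0 mps1 eqxx fact0 divr1. Qed.

Lemma fexp_deriv i u : u 0%MM = 0 -> mps_deriv i (fexp u) = fexp u * mps_deriv i u.
Proof.
move=> u0; apply: mpsP => m; pose D := (mdeg m).+1.
(* One extra term, since the derivative reads a coefficient of degree [(mdeg m).+1]. *)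
have -> : mps_deriv i (fexp u) m = mps_deriv i (fexp_trunc D.+1 u) m.
  rewrite !mps_derivE -(fexp_truncE u0) //.
  by rewrite mdegD mdeg1 /D; lia.
rewrite (@mpsM_eq_low (fexp u) (fexp_trunc D u)); last first.
  by move=> l lm; apply: fexp_truncE.
congr (mpsfun _ m); rewrite /fexp_trunc raddf_sum mulr_suml big_ord_recl /=.
rewrite mps_derivM mps_derivC mul0r add0r expr0 (mps_derivC i 1) mulr0 add0r.
apply: eq_bigr => l _; rewrite mps_derivM mps_derivC mul0r add0r mps_derivX /bump add1n /=.
rewrite -(rmorph_nat (@mpsC n F)) !mulrA -rmorphM; congr (mpsC n _ * _ * _).
by rewrite factS natrM invfM mulrAC mulVf ?mul1r ?F0.
Qed.

(** Both sides have constant term 1 and the same logarithmic derivatives, so no binomial expansion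
    of power series is required. *)
Lemma fexpD u v : u 0%MM = 0 -> v 0%MM = 0 -> fexp (u + v) = fexp u * fexp v.
Proof.
move=> u0 v0; have uv0 : (u + v) 0%MM = 0 by rewrite mpsD u0 v0 addr0.
apply: (@ode_unique _ _ (fun i => mps_deriv i (u + v))) => [|i|i].
- by rewrite mpsM0 !fexp_0 mulr1.
- exact: fexp_deriv.
- by rewrite mps_derivM !fexp_deriv // raddfD /=; ring.
Qed.

Lemma fexpMn u N : u 0%MM = 0 -> fexp (u *+ N) = fexp u ^+ N.
Proof.
move=> u0; elim: N => [|N IH].
  apply: (@ode_unique _ _ (fun=> 0)) => [|i|i].
  - by rewrite fexp_0 mps1 eqxx.
  - by rewrite mulr0n fexp_deriv ?mps0 // raddf0.
  - by rewrite mulr0 expr0; exact: (mps_derivC i 1).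
rewrite mulrS fexpD // ?IH ?exprS //.
by elim: N {IH} => [|N IH]; [rewrite mulr0n mps0 | rewrite mulrS mpsD IH u0 addr0].
Qed.
End FormalExp.

(** Legendre's formula with p >= 5. The extra term l / p^J closes the induction, because 5 (x / p)
    <= x. *)
Lemma logn_fact_bound p l : prime p -> (3 < p)%N -> (4 * logn p l`! <= l)%N.
Proof.
move=> pp p3; have p5 : (5 <= p)%N.
  by move: p3; rewrite leq_eqVlt => /orP[/eqP e|//]; rewrite -e in pp.
rewrite logn_fact //.
suff H J : (4 * \sum_(1 <= j < J.+1) l %/ p ^ j + l %/ p ^ J <= l)%N.
  by apply: leq_trans (H l); apply: leq_addr.
elim: J => [|J IH]; first by rewrite big_geq // expn0 divn1.
rewrite big_nat_recr //= expnSr divnMA.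
have := leq_divM (l %/ p ^ J) p; move: IH.
move: (\sum_(_ <= _ < _) _)%N (l %/ p ^ J)%N => s x IH.
have : (5 * (x %/ p) <= x %/ p * p)%N by rewrite mulnC leq_mul2l p5 orbT.
move: (x %/ p)%N IH => y; clear; lia.
Qed.

(** * The p-adic exponential on pW *)

Section PadicExp.
Variables (p : nat) (k : closedFieldType) (W : witt_vectors p k).
Hypotheses (char_k : p \in [pchar k]) (p_gt3 : (3 < p)%N).
Local Notation K := {fraction W}.
Implicit Types (a b c d x y : K).

Let p_prime : prime p := pcharf_prime char_k.

Lemma witt_nat_factor l : (0 < l)%N ->
  exists2 u : W, u \is a GRing.unit & (l%:R : W) = p%:R ^+ logn p l * u.
Proof.
move=> l0; exists (l`_p^')%:R.
  rewrite (witt_unit char_k) rmorph_nat -(dvdn_pcharf char_k).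
  by rewrite -p'natE ?part_pnat.
by rewrite -natrX -natrM -p_part partnC.
Qed.

Lemma K_nat_neq0 l : (l.+1%:R : K) != 0.
Proof.
have [u uu Hu] := @witt_nat_factor l.+1 isT.
rewrite -(rmorph_nat (@toK p k W)); apply: toK_neq0; rewrite Hu mulf_neq0 //.
  exact/expf_neq0/witt_p_neq0.
by apply: contraTneq uu => ->; rewrite unitr0.
Qed.

Lemma K_fact_neq0 l : (l`!%:R : K) != 0.
Proof. by have := K_nat_neq0 l`!.-1; rewrite prednK // fact_gt0. Qed.

Lemma padicK_div_nat l N x : (0 < l)%N -> padicK (N + logn p l) x -> padicK N (x / l%:R).
Proof.
move=> l0 [w ->]; have [u uu Hu] := witt_nat_factor l0.
rewrite -(rmorph_nat (@toK p k W)) Hu; exists (w / u).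
have pN : toK (p%:R ^+ logn p l : W) != 0.
  exact/toK_neq0/expf_neq0/witt_p_neq0.
rewrite exprD !rmorphM /= rmorphV //= invfM mulrACA -!mulrA; congr (_ * _).
by rewrite mulrCA !mulrA mulVf // mul1r.
Qed.

Lemma padicK_div_fact l N x : padicK (N + l %/ 4) x -> padicK N (x / l`!%:R).
Proof.
move=> H; apply: padicK_div_nat (fact_gt0 _) _; apply: padicKS H.
by have := logn_fact_bound l p_prime p_gt3; lia.
Qed.

Lemma padicK_exp_term l x : padicK 1 x -> padicK (l - l %/ 4) (x ^+ l / l`!%:R).
Proof.
move=> /(padicKX l); rewrite mul1n => H; apply: padicK_div_fact.
by rewrite subnK // leq_div.
Qed.

Lemma padicK_p : padicK 1 (p%:R : K).
Proof. by exists 1; rewrite mulr1 expr1 rmorph_nat. Qed.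

Lemma padicK_int_nat l : padicK 0 (l%:R : K).
Proof. by apply/padicK_int; exists l%:R; rewrite rmorph_nat. Qed.

Lemma padicK_mul0 N x y : padicK 0 x -> padicK N y -> padicK N (x * y).
Proof. exact: (@padicKM _ _ _ 0). Qed.

Definition exp_sum L a : K := \sum_(l < L) a ^+ l / l`!%:R.

(* For v(a) >= 1 and p > 3 the terms of index >= L have valuation at least
   L - L/4, since 4 v(l!) <= l; the weaker L/2 is easier to handle. *)
Definition is_pexp a c := forall L, padicK L./2 (c - exp_sum L a).

Lemma padicK_exp_tail L l x : padicK 1 x -> (L <= l)%N -> padicK L./2 (x ^+ l / l`!%:R).
Proof. by move=> x1 Ll; apply: padicKS (padicK_exp_term l x1); clear -Ll; lia. Qed.

Lemma is_pexp_exists a : padicK 1 a -> exists c, is_pexp a c.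
Proof.
move=> a1.
have /choice[b Hb] l : exists b : W, a ^+ l / l`!%:R = toK b.
  by apply/padicK_int; apply: padicKS (padicK_exp_term l a1).
(* Partial sums of even length 2N differ from the next by two terms in p^N W, which is the rate that
   [padicW_complete] asks for. *)
have [|s Hs] := @padicW_complete _ _ _ char_k (fun N => \sum_(l < N.*2) b l).
  move=> N; rewrite doubleS !big_ord_recr /= addrAC -addrA addrAC subrr add0r.
  apply: padicWD; apply/padicK_toK; rewrite -Hb.
    by have := padicK_exp_tail a1 (leqnSn N.*2); rewrite doubleK.
  by have := padicK_exp_tail a1 (leqnn N.*2); rewrite doubleK.
exists (toK s) => L.
have H : padicK L./2 (toK s - exp_sum L./2.*2 a).
  have /padicK_toK := Hs L./2; rewrite rmorphB rmorph_sum /=.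
  by under eq_bigr do rewrite -Hb.
have [e|e] : L = L./2.*2 \/ L = L./2.*2.+1.
  by have := odd_double_half L; case: odd => e; [right | left]; rewrite -[LHS]e.
  by rewrite [in exp_sum _ _]e.
rewrite [in exp_sum _ _]e /exp_sum big_ord_recr /= opprD addrA; apply: padicKB => //.
by have := padicK_exp_tail a1 (leqnn L./2.*2); rewrite doubleK.
Qed.

Lemma is_pexp_int a c : is_pexp a c -> padicK 1 a -> padicK 1 (c - 1).
Proof.
(* At length 2 the partial sum is 1 + a, with error in pW. *)
move=> /(_ 2) ac a1; have := padicKD ac a1; congr (padicK 1 _).
rewrite /exp_sum !big_ord_recl big_ord0 /= addr0 expr0 expr1 !divr1 opprD addrA.
by rewrite subrK.
Qed.

Lemma is_pexp_int0 a c : is_pexp a c -> padicK 0 c.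
Proof. by move=> /(_ 0%N); rewrite /exp_sum big_ord0 subr0. Qed.

Lemma has_sum_pexp a c : padicK 1 a -> is_pexp a c ->
  has_sum (@padicK p k W) (fun l : nat => a ^+ l / l`!%:R) c.
Proof.
move=> a1 ac N; exists (iota 0 N.*2) => E uE sE.
rewrite (bigID (fun l => l < N.*2)%N) /= opprD addrA.
have -> : \sum_(l <- E | (l < N.*2)%N) a ^+ l / l`!%:R = exp_sum N.*2 a.
  rewrite -big_filter /exp_sum -(big_mkord xpredT (fun l => a ^+ l / l`!%:R)).
  apply: perm_big; apply: uniq_perm; rewrite ?filter_uniq ?iota_uniq //.
  move=> l; rewrite mem_filter mem_index_iota /=; case: ltnP => //= lN.
  by apply: sE; rewrite mem_iota.
apply: padicKB; first by have := ac N.*2; rewrite doubleK.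
apply: padicK_sum => l; rewrite -leqNgt => Nl.
by have := padicK_exp_tail a1 Nl; rewrite doubleK.
Qed.

Lemma pexp_binomial a b l :
  (a + b) ^+ l / l`!%:R = \sum_(i < l.+1) (a ^+ i / i`!%:R) * (b ^+ (l - i) / (l - i)`!%:R).
Proof.
rewrite addrC exprDn mulr_suml; apply: eq_bigr => i _.
have il : (i <= l)%N by rewrite -ltnS.
have key : 'C(l, i)%:R / l`!%:R = (i`!%:R * (l - i)`!%:R)^-1 :> K.
  apply: (mulIf (K_fact_neq0 l)); rewrite divfK ?K_fact_neq0 // -[in RHS](bin_fact il).
  by rewrite !natrM mulrCA mulVf ?mulr1 // mulf_neq0 ?K_fact_neq0.
rewrite -[_ *+ 'C(l, i)]mulr_natr -[_ * _ / _]mulrA key invfM [RHS]mulrACA.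
by congr (_ * _); apply: mulrC.
Qed.

Lemma exp_sumD L a b :
  exp_sum L (a + b) = \sum_(i < L) (a ^+ i / i`!%:R) * exp_sum (L - i) b.
Proof.
elim: L => [|L IH]; first by rewrite /exp_sum !big_ord0.
rewrite /exp_sum big_ord_recr /= -/(exp_sum L (a + b)) IH pexp_binomial.
rewrite !big_ord_recr /= addrA -big_split /= subnn subSnn -/(exp_sum 1 b).
congr (_ + _); last by rewrite /exp_sum big_ord1.
apply: eq_bigr => i _; rewrite -mulrDr subSn; last exact: ltnW.
by rewrite /exp_sum big_ord_recr.
Qed.

Lemma is_pexpD a b c d : padicK 1 a -> padicK 1 b ->
  is_pexp a c -> is_pexp b d -> is_pexp (a + b) (c * d).
Proof.
move=> a1 b1 ac bd L; rewrite exp_sumD.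
have -> : c * d = (c - exp_sum L a) * d + \sum_(i < L) (a ^+ i / i`!%:R) * d.
  by rewrite -mulr_suml -/(exp_sum L a) mulrBl subrK.
rewrite -addrA -sumrB; apply: padicKD.
  by rewrite mulrC; apply: padicK_mul0 (is_pexp_int0 bd) _.
apply: padicK_sum => i _; rewrite -mulrBr.
apply: padicKS (padicKM (padicK_exp_term i a1) (_ : padicK ((L - i) - (L - i) %/ 4) _)).
  by have := ltn_ord i; clear; lia.
(* [is_pexp] guarantees only half of the length, so the remainder is cut at length 2L, where this is
   harmless, and the terms in between are bounded one by one by the sharper l - l/4. *)
have -> : d - exp_sum (L - i) b = (d - exp_sum L.*2 b) +
    \sum_((L - i) <= l < L.*2) b ^+ l / l`!%:R.
  rewrite /exp_sum -!(big_mkord xpredT (fun l => b ^+ l / l`!%:R)).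
  rewrite (@big_cat_nat _ _ _ (L - i) 0 L.*2) //=; last by clear; lia.
  by rewrite opprD addrA subrK.
apply: padicKD; first by apply: padicKS (bd L.*2); rewrite doubleK; lia.
rewrite big_nat; apply: padicK_sum => l /andP[l1 _].
by apply: padicKS (padicK_exp_term l b1); clear -l1; lia.
Qed.

Lemma is_pexpMn a c N : padicK 1 a -> is_pexp a c -> is_pexp (a *+ N) (c ^+ N).
Proof.
move=> a1 ac; elim: N => [|N IH].
  move=> [|L]; first by rewrite /exp_sum big_ord0 subr0 expr0; exact: padicK_int_nat 1%N.
  rewrite /exp_sum big_ord_recl big1 => [|i _]; last by rewrite mulr0n expr0n mul0r.
  by rewrite !expr0 addr0 divr1 subrr; apply: padicK0.
rewrite mulrS exprS; apply: is_pexpD => //.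
by rewrite -mulr_natr mulrC; apply: padicK_mul0 (padicK_int_nat N) _.
Qed.

(** The difference of the two exponential sums is a - b times a unit 1 + [g]-terms: for l >= 2 the
    cofactor of a - b in (a^l - b^l) / l! has valuation at least l - 1 - l/4 >= 1. *)
Lemma is_pexp_inj a b c : padicK 1 a -> padicK 1 b -> is_pexp a c -> is_pexp b c -> a = b.
Proof.
move=> a1 b1 ac bc; apply/eqP; rewrite -subr_eq0; apply/eqP/(padicK_sep char_k) => N.
pose L := N.*2.+2.
have H : padicK N (exp_sum L a - exp_sum L b).
  have := padicKB (bc L) (ac L); rewrite subr_sub2 subrr sub0r opprB.
  by apply: padicKS; rewrite /L; lia.
pose g l : K := \sum_(i < l.+2) a ^+ (l.+1 - i) * b ^+ i / l.+2`!%:R.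
have E : exp_sum L a - exp_sum L b = (a - b) * (1 + \sum_(l < N.*2) g l).
  rewrite /exp_sum -sumrB !big_ord_recl /= !expr0 subrr add0r !expr1 -mulrBl divr1.
  rewrite mulrDr mulr1 mulr_sumr; congr (_ + _); apply: eq_bigr => l _.
  by rewrite -mulrBl subrXX -mulrA mulr_suml.
have g1 : padicK 1 (\sum_(l < N.*2) g l).
  apply: padicK_sum => l _; rewrite /g -mulr_suml; apply: padicK_div_fact.
  apply: padicK_sum => i _.
  apply: padicKS (padicKM (padicKX (l.+1 - i) a1) (padicKX i b1)).
  by have := ltn_ord i; clear; lia.
have [w Hw] := g1; rewrite expr1 in Hw.
have u1 : (1 + p%:R * w : W) \is a GRing.unit.
  rewrite (witt_unit char_k) rmorphD rmorphM rmorph_nat (pcharf0 char_k) mul0r addr0.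
  by rewrite rmorph1 oner_neq0.
have e : (a - b) = toK (1 + p%:R * w)^-1 * ((a - b) * (1 + \sum_(l < N.*2) g l)).
  rewrite Hw -(rmorph1 (@toK p k W)) -rmorphD mulrCA -rmorphM mulVr //.
  by rewrite rmorph1 mulr1.
by rewrite e; apply: padicK_mul0; [apply/padicK_int; eexists | rewrite -E].
Qed.

Section Sigma.
Variables (sigma : {rmorphism W -> W}) (s : {rmorphism K -> K}).
Hypotheses (sigma_frob : is_frobenius sigma) (sE : sigmaK sigma =1 s).

Lemma padicK_s N x : padicK N x -> padicK N (s x).
Proof. by rewrite -sE; apply: padicK_sigmaK. Qed.

Lemma is_pexp_s a c : is_pexp a c -> is_pexp (s a) (s c).
Proof.
move=> ac L; have := padicK_s (ac L); rewrite rmorphB rmorph_sum /=.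
congr (padicK _ (_ - _)); apply: eq_bigr => i _.
by rewrite rmorphM fmorphV rmorph_nat rmorphXn.
Qed.

(** As sigma preserves the valuation, s x - p x has the valuation of x; the induction removes one
    power of p from the denominator at a time. This is how tau_i(0) is seen to lie in pW. *)
Lemma padicK_s_sub x : padicK 1 (s x - p%:R * x) -> padicK 1 x.
Proof.
have s1 y : padicK 0 y -> padicK 1 (s y) -> padicK 1 y.
  move=> /padicK_int[w ->]; rewrite -sE (sigmaK_toK sigma_frob).
  move/padicK_toK=> [v Hv]; apply/padicK_toK.
  have [[t st ts] _] := sigma_frob; exists (t v).
  by apply: (can_inj st); rewrite Hv rmorphM rmorphXn rmorph_nat ts.
move=> Hx; have [B HB] := padicK_bounded char_k x.
elim: B HB => [|B IH] HB.
  rewrite expr0 mul1r in HB; apply: s1 => //; rewrite -(subrK (p%:R * x) (s x)).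
  by apply: padicKD => //; apply: (padicKM padicK_p HB).
apply: IH; apply/(padicK_shift char_k 1); rewrite expr1 mulrA -exprS.
apply: s1 => //; rewrite rmorphM rmorphXn rmorph_nat -(subrK (p%:R * x) (s x)) mulrDr.
apply: padicKD; last by rewrite mulrCA; apply: (padicKM padicK_p HB).
apply: padicK_mul0 Hx; apply/padicK_int; exists (p%:R ^+ B.+1).
by rewrite rmorphXn rmorph_nat.
Qed.
End Sigma.
End PadicExp.

(** * Dwork's lemma *)

Section FrobExt.
Variables (p : nat) (k : closedFieldType) (W : witt_vectors p k).
Hypotheses (char_k : p \in [pchar k]) (p_gt3 : (3 < p)%N).
Local Notation K := {fraction W}.
Variables (sigma : {rmorphism W -> W}) (s : {rmorphism K -> K}) (n : nat).
Hypotheses (sigma_frob : is_frobenius sigma) (sE : sigmaK sigma =1 s).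
Local Notation A := {mps W[n]}.
Local Notation AK := {mps K[n]}.
Implicit Types (phi : frob_lift sigma n) (f g : AK) (a : A) (m l : 'X_{1..n}).

Lemma frob_lift_p phi a : Iad 1 (phi a - a ^+ p).
Proof.
apply/Iad1P/(residue_eq0 char_k).
have := congr1 (fun h : {mps k[n]} => h 0%MM) (frob_lift_red phi a).
by rewrite -rmorphXn /= -[RHS]/(residue ((a ^+ p) 0%MM)) => H; rewrite rmorphB /= H subrr.
Qed.

Lemma frob_lift_sub_p phi a : exists b, phi a - a ^+ p = p%:R * b.
Proof.
have /choice[b Hb] m : exists w : W, (phi a - a ^+ p) m = p%:R * w.
  have [|w Hw] := (residue_eq0 char_k ((phi a - a ^+ p) m)).1; last by exists w.
  have := congr1 (fun h : {mps k[n]} => h m) (frob_lift_red phi a).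
  by rewrite -rmorphXn /= -[RHS]/(residue ((a ^+ p) m)) => H; rewrite rmorphB /= H subrr.
by exists (MPS b); apply: mpsP => m; rewrite Hb mps_natMl.
Qed.

Lemma Iad_frob_mpsX phi i : Iad 1 (phi (mpsX W i)).
Proof.
rewrite -(subrK (mpsX W i ^+ p) (phi _)); apply: IadD; first exact: frob_lift_p.
have p_gt0 : (0 < p)%N by apply/prime_gt0/(pcharf_prime char_k).
by apply: IadS p_gt0 _; apply: IadX; apply: Iad_mpsX.
Qed.

Lemma frob_extP phi g g' : frob_ext phi g g' <->
  evalK (fun i => toAK (phi (mpsX W i))) (mps_map s g) g'.
Proof.
have H m : (fun l => sigmaK sigma (g l) * toAK (mmap1 (fun i => phi (mpsX W i)) l) m) =
  (fun l => (mps_map s g) l * mmap1 (fun i => toAK (phi (mpsX W i))) l m).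
  by apply: funext => l; rewrite mmap1_rmorph /= sE.
by split=> G m; [rewrite -H | rewrite H].
Qed.

Lemma frob_ext_unique phi f g g' : frob_ext phi f g -> frob_ext phi f g' -> g = g'.
Proof. by move=> /frob_extP h1 /frob_extP h2; apply: evalK_unique h1 h2. Qed.

Lemma frob_extB phi f g f' g' :
  frob_ext phi f f' -> frob_ext phi g g' -> frob_ext phi (f - g) (f' - g').
Proof.
move=> /frob_extP h1 /frob_extP h2; apply/frob_extP; rewrite rmorphB.
exact: evalKB.
Qed.

Lemma frob_extM phi f g f' g' :
  frob_ext phi f f' -> frob_ext phi g g' -> frob_ext phi (f * g) (f' * g').
Proof.
move=> /frob_extP h1 /frob_extP h2; apply/frob_extP; rewrite rmorphM.
exact: evalKM.
Qed.

Lemma frob_ext_toAK phi a : frob_ext phi (toAK a) (toAK (phi a)).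
Proof.
have := rmorph_expd a (frob_liftC phi) (Iad_frob_mpsX phi).
move=> /(is_expansionP char_k (Iad_frob_mpsX phi)) H m N.
have [E0 HE] := H m N; exists E0 => E uE sE'; have [w Hw] := HE E uE sE'.
exists w; rewrite -Hw rmorphB rmorph_sum; congr (_ - _); apply: eq_bigr => l _.
by rewrite rmorphM /= -(sigmaK_toK sigma_frob).
Qed.

Lemma frob_ext0 phi : frob_ext phi 0 0.
Proof. by have := frob_ext_toAK phi 0; rewrite !rmorph0. Qed.
Lemma frob_ext1 phi : frob_ext phi 1 1.
Proof. by have := frob_ext_toAK phi 1; rewrite !rmorph1. Qed.

Lemma frob_extN phi f f' : frob_ext phi f f' -> frob_ext phi (- f) (- f').
Proof. by rewrite -[- f]sub0r -[- f']sub0r; apply/frob_extB/frob_ext0. Qed.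

Lemma frob_extD phi f g f' g' :
  frob_ext phi f f' -> frob_ext phi g g' -> frob_ext phi (f + g) (f' + g').
Proof.
move=> h1 h2; rewrite -[g]opprK -[g']opprK; apply: (frob_extB h1).
exact: frob_extN.
Qed.

Lemma frob_ext_sum phi (I : Type) (r : seq I) (P : pred I) (F G : I -> AK) :
  (forall i, P i -> frob_ext phi (F i) (G i)) ->
  frob_ext phi (\sum_(i <- r | P i) F i) (\sum_(i <- r | P i) G i).
Proof.
move=> H; elim/big_ind2: _ => //; [exact: frob_ext0 | by move=> *; apply: frob_extD].
Qed.

Lemma frob_extX phi f f' N : frob_ext phi f f' -> frob_ext phi (f ^+ N) (f' ^+ N).
Proof.
move=> ff; elim: N => [|N IH]; first by rewrite !expr0; apply: frob_ext1.
by rewrite !exprS; apply: frob_extM.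
Qed.

Lemma frob_extC phi (c : K) : frob_ext phi (mpsC n c) (mpsC n (s c)).
Proof.
move=> m N; exists [:: 0%MM] => E uE sE0.
rewrite (bigD1_seq 0%MM) //; last by apply: sE0; rewrite inE.
rewrite big1 => [|l nl]; last by rewrite /= (negbTE nl) sE rmorph0 mul0r.
rewrite Monoid.mulm1 mpsCE0 mmap11 rmorph1 mps1 sE.
rewrite (_ : mpsC n (s c) m = s c * (m == 0%MM)%:R) ?subrr; first exact: padicK0.
by rewrite /=; case: eqP; rewrite (mulr1, mulr0).
Qed.

Lemma jacobian0_mpsX : jacobian0 (@mpsX n W) = 1%:M.
Proof. by apply/matrixP => i j; rewrite !mxE mpsXE1. Qed.

Lemma standard_lift_exists : exists psi : frob_lift sigma n,
  forall i, psi (mpsX W i) = mpsX W i ^+ p.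
Proof.
apply: (frob_lift_exists char_k sigma_frob (x := @mpsX n W) (L := 1%:M)).
- exact: Iad_mpsX.
- by rewrite jacobian0_mpsX mulmx1 map_mx1.
- by move=> i; rewrite rmorphXn.
Qed.

Section StandardLift.
Variable psi : frob_lift sigma n.
Hypothesis psiX : forall i, psi (mpsX W i) = mpsX W i ^+ p.

Let p_gt1 : (1 < p)%N. Proof. exact/prime_gt1/(pcharf_prime char_k). Qed.

Definition mnm_div m : 'X_{1..n} := [multinom (m i %/ p)%N | i < n].

(** For psi(t_i) = t_i^p the sum defining psi(f) has at most one nonzero term at each monomial, so
    this closed formula is valid for every series over K. *)
Definition standard_ext f : AK :=
  MPS (fun m => if [forall i, p %| m i]%N then s (f (mnm_div m)) else 0).

Lemma mnm_divK m : [forall i, p %| m i]%N -> (mnm_div m *+ p)%MM = m.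
Proof.
by move=> /forallP pm; apply/mnmP => i; rewrite mulmnE mnmE divnK.
Qed.

Lemma mnm_mulK l : mnm_div (l *+ p)%MM = l.
Proof. by apply/mnmP => i; rewrite mnmE mulmnE mulnK // ltnW. Qed.

Lemma toAK_mpsXm l : toAK (mpsXm W l : A) = mpsXm K l.
Proof. by apply: mpsP => m /=; rewrite rmorph_nat. Qed.

Lemma mmap1_standard l : mmap1 (fun i => psi (mpsX W i)) l = mpsXm W (l *+ p)%MM.
Proof.
rewrite mpsXmMn -mmap1_mpsX /mmap1 -prodrXl; apply: eq_bigr => i _.
by rewrite psiX -!exprM mulnC.
Qed.

Lemma frob_ext_standard f : frob_ext psi f (standard_ext f).
Proof.
move=> m N; exists [:: mnm_div m] => E uE sE0.
rewrite (bigD1_seq (mnm_div m)) //; last by apply: sE0; rewrite inE.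
rewrite big1 => [|l nl]; last first.
  rewrite mmap1_standard toAK_mpsXm /=; case: (m =P _) => [e|]; last by rewrite mulr0.
  by move: nl; rewrite e mnm_mulK eqxx.
rewrite Monoid.mulm1 mmap1_standard toAK_mpsXm sE /=.
case: ifP => pm; first by rewrite mnm_divK // eqxx mulr1 subrr; apply: padicK0.
case: eqP => [e|_]; last by rewrite mulr0 subr0; apply: padicK0.
by case/negP: (negbT pm); apply/forallP => i; rewrite e mulmnE dvdn_mull.
Qed.

Lemma standard_extE f g : frob_ext psi f g -> standard_ext f = g.
Proof. exact/frob_ext_unique/frob_ext_standard. Qed.

(** The exponent m / p has smaller degree than m, so psi(f)_m involves only coefficients of degree
    below that of m. This makes the functional equation in Dwork's lemma a recursion. *)
Lemma standard_ext_low f g m : m != 0%MM ->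
  (forall l, (mdeg l < mdeg m)%N -> f l = g l) -> standard_ext f m = standard_ext g m.
Proof.
move=> m0 fg /=; case: ifP => // pm; rewrite fg //.
have := congr1 (@mdeg n) (mnm_divK pm); rewrite mdegMn.
by move: m0 p_gt1; rewrite -mdeg_eq0; clear; nia.
Qed.

Lemma standard_ext_0 f : standard_ext f 0%MM = s (f 0%MM).
Proof.
rewrite /= ifT; last by apply/forallP => i; rewrite mnm0E dvdn0.
by congr (s (f _)); apply/mnmP => i; rewrite mnmE mnm0E div0n.
Qed.

Lemma standard_ext_fexp f : f 0%MM = 0 -> standard_ext (fexp f) = fexp (standard_ext f).
Proof.
move=> f0; apply: mpsP => m; pose D := (mdeg m).+1.
have -> : standard_ext (fexp f) m = standard_ext (fexp_trunc D f) m.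
  have [->|m0] := eqVneq m 0%MM; last first.
    apply: standard_ext_low m0 _ => l lm; apply: fexp_truncE => //.
    by rewrite /D ltnS ltnW.
  by rewrite !standard_ext_0 -fexp_truncE // mdeg0.
rewrite (@fexp_truncE _ _ D) //; last by rewrite standard_ext_0 f0 rmorph0.
congr (mpsfun _ m); apply: standard_extE; apply: frob_ext_sum => l _.
apply: frob_extM; last exact/frob_extX/frob_ext_standard.
by have := frob_extC psi (l`!%:R)^-1; rewrite (fmorphV s) (rmorph_nat s).
Qed.

(* Dwork's lemma: the functional equation E(t^p) = E(t)^p exp(p u) determines
   p E_m modulo p from the coefficients of lower degree. *)
Lemma fexp_integral f (u : A) : f 0%MM = 0 ->
  frob_ext psi f (f *+ p + p%:R * toAK u) -> exists q : A, fexp f = toAK q.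
Proof.
have F0 := K_nat_neq0 W char_k.
move=> f0 /standard_extE fE; have pK0 := K_p_neq0 W char_k.
set pu := p%:R * toAK u in fE.
have fp0 : (f *+ p) 0%MM = 0 by rewrite -mulr_natl mps_natMl f0 mulr0.
have pu0 : pu 0%MM = 0.
  have := congr1 (fun h : AK => h 0%MM) fE.
  by rewrite standard_ext_0 f0 rmorph0 mpsD fp0 add0r.
have [[E EE] [V VE]] : (exists E, E = fexp f) /\ exists V, V = fexp pu.
  by split; eexists.
have EV : standard_ext E = E ^+ p * V.
  by rewrite EE VE (standard_ext_fexp f0) fE (fexpD F0 fp0 pu0) (fexpMn F0 p f0).
have V0 : V 0%MM = 1 by rewrite VE fexp_0.
have E0 : E 0%MM = 1 by rewrite EE fexp_0.
(* For l >= 1 the quotient p^l / l! is divisible by p, since l - l/4 >= 1. *)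
have [v Hv] : exists v : A, V = toAK (1 + p%:R * v).
  have /choice[v Hv] m : exists w, V m - (1 : AK) m = toK (p%:R * w).
    rewrite VE /= big_ord_recl expr0 fact0 divr1 addrAC -/(1 : AK).
    rewrite subrr add0r; suff [w ->] : padicK 1 (\sum_(i < mdeg m)
        (pu ^+ lift ord0 i) m / (lift ord0 i)`!%:R) by exists w; rewrite expr1.
    apply: padicK_sum => i _; apply: (padicK_div_fact char_k p_gt3).
    rewrite /pu exprMn -(rmorphXn (@toAK p k W n)) -natrX mps_natMl natrX.
    have -> : toAK (u ^+ lift ord0 i) m = toK ((u ^+ lift ord0 i) m) by [].
    rewrite -(rmorph_nat (@toK p k W)) -rmorphXn -rmorphM; apply/padicK_toK.
    apply: (@padicWS _ _ _ _ (lift ord0 i)); last by eexists.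
    by rewrite lift0; clear; lia.
  exists (MPS v); apply: mpsP => m; apply/eqP; rewrite -subr_eq0.
  rewrite rmorphD rmorph1 mpsD opprD addrA Hv subr_eq0; apply/eqP.
  by rewrite -[RHS]/(toK ((p%:R * MPS v) m)) mps_natMl.
have Eint d m : (mdeg m < d)%N -> padicK 0 (E m).
  elim: d m => // d IH m md.
  have [->|m0] := eqVneq m 0%MM; first by rewrite E0; apply: padicK_int_nat 1%N.
  (* [P] equals E below the degree of m, where E is integral by induction, and 0 elsewhere; the
     default g_m = 0 isolates E_m. *)
  have /choice[P HP] (l : 'X_{1..n}) : exists w : W,
      if (mdeg l < mdeg m)%N then E l = toK w else w = 0.
    case lm: (mdeg l < mdeg m)%N; last by exists 0.
    by apply/padicK_int/IH; apply: leq_trans lm _.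
  have [g Hg] : exists g, g = toAK (MPS P) by eexists.
  have gE l : (mdeg l < mdeg m)%N -> E l = g l by move=> lm; have := HP l; rewrite lm Hg.
  have gm : g m = 0 by rewrite Hg /=; have := HP m; rewrite ltnn => ->; rewrite rmorph0.
  have g0 : g 0%MM = 1.
    rewrite -gE ?E0 // mdeg0 lt0n mdeg_eq0; exact: m0.
  have XE l : (mdeg l <= mdeg m)%N -> (E ^+ p - g ^+ p) l = p%:R * (E l - g l).
    move=> lm; rewrite mpsD mpsN.
    apply: (mpsX_low _ E0 g0) => l' ll; apply: gE; exact: leq_trans ll lm.
  (* E^p V and g^p V differ at m by p E_m, while psi(E) and psi(g) agree at m. So p E_m is a
     coefficient of psi(g) - g^p V, divisible by p because psi(g) = g^p and V = 1 modulo p. *)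
  have key : p%:R * E m = standard_ext E m - (g ^+ p * V) m.
    rewrite EV -mpsN -mpsD -mulrBl mpsM_low; last first.
      by move=> l lm; rewrite XE ?(ltnW lm) // gE // subrr mulr0.
    by rewrite V0 mulr1 XE // gm subr0.
  apply/(padicK_shift char_k 1); rewrite expr1 key addn0.
  rewrite (standard_ext_low m0 gE) {1}Hg (standard_extE (frob_ext_toAK psi (MPS P))).
  rewrite Hv Hg -rmorphXn -rmorphM -mpsN -mpsD -rmorphB.
  have [b Hb] := frob_lift_sub_p psi (MPS P).
  have -> : psi (MPS P) - MPS P ^+ p * (1 + p%:R * v) = p%:R * (b - MPS P ^+ p * v).
    by rewrite mulrDr mulr1 opprD addrA Hb mulrBr mulrCA.
  rewrite -[toAK _ m]/(toK (_ m)) mps_natMl; apply/padicK_toK; rewrite -[p%:R]expr1.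
  by eexists.
have /choice[q Hq] m := (padicK_int (E m)).1 (Eint _ m (leqnn _)).
by exists (MPS q); apply: mpsP => m; rewrite -EE Hq.
Qed.
End StandardLift.
End FrobExt.

Lemma period_identity (R : comNzRingType) N (t u x w : R) :
  N%:R * t + N%:R * u - (N%:R * w + N%:R * x) = (t - x) *+ N + N%:R * (u - w).
Proof. by rewrite -[in RHS]mulr_natl; ring. Qed.

Lemma evaluation_identity (R : comNzRingType) (c d e x q r : R) :
  x - c * d = x - q + (q - c * r) - c * (e - r) - c * (d - e).
Proof. by ring. Qed.

(** * Exponentials of periods and their Frobenius images *)

Section Periods.
Variables (p : nat) (k : closedFieldType) (W : witt_vectors p k).
Hypotheses (char_k : p \in [pchar k]) (p_gt3 : (3 < p)%N).
Local Notation K := {fraction W}.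
Variables (sigma : {rmorphism W -> W}) (s : {rmorphism K -> K}) (n : nat).
Hypotheses (sigma_frob : is_frobenius sigma) (sE : sigmaK sigma =1 s).
Local Notation A := {mps W[n]}.
Local Notation AK := {mps K[n]}.
Implicit Types (phi : frob_lift sigma n) (f g : AK) (a : A) (m l : 'X_{1..n}).

Let F0 := K_nat_neq0 W char_k.

Lemma mps_sub_const0 (R : comNzRingType) (f : {mps R[n]}) : (f - mpsC n (f 0%MM)) 0%MM = 0.
Proof. by rewrite mpsD mpsN mpsCE0 subrr. Qed.

Lemma period_exp (psi : frob_lift sigma n) (tau : AK) (u : A) :
  (forall i, psi (mpsX W i) = mpsX W i ^+ p) ->
  frob_ext psi tau (p%:R * tau + p%:R * toAK u) ->
  padicK 1 (tau 0%MM) /\ exists (q : A) (c : W),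
    is_pexp (tau 0%MM) (toK c) /\
    toAK q = mpsC n (toK c) * fexp (tau - mpsC n (tau 0%MM)).
Proof.
move=> psiX Htau; set t0 := tau 0%MM; set theta := tau - mpsC n t0.
have st0 : s t0 = p%:R * t0 + p%:R * toK (u 0%MM).
  have := congr1 (fun h : AK => h 0%MM)
    (standard_extE char_k sE psiX Htau).
  by rewrite standard_ext_0 mpsD !mps_natMl.
have t01 : padicK 1 t0.
  apply: (padicK_s_sub char_k sigma_frob sE); rewrite st0 addrAC subrr add0r.
  by exists (u 0%MM); rewrite expr1 rmorphM rmorph_nat.
split=> //.
have theta0 : theta 0%MM = 0 by apply: mps_sub_const0.
(* Removing the constant term t0 from tau replaces u by u - w in the Frobenius equation, where p w =
   s(t0) - p t0. *)
have [w Hw] : padicK 1 (s t0 - p%:R * t0).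
  by rewrite st0 addrAC subrr add0r; exists (u 0%MM); rewrite expr1 rmorphM rmorph_nat.
have [E HE] : exists q : A, fexp theta = toAK q.
  apply: (fexp_integral char_k p_gt3 sigma_frob sE psiX (u := u - mpsC n w)) => //.
  have := frob_extB sE Htau (frob_extC sE psi t0).
  congr (frob_ext psi _ _); rewrite rmorphB /= toAKC.
  have -> : mpsC n (s t0) = p%:R * mpsC n (toK w) + p%:R * mpsC n t0.
    rewrite -(rmorph_nat (@mpsC n K)) -!rmorphM -rmorphD; congr (mpsC n _).
    apply/eqP; rewrite -subr_eq Hw expr1 rmorphM rmorph_nat; exact: eqxx.
  exact: period_identity.
have [c Hc] := is_pexp_exists char_k p_gt3 t01.
have /padicK_int[c' Hc'] := is_pexp_int0 Hc.
exists (mpsC n c' * E), c'; rewrite -Hc'; split=> //.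
by rewrite rmorphM /= toAKC -HE Hc'.
Qed.

Lemma has_sum_padicK_closed (I : eqType) (f : I -> K) (x : K) N :
  has_sum (@padicK p k W) f x -> (forall i, padicK N (f i)) -> padicK N x.
Proof.
move=> /(_ N)[E0 HE] Hf; have H := HE (undup E0) (undup_uniq _) (fun j => etrans (mem_undup _ _)).
by rewrite -(subrK (\sum_(i <- undup E0) f i) x); apply: padicKD H _; apply: padicK_sum.
Qed.

(* At t = 0, phi(f) is the sum of the sigma(f_l) phi(t)^l(0).  As the derivatives
   of theta are integral, the denominator of theta_l divides the nonzero l_j, while
   phi(t)^l(0) lies in (p^|l|): hence this sum may be exchanged with the
   exponential series. *)
Section EvaluationAtZero.
Variables (phi : frob_lift sigma n) (tau tau' : AK) (q : A) (c : W) (g : 'I_n -> A).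
Hypotheses (Htau : frob_ext phi tau tau') (tau0 : padicK 1 (tau 0%MM)).
Hypothesis (dtau : forall j, mps_deriv j tau = toAK (g j)).
Let theta := tau - mpsC n (tau 0%MM).
Hypotheses (Hc : is_pexp (tau 0%MM) (toK c)) (Hq : toAK q = mpsC n (toK c) * fexp theta).

Let y l : K := toAK (mmap1 (fun i => phi (mpsX W i)) l) 0%MM.
Let b f l : K := s (f l) * y l.

Let yD l l' : y (l + l')%MM = y l * y l'.
Proof.
rewrite /y commr_mmap1_M ?rmorphM ?mpsM0 // => i x; exact: mulrC.
Qed.

Let y_low l : padicK (mdeg l) (y l).
Proof.
apply/padicK_toK; have := Iad_mmap1 (Iad_frob_mpsX char_k phi) l 0%MM.
by rewrite mdeg0 subn0.
Qed.

Let has_sum_b f f' : frob_ext phi f f' -> has_sum (@padicK p k W) (b f) (f' 0%MM).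
Proof.
move=> /(_ 0%MM); rewrite /b; congr (has_sum _ _ _).
by apply: funext => l; rewrite sE.
Qed.

Let theta0 : theta 0%MM = 0. Proof. exact: mps_sub_const0. Qed.

Let theta_low l : padicK 1 (b theta l).
Proof.
have [->|l0] := eqVneq l 0%MM.
  by rewrite /b theta0 rmorph0 mul0r; apply: padicK0.
have [j lj] := mnm_neq0 l0.
have lj0 : (0 < l j)%N by rewrite lt0n.
have lE : (l - U_(j) + U_(j))%MM = l by rewrite submK // lep1mP.
have tl : tau l = toK (g j (l - U_(j))%MM) / (l j)%:R.
  have := congr1 (fun h : AK => h (l - U_(j))%MM) (dtau j).
  rewrite mps_derivE lE mnmBE mnm1E eqxx subn1 prednK // => e.
  apply: (mulIf (_ : (l j)%:R != 0)); first by rewrite -(prednK lj0) F0.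
  rewrite divfK; last by rewrite -(prednK lj0) F0.
  by rewrite mulr_natr e.
have -> : b theta l = (s (toK (g j (l - U_(j))%MM)) * y l) / (l j)%:R.
  rewrite /b /theta mpsD mpsN /= (negbTE l0) subr0 tl rmorphM fmorphV rmorph_nat.
  by rewrite mulrAC.
apply: (padicK_div_nat char_k lj0); apply: (@padicK_mul0 _ _ _ _ (s _)).
  by apply: (padicK_s sigma_frob sE); apply/padicK_int; eexists.
apply: padicKS (y_low l); rewrite add1n.
apply: leq_trans (ltn_logl p lj0) _; rewrite mdegE (bigD1 j) //=; exact: leq_addr.
Qed.

Let thetaX_low i l : padicK i (b (theta ^+ i) l).
Proof.
elim: i l => [|i IH] l.
  rewrite /b expr0 mps1 rmorph_nat; apply: padicK_mul0; first exact: padicK_int_nat.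
  exact: padicKS (y_low l).
rewrite /b exprS mpsM rmorph_sum mulr_suml; apply: padicK_sum => -[k1 k2] /= /eqP lk.
rewrite rmorphM (congr1 y lk) yD mulrACA -add1n; apply: padicKM; first exact: theta_low.
exact: IH.
Qed.

Lemma frob_lift_exp_at0 :
  padicK 1 (tau' 0%MM) /\ is_pexp (tau' 0%MM) (toK (phi q 0%MM)).
Proof.
pose theta' := tau' - mpsC n (s (tau 0%MM)).
have Htheta : frob_ext phi theta theta' by apply/frob_extB/frob_extC.
pose t := theta' 0%MM.
have t1 : padicK 1 t by apply: has_sum_padicK_closed (has_sum_b Htheta) theta_low.
have tE : tau' 0%MM = s (tau 0%MM) + t.
  by rewrite /t /theta' mpsD mpsN mpsCE0 addrC subrK.
have s1 : padicK 1 (s (tau 0%MM)) by apply: (padicK_s sigma_frob sE).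
split; first by rewrite tE; apply: padicKD.
have [d Hd] := is_pexp_exists char_k p_gt3 t1.
suff -> : toK (phi q 0%MM) = s (toK c) * d.
  by rewrite tE; apply: (is_pexpD char_k p_gt3) => //; apply: (is_pexp_s sigma_frob sE).
have sc0 : padicK 0 (s (toK c)) by apply: (padicK_s sigma_frob sE); apply: is_pexp_int0 Hc.
apply/eqP; rewrite -subr_eq0; apply/eqP/(padicK_sep char_k) => N.
pose L := N.*2.
have nb0 := @padicK0 p k W; have nbB := @padicKB p k W.
have [D1 [_ HD1]] := (has_sum_mdeg nb0 nbB _ _).1
  (has_sum_b (frob_ext_toAK char_k sigma_frob phi q)) N.
(* The L additional digits absorb the denominators i! for i < L. *)
have /choice[D2 HD2] (i : 'I_L) : exists D0, forall D, (D0 <= D)%N ->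
    padicK (N + L) (t ^+ i - \sum_(l : 'X_{1..n < D}) b (theta ^+ i) l).
  have [D0 [_ H]] := (has_sum_mdeg nb0 nbB _ _).1
    (has_sum_b (frob_extX char_k sigma_frob sE i Htheta)) (N + L)%N.
  by exists D0 => D /H; rewrite mpsX0.
pose D := maxn D1 (\max_i D2 i).
have {HD1}H1 := HD1 D (leq_maxl _ _).
have {HD2}H2 i := HD2 i D (leq_trans (leq_bigmax i) (leq_maxr _ _)).
(* At the monomial l the exponential is an exact finite sum of [L + (mdeg l).+1] terms; those of
   index i >= L lie in p^(i - i/4) W, within p^N W as L = 2N. *)
have bq l : padicK N (b (toAK q) l - s (toK c) * \sum_(i < L) b (theta ^+ i) l / i`!%:R).
  have -> : b (toAK q) l =
      s (toK c) * \sum_(i < L + (mdeg l).+1) b (theta ^+ i) l / i`!%:R.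
    rewrite /b Hq mpsCMl (@fexp_truncE _ _ (L + (mdeg l).+1)) //; last by rewrite leq_addl.
    rewrite rmorphM -mulrA; congr (_ * _).
    rewrite /fexp_trunc mps_sum rmorph_sum mulr_suml; apply: eq_bigr => i _.
    by rewrite mpsCMl (rmorphM s) (fmorphV s) (rmorph_nat s) -mulrA mulrC.
  rewrite -mulrBr big_split_ord /= addrAC subrr add0r.
  apply: padicK_mul0 => //; apply: padicK_sum => i _.
  apply: (padicK_div_fact char_k p_gt3); apply: padicKS (thetaX_low _ _).
  by rewrite /L; clear; lia.
have -> : toK (phi q 0%MM) - s (toK c) * d =
    (toAK (phi q) 0%MM - \sum_(l : 'X_{1..n < D}) b (toAK q) l)
    + \sum_(l : 'X_{1..n < D}) (b (toAK q) l - s (toK c) * \sum_(i < L) b (theta ^+ i) l / i`!%:R)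
    - s (toK c) * (\sum_(i < L) (t ^+ i - \sum_(l : 'X_{1..n < D}) b (theta ^+ i) l) / i`!%:R)
    - s (toK c) * (d - exp_sum L t).
  rewrite sumrB -mulr_sumr exchange_big /=.
  under [in X in _ - s (toK c) * X - _]eq_bigr do rewrite mulrBl mulr_suml.
  rewrite sumrB -/(exp_sum L t).
  exact: evaluation_identity.
apply: padicKB; last by apply: padicK_mul0 => //; have := Hd L; rewrite doubleK.
apply: padicKB; last first.
  apply: padicK_mul0 => //; apply: padicK_sum => i _.
  apply: (padicK_div_fact char_k p_gt3); apply: padicKS (H2 i).
  by have := ltn_ord i; clear; lia.
by apply: padicKD => //; apply: padicK_sum => l _; apply: bq.
Qed.
End EvaluationAtZero.
End Periods.

(** * Ordinary CY3 crystals *)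

Section Divisibility.
Variables (p : nat) (k : closedFieldType) (W : witt_vectors p k).
Hypotheses (char_k : p \in [pchar k]) (p_gt3 : (3 < p)%N).
Local Notation K := {fraction W}.
Variables (sigma : {rmorphism W -> W}) (n r : nat).
Local Notation A := {mps W[n]}.
Local Notation AK := {mps K[n]}.
Implicit Types (phi psi : frob_lift sigma n) (m : 'X_{1..n}).

Lemma chi_coef_divisible phi psi m :
  exists a : A, chi_coef phi psi m = toAK (p%:R ^+ minn (mdeg m) 3 * a).
Proof.
have /choice[a Ha] (j : 'I_n) : exists a : A,
    mpsC n (p%:R ^+ m j / (m j)`!%:R) *
    (mpsC n p%:R^-1 * toAK (phi (mpsX W j) - psi (mpsX W j))) ^+ m j =
    toAK (p%:R ^+ minn (m j) 3 * a).
  have [b Hb] := frob_lift_sub_p char_k phi (mpsX W j).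
  have [c Hc] := frob_lift_sub_p char_k psi (mpsX W j).
  have -> : phi (mpsX W j) - psi (mpsX W j) = p%:R * (b - c).
    by rewrite mulrBr -Hb -Hc opprB addrA subrK.
  have [w ->] : padicK (minn (m j) 3) (p%:R ^+ m j / (m j)`!%:R : K).
    apply: padicKS (padicK_exp_term char_k p_gt3 (m j) (padicK_p W)).
    by clear; lia.
  exists (mpsC n w * (b - c) ^+ m j).
  have -> : mpsC n (p%:R : K)^-1 * toAK (p%:R * (b - c)) = toAK (b - c).
    rewrite (rmorphM (@toAK p k W n)) rmorph_nat mulrA -(rmorph_nat (@mpsC n K)) -rmorphM.
    by rewrite mulVf ?K_p_neq0 // rmorph1 mul1r.
  rewrite -toAKC -(rmorphXn (@toAK p k W n)) -(rmorphM (@toAK p k W n)); congr toAK.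
  by rewrite (rmorphM (@mpsC n W)) (rmorphXn (@mpsC n W)) (rmorph_nat (@mpsC n W)) mulrA.
exists (p%:R ^+ (\sum_j minn (m j) 3 - minn (mdeg m) 3) * \prod_j a j).
rewrite mulrA -exprD subnKC; last first.
  rewrite mdegE; elim/big_rec2: _ => [|j x y _]; first by rewrite min0n.
  by clear; lia.
rewrite /chi_coef (eq_bigr _ (fun j _ => Ha j)) -rmorph_prod; congr toAK.
by rewrite big_split /= prodrXr.
Qed.

Variables (H : fcrystal_data sigma n r) (Fil : nat -> 'cV[A]_r -> Prop).
Hypotheses (H_hodge : is_hodge_fcrystal H Fil) (H_div : is_divisible H Fil 3).

Lemma Fil_mono i j x : (i <= j)%N -> Fil j x -> Fil i x.
Proof.
case: H_hodge => _ [_ FS] _ _ _ /subnK <-; elim: (j - i)%N => [|d IH] //.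
by move=> /FS.
Qed.

Lemma Fil_Dop i j x : Fil i x -> Fil i.-1 (Dop H j x).
Proof.
case: H_hodge => _ [F0 FS] _ _ FG; case: i => [|i]; first by move=> _; apply: F0.
by move=> /FG.
Qed.

Lemma Fil_Dmon i m x : Fil i x -> Fil (i - mdeg m) (Dmon H m x).
Proof.
move=> ix; rewrite /Dmon mdegE -(big_enum _ _ _ (fun j => m j)) /=.
elim: (enum 'I_n) => [|j s IH] /=; first by rewrite big_nil subn0.
rewrite big_cons [(m j + _)%N]addnC subnDA; elim: (m j) => [|d IHd]; first by rewrite subn0.
by rewrite iterS subnS; apply: Fil_Dop.
Qed.

Lemma map_toAK_inj a b : injective (map_mx (@toAK p k W n) : 'M_(a, b) -> 'M_(a, b)).
Proof.
move=> M N /matrixP MN; apply/matrixP => i j; apply: (@toAK_inj p k W n).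
by have := MN i j; rewrite !mxE.
Qed.

(* p^|m|/m! has valuation at least min(|m|, 3) since p > 3. *)
Lemma frobs_divisible phi i x : (i <= 3)%N -> Fil i x ->
  exists y, frobs H phi x = p%:R ^+ i *: y.
Proof.
move=> i3 ix; have [psi Hpsi] := H_div.
case: H_hodge => [[_ _ Hchi _]] _ _ _ _.
have [X HX FX] := Hchi phi psi.
(* Modulo p^i the series for chi is a finite sum over [undup E0]; F(psi), being integral, keeps the
   remainder divisible by p^i. *)
have [E0 HE] := HX x i; have [y Hy] := HE (undup E0) (undup_uniq _) (fun j => etrans (mem_undup _ _)).
have /choice[z Hz] m : exists z : 'cV[A]_r,
    chi_coef phi psi m *: map_mx (@toAK p k W n) (frobs H psi (Dmon H m x)) =
    map_mx (@toAK p k W n) (p%:R ^+ i *: z).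
  have [|z Hz] := Hpsi (i - mdeg m)%N _ _ (Fil_Dmon m ix).
    by apply: leq_trans i3; apply: leq_subr.
  have [a Ha] := chi_coef_divisible phi psi m.
  (* Each derivative costs one step of the filtration and [chi_coef] repays it: min(|m|, 3) + (i -
     |m|) >= i because i <= 3. *)
  exists (p%:R ^+ (minn (mdeg m) 3 + (i - mdeg m) - i) *: (a *: z)).
  rewrite Ha Hz -map_mxZ; congr map_mx.
  rewrite !scalerA -exprD subnKC; last by move: i3; clear; lia.
  by rewrite exprD; congr (_ *: _); ring.
have Ey : map_mx (@toAK p k W n) (p%:R ^+ i *: (frob H psi *m y)) =
    map_mx (@toAK p k W n) (frob H psi) *m (map_mx (@toAK p k W n) (X *m map_mx phi x) -
      \sum_(m <- undup E0) chi_coef phi psi m *: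
        map_mx (@toAK p k W n) (map_mx psi (Dmon H m x))).
  by rewrite scalemxAr map_mxM Hy.
exists (\sum_(m <- undup E0) z m + frob H psi *m y); apply: map_toAK_inj.
rewrite scalerDr map_mxD scaler_sumr map_mx_sum.
under eq_bigr do rewrite -Hz.
rewrite [X in _ = _ + X]Ey mulmxBr -map_mxM mulmxA FX -/(frobs H phi x).
rewrite mulmx_sumr [RHS]addrC -[LHS](subrK (\sum_(m <- undup E0)
  chi_coef phi psi m *: map_mx (@toAK p k W n) (frobs H psi (Dmon H m x)))).
congr (_ - _ + _); apply: eq_bigr => m _.
by rewrite -scalemxAr -map_mxM.
Qed.
End Divisibility.

(** * Block computations with the period matrix *)

Section PeriodBlocks.
Variables (R : comNzRingType) (h : nat).

Definition upper_unip m n (t : 'M[R]_(m, n)) : 'M[R]_(m + n) := block_mx 1%:M t 0 1%:M.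

Lemma upper_unip_solve m n l (t : 'M[R]_(m, n)) (u1 v1 : 'M[R]_(m, l)) u2 v2 :
  upper_unip t *m col_mx u1 u2 = col_mx v1 v2 -> u1 = v1 - t *m v2 /\ u2 = v2.
Proof.
rewrite mul_block_col !mul1mx mul0mx add0r => /eq_col_mx[<- <-].
by rewrite addrK.
Qed.

(** Back substitution through the block unipotent period matrix. The right-hand side has the common
    shape of dT and of P phi(T), so the lemma serves both the connection and Frobenius. *)
Lemma period_block_solve (t : 'cV[R]_h) (A1 : 'M[R]_(1, h)) (A2 : 'M[R]_1)
    (B1 : 'M[R]_h) (B2 : 'cV[R]_h) (M : 'M[R]_((1 + h) + (h + 1)))
    a00 a01 a11 a02 a03 a12 a13 a22 a23 a33 :
  block_mx (upper_unip t^T) (block_mx A1 A2 B1 B2) 0 (upper_unip t) *m M =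
    block_mx (block_mx a00 a01 0 a11) (block_mx a02 a03 a12 a13)
             0 (block_mx a22 a23 0 a33) ->
  let f23 := a23 - t *m a33 in
  let f13 := a13 - B1 *m f23 - B2 *m a33 in
  let f03 := a03 - A1 *m f23 - A2 *m a33 - t^T *m f13 in
  exists f02 f12, M = block_mx (block_mx a00 (a01 - t^T *m a11) 0 a11)
    (block_mx f02 f03 f12 f13) 0 (block_mx a22 f23 0 a33).
Proof.
move=> + f23 f13 f03.
rewrite -[M]submxK; set M1 := ulsubmx M; set M2 := ursubmx M.
set M3 := dlsubmx M; set M4 := drsubmx M.
rewrite mulmx_block !mul0mx !add0r => /eq_block_mx[E1 E2 E3 E4].
have {E3} M30 : M3 = 0.
  rewrite -[M3]vsubmxK; move: E3; rewrite -{1}[M3]vsubmxK -[0]vsubmxK.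
  by case/upper_unip_solve=> -> ->; rewrite !linear0 addr0.
rewrite M30 mulmx0 addr0 in E1; rewrite M30.
have {}E4 : M4 = block_mx a22 f23 0 a33.
  move: E4; rewrite -{1}[M4]vsubmxK /block_mx; case/upper_unip_solve => e1 e2.
  rewrite -[M4]vsubmxK e1 e2 /f23 mul_mx_row mulmx0 opp_row_mx add_row_mx oppr0 addr0 //.
have {}E1 : M1 = block_mx a00 (a01 - t^T *m a11) 0 a11.
  move: E1; rewrite -{1}[M1]vsubmxK /block_mx; case/upper_unip_solve => e1 e2.
  rewrite -[M1]vsubmxK e1 e2 mul_mx_row mulmx0 opp_row_mx add_row_mx oppr0 addr0 //.
rewrite E4 E1.
have {}E2 : upper_unip t^T *m M2 =
    block_mx (a02 - A1 *m a22) (a03 - A1 *m f23 - A2 *m a33) (a12 - B1 *m a22) f13.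
  apply/eqP; rewrite -(inj_eq (addIr (block_mx A1 A2 B1 B2 *m M4))) E2 E4.
  rewrite mulmx_block !mulmx0 !addr0 add_block_mx !subrK /f13.
  have aux m n (u x y : 'M[R]_(m, n)) : u - x - y + (x + y) = u.
    by rewrite -[_ - x - y]addrA -opprD subrK.
  by rewrite !aux.
exists (a02 - A1 *m a22 - t^T *m (a12 - B1 *m a22)), (a12 - B1 *m a22).
congr (block_mx _ _ _ _).
move: E2; rewrite -{1}[M2]vsubmxK /block_mx; case/upper_unip_solve => e1 e2.
by rewrite -[M2]vsubmxK e1 e2 mul_mx_row opp_row_mx add_row_mx.
Qed.

Lemma slopes_mul (c1 c2 c3 : R) (t : 'cV[R]_h) (A1 : 'M[R]_(1, h)) (A2 : 'M[R]_1)
    (B1 : 'M[R]_h) (B2 : 'cV[R]_h) :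
  block_mx (block_mx 1%:M 0 0 c1%:M) 0 0 (block_mx c2%:M 0 0 c3%:M) *m
    block_mx (upper_unip t^T) (block_mx A1 A2 B1 B2) 0 (upper_unip t) =
  block_mx (block_mx 1%:M t^T 0 c1%:M) (block_mx A1 A2 (c1 *: B1) (c1 *: B2))
    0 (block_mx c2%:M (c2 *: t) 0 c3%:M).
Proof.
rewrite /upper_unip mulmx_block !mulmx0 !mul0mx !addr0 !add0r.
by rewrite !mulmx_block !mul0mx !mulmx0 !mulmx1 !mul1mx !addr0 !add0r !mul_scalar_mx.
Qed.

End PeriodBlocks.

Section PeriodMatrix.
Variables (p : nat) (k : fieldType) (W : witt_vectors p k) (n h : nat).
Local Notation AK := {mps {fraction W}[n]}.
Variables (Z : AK) (t23 t13 : 'cV[AK]_h) (t12 : 'M[AK]_h).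

Lemma cy3_periodsE : cy3_periods Z t23 t13 t12 =
  block_mx (upper_unip t23^T)
    (block_mx (- t13^T + t23^T *m t12) (Z%:M + t23^T *m t13) t12 t13)
    0 (upper_unip t23).
Proof.
rewrite /cy3_periods /upper_unip mulmx_block !mulmx0 !mul0mx !mulmx1 !addr0 !add0r.
by rewrite mulmx_block !mul1mx !mul0mx !add0r.
Qed.

Lemma cy3_periods_unit : cy3_periods Z t23 t13 t12 \in unitmx.
Proof.
rewrite cy3_periodsE unitmxE det_ublock /upper_unip !det_ublock !det1 !mul1r.
exact: unitr1.
Qed.
End PeriodMatrix.

Section ChainRule.
Variables (p : nat) (k : closedFieldType) (W : witt_vectors p k).
Hypothesis char_k : p \in [pchar k].
Variables (sigma : {rmorphism W -> W}) (n : nat).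
Local Notation A := {mps W[n]}.

(** Both sides are derivations along phi that agree on constants and on the t_i. Writing a = c + sum
    t_i b_i multiplies the discrepancy by the phi(t_i), so it lies in every power of the maximal
    ideal. *)
Lemma frob_lift_chain_rule (phi : frob_lift sigma n) (l : 'I_n) (a : A) :
  mps_deriv l (phi a) = \sum_j phi (mps_deriv j a) * mps_deriv l (phi (mpsX W j)).
Proof.
apply/eqP; rewrite -subr_eq0; apply/eqP/(Iad_sep char_k) => d.
elim: d a => [|d IH] a; first exact: Iad_0.
pose D a := \sum_j phi (mps_deriv j a) * mps_deriv l (phi (mpsX W j)).
have DD (I : Type) (s : seq I) (F : I -> A) : D (\sum_(i <- s) F i) = \sum_(i <- s) D (F i).
  rewrite /D exchange_big; apply: eq_bigr => j _.
  by rewrite !raddf_sum mulr_suml.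
have DA u v : D (u + v) = D u + D v.
  by rewrite /D -big_split; apply: eq_bigr => j _; rewrite !raddfD mulrDl.
have DC w : D (mpsC n w) = 0.
  by rewrite /D big1 // => j _; rewrite mps_derivC rmorph0 mul0r.
have DM u v : D (u * v) = D u * phi v + phi u * D v.
  rewrite /D mulr_suml mulr_sumr -big_split; apply: eq_bigr => j _ /=.
  rewrite mps_derivM rmorphD !rmorphM mulrDl.
  by congr (_ + _); [apply: mulrAC | rewrite mulrA].
have DX i : D (mpsX W i) = mps_deriv l (phi (mpsX W i)).
  rewrite /D (bigD1 i) //= big1 => [|j nj]; last first.
    by rewrite mps_deriv_mpsX (negbTE nj) rmorph0 mul0r.
  by rewrite mps_deriv_mpsX eqxx rmorph1 mul1r addr0.
have [c [b ->]] : exists (c : W) (b : 'I_n -> A), a = mpsC n c + \sum_i mpsX W i * b i.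
  by exists (a 0%MM), (fun i => mps_div i a); apply: mps_div_sum.
rewrite -/(D _) DA DD DC add0r.
rewrite rmorphD rmorph_sum raddfD raddf_sum /= frob_liftC mps_derivC add0r -sumrB.
apply: Iad_sum => i _; rewrite DM DX rmorphM mps_derivM opprD addrACA subrr add0r -mulrBr.
by rewrite -add1n; apply: IadM (IH _); apply: Iad_frob_mpsX.
Qed.
End ChainRule.

Lemma eq_col_matrix (R : Type) m n (A B : 'M[R]_(m, n)) :
  (forall j, col j A = col j B) -> A = B.
Proof.
move=> AB; apply/matrixP => i j.
by have := congr1 (fun M : 'cV_m => M i 0) (AB j); rewrite !mxE.
Qed.

Lemma col_mulmx (R : pzSemiRingType) m n l (A : 'M[R]_(m, n)) (B : 'M[R]_(n, l)) j :
  col j (A *m B) = A *m col j B.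
Proof. by apply/matrixP => a b; rewrite !mxE; apply: eq_bigr => i _; rewrite !mxE. Qed.

Lemma col_block_lshift (R : Type) m1 m2 n1 n2 (A : 'M[R]_(m1, n1)) B (C : 'M[R]_(m2, n1))
    (D : 'M[R]_(m2, n2)) j : col (lshift n2 j) (block_mx A B C D) = col_mx (col j A) (col j C).
Proof. by rewrite block_mxEh colKl col_col_mx. Qed.

Lemma col_block_rshift (R : Type) m1 m2 n1 n2 (A : 'M[R]_(m1, n1)) B (C : 'M[R]_(m2, n1))
    (D : 'M[R]_(m2, n2)) j : col (rshift n1 j) (block_mx A B C D) = col_mx (col j B) (col j D).
Proof. by rewrite block_mxEh colKr col_col_mx. Qed.

Section BlockColumns.
Variables (R : pzSemiRingType) (h : nat).
Variables (l00 : 'M[R]_1) (l01 : 'M[R]_(1, h)) (l10 : 'M[R]_(h, 1)) (l11 : 'M[R]_h).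

Lemma col_last_block (a : 'M[R]_(1 + h)) c (m00 : 'M[R]_1) m01 (m10 : 'M[R]_(h, 1)) m11 :
  col (rshift _ (rshift _ 0)) (block_mx a (block_mx l01 l00 l11 l10) c (block_mx m11 m10 m01 m00))
  = col_mx (col_mx l00 l10) (col_mx m10 m00).
Proof. by rewrite !col_block_rshift !col_id. Qed.

Lemma col_first_block (a : 'M[R]_(1 + h, h + 1)) (c : 'M_(h + 1)) :
  col (lshift _ (lshift _ 0)) (block_mx (block_mx l00 l01 l10 l11) a 0 c)
  = col_mx (col_mx l00 l10) 0.
Proof. by rewrite !col_block_lshift !col_id col0. Qed.

Lemma col_second_block (a : 'M[R]_(1 + h, h + 1)) (c : 'M_(h + 1)) i :
  col (lshift _ (rshift _ i)) (block_mx (block_mx l00 l01 l10 l11) a 0 c)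
  = col_mx (col_mx (col i l01) (col i l11)) 0.
Proof. by rewrite col_block_lshift !col_block_rshift col0. Qed.
End BlockColumns.

(** The last entry of the first row of T^-1 P phi(T) when phi(tau) = p tau: the terms in tau^T tau13
    cancel, and a2 - phi(tau)^T phi(tau13) is phi(Z). *)
Lemma period_entry (R : comNzRingType) h (c c3 z : R) (t t13 t13' : 'cV[R]_h) (a2 : 'M[R]_1) :
  (a2 - (z%:M + t^T *m t13) *m c3%:M - t^T *m (c *: t13' - t13 *m c3%:M)) 0 0 =
  a2 0 0 - ((c *: t)^T *m t13') 0 0 - c3 * z.
Proof.
have -> : (c *: t)^T *m t13' = c *: (t^T *m t13').
  by rewrite linearZ /= -scalemxAl.
rewrite !mul_mx_scalar mulmxBr -!scalemxAr.
move: (t^T *m t13') (t^T *m t13) => x y; rewrite !mxE eqxx mulr1n; ring.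
Qed.

Section OrdinaryCY3.
Variables (p : nat) (k : closedFieldType) (W : witt_vectors p k).
Hypotheses (char_k : p \in [pchar k]) (p_gt3 : (3 < p)%N).
Local Notation K := {fraction W}.
Variables (sigma : {rmorphism W -> W}) (s : {rmorphism K -> K}).
Hypotheses (sigma_frob : is_frobenius sigma) (sE : sigmaK sigma =1 s).
Variables (n h r : nat).
Local Notation A := {mps W[n]}.
Local Notation AK := {mps K[n]}.
Local Notation N := ((1 + h) + (h + 1))%N.
Variables (H : fcrystal_data sigma n r) (U Fil : nat -> 'cV[A]_r -> Prop).
Variables (form : 'cV[A]_r -> 'cV[A]_r -> A).
Variables (e0 : 'cV[A]_r) (e1 e2 : 'M[A]_(r, h)) (e3 : 'cV[A]_r).
Variables (Z : AK) (tau23 tau13 : 'cV[AK]_h) (tau12 : 'M[AK]_h).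
Hypothesis H_CY3 : is_ordinary_CY3 h H U Fil form.
Local Notation T := (cy3_periods Z tau23 tau13 tau12).
Hypothesis e_adapted : is_adapted_basis H U Fil form e0 e1 e2 e3 T.
Local Notation e := (row_mx (row_mx e0 e1) (row_mx e2 e3)).

Lemma mul_basis (a : 'cV[A]_1) (b u : 'cV[A]_h) (v : 'cV[A]_1) :
  e *m col_mx (col_mx a b) (col_mx u v) = e0 *m a + e1 *m b + (e2 *m u + e3 *m v).
Proof. by rewrite !mul_row_col. Qed.

(** The rank r is not literally 2h + 2, so the basis matrix is rectangular and a two-sided inverse
    has to be assembled from coordinates. *)
Lemma basis_inverse : exists E : 'M[A]_(N, r), e *m E = 1%:M /\ E *m e = 1%:M.
Proof.
have [sp inj] := adapted_basis e_adapted.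
have /choice[c Hc] (j : 'I_r) : exists c : 'cV[A]_N, col j 1%:M = e *m c.
  exact: (sp (col j 1%:M)).1.
pose E : 'M[A]_(N, r) := \matrix_(i, j) c j i 0.
have cE j : col j E = c j by apply/matrixP => i l; rewrite !mxE ord1.
have eE : e *m E = 1%:M.
  by apply: eq_col_matrix => j; rewrite col_mulmx cE -Hc.
exists E; split=> //; apply/eqP; rewrite -subr_eq0; apply/eqP; apply: eq_col_matrix => j.
rewrite [RHS](_ : _ = 0); last by apply/matrixP => i l; rewrite !mxE.
apply: inj; rewrite -col_mulmx mulmxBr mulmxA eE mul1mx mulmx1 subrr.
by apply/matrixP => i l; rewrite !mxE.
Qed.

Variable E : 'M[A]_(N, r).
Hypotheses (eE : e *m E = 1%:M) (Ee : E *m e = 1%:M).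

Lemma basis_coords (x : 'cV[A]_r) : x = e *m (E *m x).
Proof. by rewrite mulmxA eE mul1mx. Qed.

Lemma basis_inj (c d : 'cV[A]_N) : e *m c = e *m d -> c = d.
Proof. by move=> /(congr1 (mulmx E)); rewrite !mulmxA Ee !mul1mx. Qed.

Lemma split_coords (c : 'cV[A]_N) : exists a b u v, c = col_mx (col_mx a b) (col_mx u v).
Proof.
exists (usubmx (usubmx c)), (dsubmx (usubmx c)), (usubmx (dsubmx c)), (dsubmx (dsubmx c)).
by rewrite !vsubmxK.
Qed.

(** The vectors lie in H, so their coordinates form an integral matrix M; the equation T M = S
    replaces [invmx T] and can be solved by blocks. *)
Lemma integral_matrix (y : 'I_N -> 'cV[A]_r) (S : 'M[AK]_N) :
  (forall i, map_mx (@toAK p k W n) (y i) = map_mx (@toAK p k W n) e *m col i (invmx T *m S)) ->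
  exists M : 'M[A]_N, (forall i, y i = e *m col i M) /\ T *m map_mx (@toAK p k W n) M = S.
Proof.
move=> Hy; pose M : 'M[A]_N := \matrix_(a, i) (E *m y i) a 0.
have cM i : col i M = E *m y i by apply/matrixP => a b; rewrite !mxE ord1.
exists M; split=> [i|]; first by rewrite cM -basis_coords.
suff -> : map_mx (@toAK p k W n) M = invmx T *m S.
  by rewrite mulmxA mulmxV ?mul1mx // cy3_periods_unit.
apply: eq_col_matrix => i; rewrite -map_col cM map_mxM Hy mulmxA -map_mxM Ee map_mx1.
by rewrite mul1mx.
Qed.

Lemma form_mul (c : 'cV[A]_N) y : form (e *m c) y = \sum_i c i 0 * form (col i e) y.
Proof.
have [lin _ _ _] := cy3_form H_CY3.
have form0 z : form 0 z = 0.
  have := lin 1 0 0 z; rewrite scaler0 addr0 mul1r => /eqP.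
  by rewrite -subr_eq subrr => /eqP.
have -> : e *m c = \sum_i c i 0 *: col i e.
  apply/matrixP => a b; rewrite ord1 mxE summxE; apply: eq_bigr => i _.
  by rewrite !mxE mulrC.
elim: (index_enum _) => [|i t IH]; first by rewrite !big_nil form0.
by rewrite !big_cons lin IH.
Qed.

Lemma form_coords (a : 'cV[A]_1) (b u : 'cV[A]_h) (v : 'cV[A]_1) :
  let x := e *m col_mx (col_mx a b) (col_mx u v) in
  [/\ forall j, form x (col j e1) = - u j 0, forall j, form x (col j e2) = b j 0 &
      form x e3 = - a 0 0].
Proof.
move=> x; pose c := col_mx (col_mx a b) (col_mx u v).
have Hx : \row_j form x (col j e) = c^T *m (cy3_gram W n h).
  apply/rowP => j; rewrite !mxE form_mul; apply: eq_bigr => i _.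
  by rewrite -(adapted_gram e_adapted) !mxE.
have cG : c^T *m (cy3_gram W n h) =
    row_mx (row_mx v^T (- u^T)) (row_mx b^T (- a^T)).
  rewrite /cy3_gram /c !tr_col_mx mul_row_block !mulmx0 add0r addr0.
  by rewrite !mul_row_block !mulmx0 !mulmx1 !mulmxN !mulmx1 !add0r !addr0.
rewrite cG in Hx.
split=> [j|j|].
- have := congr1 (fun M : 'rV_N => M 0 (lshift _ (rshift _ j))) Hx.
  by rewrite mxE colKl colKr row_mxEl row_mxEr !mxE.
- have := congr1 (fun M : 'rV_N => M 0 (rshift _ (lshift _ j))) Hx.
  by rewrite mxE colKr colKl row_mxEr row_mxEl !mxE.
- have := congr1 (fun M : 'rV_N => M 0 (rshift _ (rshift _ 0))) Hx.
  by rewrite mxE colKr colKr col_id row_mxEr row_mxEr !mxE.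
Qed.

Local Notation toAKmx := (map_mx (@toAK p k W n)).

Lemma Fil_adapted : [/\ Fil 0 e0, forall i, Fil 1 (col i e1), forall i, Fil 2 (col i e2) & Fil 3 e3].
Proof.
have [[_ ?] P1 P2 [_ ?]] := adapted_parts e_adapted.
by split=> // i; [case: (P1 i) | case: (P2 i)].
Qed.

(** By transversality D_j e3 lies in Fil^2, which is its own orthogonal and contains e2 and e3;
    pairing with these kills the coordinates on e1 and e0. *)
Lemma Dop_e3_coords j : exists u v, Dop H j e3 = e *m col_mx 0 (col_mx u v).
Proof.
have [_ _ F2 F3] := Fil_adapted.
have D2 : Fil 2 (Dop H j e3) by apply: (Fil_Dop (cy3_hodge H_CY3) j F3).
have perp y : Fil 2 y -> form (Dop H j e3) y = 0.
  by move=> /(cy3_perp22 H_CY3) ->.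
have [a [b [u [v cE]]]] := split_coords (E *m Dop H j e3).
have DE : Dop H j e3 = e *m col_mx (col_mx a b) (col_mx u v) by rewrite -cE -basis_coords.
have [_ fb fa] := form_coords a b u v; rewrite -DE in fb fa.
exists u, v; rewrite DE; congr (_ *m col_mx _ _).
rewrite -[RHS]vsubmxK !linear0; congr col_mx.
  apply/matrixP => i l; rewrite !ord1 mxE; apply: oppr_inj; rewrite -fa oppr0.
  by apply/perp/(Fil_mono (cy3_hodge H_CY3) _ F3).
by apply/colP => i; rewrite mxE -fb; apply: perp.
Qed.

Lemma connection_basis : exists g : 'M[A]_(h, n),
  (forall i j, mps_deriv j (tau23 i 0) = toAK (g i j)) /\
  forall j, [/\ Dop H j e0 = 0, forall i, Dop H j (col i e1) = g i j *: e0 &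
               Dop H j e3 = e2 *m col j g].
Proof.
suff /choice[g Hg] j : exists g : 'cV[A]_h, toAKmx g = map_mx (mps_deriv j) tau23 /\
    [/\ Dop H j e0 = 0, forall i, Dop H j (col i e1) = g i 0 *: e0 & Dop H j e3 = e2 *m g].
  exists (\matrix_(i, j) g j i 0).
  split=> [i j|j]; have [gE [H0 H1 H3]] := Hg j.
    by have := congr1 (fun M : 'cV_h => M i 0) gE; rewrite !mxE.
  split=> // [i|]; first by rewrite mxE.
  by rewrite H3; congr (_ *m _); apply/colP => i; rewrite !mxE.
have [M [HM TM]] := integral_matrix (adapted_conn e_adapted j).
pose d := mps_deriv j : AK -> AK.
have dT : map_mx d T = block_mx (block_mx 0 (map_mx d tau23)^T 0 0)
    (block_mx (map_mx d (- tau13^T + tau23^T *m tau12))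
       (map_mx d (Z%:M + tau23^T *m tau13)) (map_mx d tau12) (map_mx d tau13))
    0 (block_mx 0 (map_mx d tau23) 0 0).
  have d1 m : map_mx d (1%:M : 'M_m) = 0.
    by apply/matrixP => i l; rewrite !mxE -(rmorph_nat (@mpsC n K)); exact: mps_derivC.
  have d0 m m' : map_mx d (0 : 'M_(m, m')) = 0.
    by apply/matrixP => i l; rewrite !mxE -(rmorph0 (@mpsC n K)); exact: mps_derivC.
  by rewrite cy3_periodsE /upper_unip !map_block_mx !d1 !d0 map_trmx.
rewrite -/d dT cy3_periodsE in TM.
have [f02 [f12 EM]] := period_block_solve TM.
rewrite !mulmx0 !subr0 in EM.
have colM i : toAKmx (col i M) = col i (toAKmx M) by rewrite map_col.
(* The coordinates of D_j e3 on e2 are the derivatives of tau23; they are integral because D_j e3 is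
   a vector of H. *)
have [u [v D3]] := Dop_e3_coords j.
have D3' := HM (rshift _ (rshift _ 0)); rewrite !colKr col_id D3 in D3'.
have /(congr1 toAKmx) := basis_inj D3'.
rewrite colM EM !map_col_mx !col_block_rshift !col_id => /eq_col_mx[_ /eq_col_mx[uE vE]].
have v0 : v = 0 by apply: map_toAK_inj; rewrite vE map_mx0.
exists u; split=> //; split.
- have := HM (lshift _ (lshift _ 0)); rewrite !colKl col_id => ->.
  suff -> : col (lshift _ (lshift _ 0)) M = 0 by rewrite mulmx0.
  apply: map_toAK_inj; rewrite colM EM !col_block_lshift !col_id map_mx0.
  by rewrite linear0 !col_mx0.
- move=> i; have := HM (lshift _ (rshift _ i)); rewrite !colKl colKr => ->.
  suff -> : col (lshift _ (rshift _ i)) M = col_mx (col_mx (u i 0)%:M 0) (col_mx 0 0).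
    by rewrite mul_basis mul_mx_scalar !mulmx0 !addr0.
  apply: map_toAK_inj; rewrite colM EM col_block_lshift col_block_rshift !map_col_mx !map_mx0.
  rewrite !linear0 !col_mx0; congr (col_mx (col_mx _ _) _).
  apply/matrixP => a b; rewrite !ord1 !mxE eqxx mulr1n.
  by have := congr1 (fun M : 'cV_h => M i 0) uE; rewrite !mxE => ->.
by rewrite D3 v0 -(col_mx0 _ 1 h) mul_basis !mulmx0 !add0r addr0.
Qed.

Section FrobeniusMatrix.
Variable phi : frob_lift sigma n.

Definition frob_ext_mx m l (M M' : 'M[AK]_(m, l)) := forall i j, frob_ext phi (M i j) (M' i j).

Lemma frob_ext_mx_unique m l (M M' M'' : 'M[AK]_(m, l)) :
  frob_ext_mx M M' -> frob_ext_mx M M'' -> M' = M''.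
Proof.
move=> h1 h2; apply/matrixP => i j; exact: (frob_ext_unique char_k sE (h1 i j) (h2 i j)).
Qed.

Lemma frob_ext_mx_block m1 m2 l1 l2 (M1 M1' : 'M[AK]_(m1, l1)) (M2 M2' : 'M[AK]_(m1, l2))
    (M3 M3' : 'M[AK]_(m2, l1)) (M4 M4' : 'M[AK]_(m2, l2)) :
  frob_ext_mx M1 M1' -> frob_ext_mx M2 M2' -> frob_ext_mx M3 M3' -> frob_ext_mx M4 M4' ->
  frob_ext_mx (block_mx M1 M2 M3 M4) (block_mx M1' M2' M3' M4').
Proof.
move=> h1 h2 h3 h4 i j.
case: (split_ordP i) => i' ->; case: (split_ordP j) => j' ->.
- by rewrite !block_mxEul.
- by rewrite !block_mxEur.
- by rewrite !block_mxEdl.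
- by rewrite !block_mxEdr.
Qed.

Lemma frob_ext_mx_ursub m1 m2 l1 l2 (M M' : 'M[AK]_(m1 + m2, l1 + l2)) :
  frob_ext_mx M M' -> frob_ext_mx (ursubmx M) (ursubmx M').
Proof. by move=> MM i j; rewrite !mxE. Qed.

Lemma frob_ext_mx_drsub m1 m2 l1 l2 (M M' : 'M[AK]_(m1 + m2, l1 + l2)) :
  frob_ext_mx M M' -> frob_ext_mx (drsubmx M) (drsubmx M').
Proof. by move=> MM i j; rewrite !mxE. Qed.

Lemma frob_ext_mx0 m l : frob_ext_mx (0 : 'M_(m, l)) 0.
Proof. by move=> i j; rewrite !mxE; apply: (frob_ext0 char_k sigma_frob). Qed.

Lemma frob_ext_mx1 m : frob_ext_mx (1%:M : 'M_m) 1%:M.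
Proof.
move=> i j; rewrite !mxE; case: eqP => _ /=.
  exact: (frob_ext1 char_k sigma_frob).
exact: (frob_ext0 char_k sigma_frob).
Qed.

(** [adapted_frob] provides phi(g) for the entries g of T; by uniqueness of phi(g) the entries 0 and
    1 are preserved, so phi(T) keeps the block shape of T. *)
Lemma frob_periods : exists (tau' t13' : 'cV[AK]_h) (t12' : 'M[AK]_h)
    (A1' : 'M[AK]_(1, h)) (A2' : 'M[AK]_1),
  [/\ forall i, frob_ext phi (tau23 i 0) (tau' i 0),
      forall i, frob_ext phi (tau13 i 0) (t13' i 0),
      frob_ext phi (Z + (tau23^T *m tau13) 0 0) (A2' 0 0) &
      forall S, frob_ext_mx T S ->
        S = block_mx (upper_unip tau'^T) (block_mx A1' A2' t12' t13') 0 (upper_unip tau')].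
Proof.
have [S [HS _]] := adapted_frob e_adapted phi.
have {}HS : frob_ext_mx T S := HS.
have Hu := frob_ext_mx_ursub HS.
pose tau' := ursubmx (drsubmx S).
have Htau : frob_ext_mx tau23 tau'.
  have := frob_ext_mx_ursub (frob_ext_mx_drsub HS).
  by rewrite cy3_periodsE block_mxKdr block_mxKur.
rewrite cy3_periodsE block_mxKur in Hu.
pose S2 := ursubmx S.
have H2 i j := Hu i j.
exists tau', (drsubmx S2), (dlsubmx S2), (ulsubmx S2), (ursubmx S2); split.
- by move=> i; apply: Htau.
- by move=> i; have := Hu (rshift 1 i) (rshift h 0); rewrite block_mxEdr !mxE.
- by have := Hu (lshift h 0) (rshift h 0); rewrite block_mxEur !mxE eqxx mulr1n.
move=> S' HS'; apply: (frob_ext_mx_unique HS'); rewrite cy3_periodsE.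
apply: frob_ext_mx_block.
- apply: frob_ext_mx_block; try exact: frob_ext_mx1; last exact: frob_ext_mx0.
  by move=> i j; rewrite !mxE; have := Htau j i; rewrite !mxE.
- by rewrite submxK.
- exact: frob_ext_mx0.
- by apply: frob_ext_mx_block; [exact: frob_ext_mx1 | exact: Htau | exact: frob_ext_mx0 | exact: frob_ext_mx1].
Qed.

Lemma form_alt x y : form x y = - form y x.
Proof.
have [lin rin alt _] := cy3_form H_CY3.
have := alt (1 *: x + y); rewrite lin rin [X in _ + X = _]rin !alt !mulr0 !mul1r add0r addr0.
by move=> /eqP; rewrite addr_eq0 => /eqP.
Qed.

Lemma toAKmx_scale_p m l i (M : 'M[A]_(m, l)) :
  toAKmx (p%:R ^+ i *: M) = p%:R ^+ i *: toAKmx M.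
Proof.
by apply/matrixP => a b; rewrite !mxE rmorphM rmorphXn rmorph_nat.
Qed.

Lemma AK_p_inj i (x y : AK) : p%:R ^+ i * x = p%:R ^+ i * y -> x = y.
Proof.
move=> e; apply: mpsP => m; have := congr1 (fun f : AK => f m) e.
by rewrite -natrX !mps_natMl natrX => /(mulfI (expf_neq0 i (K_p_neq0 W char_k))).
Qed.

Lemma frobenius_basis : exists (tau' : 'cV[AK]_h) (phiZ : AK) (d : 'I_h -> A) (a : A),
  [/\ forall i, frob_ext phi (tau23 i 0) (tau' i 0),
      frob_ext phi Z phiZ,
      forall i, tau' i 0 = p%:R * tau23 i 0 + p%:R * toAK (d i),
      frobs H phi e0 = e0 /\
        (forall i, frobs H phi (col i e1) = (p%:R * d i) *: e0 + p%:R *: col i e1) &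
      form e3 (frobs H phi e3) = p%:R ^+ 3 * a /\
      ((forall i, d i = 0) -> toAK (form e3 (frobs H phi e3)) = phiZ - p%:R ^+ 3 * Z)].
Proof.
have [tau' [t13' [t12' [A1' [A2' [Htau H13 HZ HS]]]]]] := frob_periods.
have [S [HTS HF]] := adapted_frob e_adapted phi.
have {HTS}HS := HS _ HTS.
have [|M [HM TM]] := @integral_matrix (fun i => frobs H phi (col i e)) (cy3_slopes W n h *m S).
  by move=> i; rewrite HF mulmxA.
have PS : cy3_slopes W n h *m S = block_mx (block_mx 1%:M tau'^T 0 p%:R%:M)
    (block_mx A1' A2' (p%:R *: t12') (p%:R *: t13')) 0
    (block_mx (p%:R ^+ 2)%:M (p%:R ^+ 2 *: tau') 0 (p%:R ^+ 3)%:M).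
  by rewrite HS; exact: slopes_mul.
rewrite PS cy3_periodsE in TM.
have [f02 [f12 EM]] := period_block_solve TM.
have colM i : toAKmx (col i M) = col i (toAKmx M) by rewrite map_col.
(* The divisibility F e3 = p^3 y serves twice: the coordinates of y on e2 yield [d], and its
   coordinate on e0 is the quotient [a]. *)
have [y Hy] := frobs_divisible char_k p_gt3 (cy3_hodge H_CY3) (cy3_divisible H_CY3)
  phi (leqnn 3) (let: And4 _ _ _ F3 := Fil_adapted in F3).
have [a [b [u [v cE]]]] := split_coords (E *m y).
have F3 : frobs H phi e3 = e *m (p%:R ^+ 3 *: col_mx (col_mx a b) (col_mx u v)).
  by rewrite -cE -scalemxAr -basis_coords.
have F3' := HM (rshift _ (rshift _ 0)); rewrite !colKr col_id F3 in F3'.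
have /(congr1 toAKmx) := basis_inj F3'.
rewrite [RHS]colM EM [LHS]toAKmx_scale_p !map_col_mx !scale_col_mx [RHS]col_last_block.
move=> /eq_col_mx[/eq_col_mx[aE _] /eq_col_mx[uE _]].
(* The coordinates of F e3 on e2 are p^2 phi(tau) - p^3 tau and also p^3 u; cancelling p^2 gives the
   formula. *)
have dE i : tau' i 0 = p%:R * tau23 i 0 + p%:R * toAK (u i 0).
  have := congr1 (fun M : 'cV_h => M i 0) uE.
  rewrite mul_mx_scalar !mxE => e; apply: (@AK_p_inj 2).
  rewrite mulrDr !mulrA -!exprSr e [RHS]addrC subrK; reflexivity.
have formE : form e3 (frobs H phi e3) = p%:R ^+ 3 * a 0 0.
  rewrite form_alt F3 !scale_col_mx.
  have [_ _ ->] := form_coords (p%:R ^+ 3 *: a) (p%:R ^+ 3 *: b) (p%:R ^+ 3 *: u) (p%:R ^+ 3 *: v).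
  by rewrite opprK mxE.
(* Z enters T only through the entry Z + tau23^T tau13, so phi(Z) is obtained by subtracting the
   image of the product. *)
pose phiZ := A2' 0 0 - (tau'^T *m t13') 0 0.
have HphiZ : frob_ext phi Z phiZ.
  rewrite -[Z](addrK ((tau23^T *m tau13) 0 0)); apply: (frob_extB sE HZ).
  rewrite !mxE; apply: (frob_ext_sum char_k sigma_frob sE) => i _; rewrite !mxE.
  exact: (frob_extM char_k sE (Htau i) (H13 i)).
exists tau', phiZ, (fun i => u i 0), (a 0 0); split=> //.
  split=> [|i].
    have := HM (lshift _ (lshift _ 0)); rewrite !colKl col_id => ->.
    suff -> : col (lshift _ (lshift _ 0)) M = col_mx (col_mx 1%:M 0) (col_mx 0 0).
      by rewrite mul_basis mulmx1 !mulmx0 !addr0.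
    apply: map_toAK_inj; rewrite [LHS]colM EM [LHS]col_first_block !map_col_mx !map_mx0 map_mx1.
    rewrite col_mx0; reflexivity.
  have := HM (lshift _ (rshift _ i)); rewrite !colKl colKr => ->.
  suff -> : col (lshift _ (rshift _ i)) M =
      col_mx (col_mx (p%:R * u i 0)%:M (p%:R *: col i 1%:M)) (col_mx 0 0).
    rewrite mul_basis mul_mx_scalar !mulmx0 !addr0 -scalemxAr -col_mulmx mulmx1.
    by [].
  apply: map_toAK_inj; rewrite [LHS]colM EM [LHS]col_second_block !map_col_mx !map_mx0 !col_mx0.
  congr (col_mx (col_mx _ _) _).
    apply/matrixP => j l; rewrite !ord1 mul_mx_scalar !mxE eqxx mulr1n dE.
    by rewrite rmorphM rmorph_nat addrAC subrr add0r.
  apply/colP => j; rewrite !mxE rmorphM !rmorph_nat.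
  by case: eqP; rewrite ?mulr1n ?mulr0n ?mulr1 ?mulr0.
split=> // u0; rewrite formE.
have tau'E : tau' = p%:R *: tau23.
  by apply/colP => i; rewrite mxE dE u0 rmorph0 mulr0 addr0.
have f23 : p%:R ^+ 2 *: tau' - tau23 *m (p%:R ^+ 3)%:M = 0 :> 'cV[AK]_h.
  by rewrite mul_mx_scalar tau'E scalerA -exprSr subrr.
have := congr1 (fun M : 'M_1 => M 0 0) aE; rewrite f23 !mulmx0 !subr0 period_entry.
rewrite -tau'E [LHS]mxE [X in _ * X = _]mxE => <-.
by rewrite rmorphM rmorphXn rmorph_nat.
Qed.
End FrobeniusMatrix.

Lemma Fil_lin i (a : A) x y : Fil i x -> Fil i y -> Fil i (a *: x + y).
Proof.
case: (cy3_hodge H_CY3) => _ _ /(_ i)[d [b [Hb _]]] _ _.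
move=> /Hb[c ->] /Hb[c' ->]; apply/Hb; exists (a *: c + c').
by rewrite mulmxDr -scalemxAr.
Qed.

Lemma U_lin i (a : A) x y : U i x -> U i y -> U i (a *: x + y).
Proof.
case: (cy3_slope H_CY3 i) => [[d [V [b [_ [Hb _] _ _]]]] _ _ _].
move=> /Hb[c ->] /Hb[c' ->]; apply/Hb; exists (a *: c + c').
by rewrite mulmxDr -scalemxAr.
Qed.

Lemma Fil_0 i : Fil i 0.
Proof.
case: (cy3_hodge H_CY3) => _ _ /(_ i)[d [b [Hb _]]] _ _.
by apply/Hb; exists 0; rewrite mulmx0.
Qed.

Lemma U_0 i : U i 0.
Proof.
case: (cy3_slope H_CY3 i) => [[d [V [b [_ [Hb _] _ _]]]] _ _ _].
by apply/Hb; exists 0; rewrite mulmx0.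
Qed.

Lemma Fil_scale i (a : A) x : Fil i x -> Fil i (a *: x).
Proof. by move=> Hx; rewrite -[a *: x]addr0; apply: Fil_lin => //; apply: Fil_0. Qed.

Lemma U_scale i (a : A) x : U i x -> U i (a *: x).
Proof. by move=> Hx; rewrite -[a *: x]addr0; apply: U_lin => //; apply: U_0. Qed.

Lemma Fil3_coords x : Fil 3 x -> exists v : A, x = v *: e3.
Proof.
move=> Fx; have [_ F1 F2 F3] := Fil_adapted.
have perp y : Fil 1 y -> form x y = 0 by move=> /(cy3_perp31 H_CY3) ->.
have [a [b [u [v cE]]]] := split_coords (E *m x).
have xE : x = e *m col_mx (col_mx a b) (col_mx u v) by rewrite -cE -basis_coords.
have [fu fb fa] := form_coords a b u v; rewrite -xE in fu fb fa.
have H1 := cy3_hodge H_CY3.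
have a0 : a = 0.
  apply/matrixP => i l; rewrite !ord1 mxE; apply: oppr_inj; rewrite -fa oppr0.
  by apply/perp/(Fil_mono H1 _ F3).
have b0 : b = 0.
  by apply/colP => i; rewrite mxE -fb; apply/perp/(Fil_mono H1 _ (F2 i)).
have u0 : u = 0.
  by apply/colP => i; rewrite mxE; apply: oppr_inj; rewrite -fu oppr0; apply: perp.
exists (v 0 0); rewrite xE a0 b0 u0 mul_basis !mulmx0 !add0r.
rewrite -mul_mx_scalar; congr (_ *m _).
by apply/matrixP => i l; rewrite !ord1 mxE eqxx mulr1n.
Qed.

Lemma Fil3_e2 (w : 'cV[A]_h) : Fil 3 (e2 *m w) -> w = 0.
Proof.
move=> /Fil3_coords[v e2w].
have : e *m col_mx (col_mx 0 0) (col_mx w 0) = e *m col_mx (col_mx 0 0) (col_mx 0 v%:M).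
  by rewrite !mul_basis !mulmx0 !add0r addr0 mul_mx_scalar.
by move=> /basis_inj/eq_col_mx[_ /eq_col_mx[]].
Qed.

Hypothesis H_KS : kodaira_spencer_iso H U Fil.

(** Existence of theta for the maps e3 -> e2_l gives a right inverse of g; uniqueness for the zero
    map gives injectivity, which makes it a left inverse although n and h are not yet known to be
    equal. *)
Lemma kodaira_spencer_inverse (g : 'M[A]_(h, n)) :
  (forall j, Dop H j e3 = e2 *m col j g) ->
  exists G : 'M[A]_(n, h), g *m G = 1%:M /\ G *m g = 1%:M.
Proof.
move=> Hg; have [_ _ F2 F3] := Fil_adapted.
have [_ _ P2 P3] := adapted_parts e_adapted.
have connE : conn H e3 = e2 *m g.
  by apply: eq_col_matrix => j; rewrite col_mulmx -Hg.
(* The coordinate on e3 turns each column of e2 into a test map x -> c3(x) e2_l from H^3 to H^2. *)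
pose c3 (x : 'cV[A]_r) : A := (E *m x) (rshift (1 + h) (rshift h (0 : 'I_1))) 0.
have c3_lin (a : A) x y : c3 (a *: x + y) = a * c3 x + c3 y.
  by rewrite /c3 mulmxDr -scalemxAr !mxE.
have c3_e3 : c3 e3 = 1.
  have -> : e3 = e *m col_mx (col_mx 0 0) (col_mx 0 1%:M).
    by rewrite mul_basis !mulmx0 mulmx1 !add0r.
  by rewrite /c3 mulmxA Ee mul1mx !col_mxEd mxE eqxx.
have conn3 : is_crystal H by case: (cy3_hodge H_CY3) => [[]].
case: conn3 => _ connZ _ _.
have /choice[th Hth] l : exists th : 'cV[A]_n, g *m th = delta_mx l 0.
  have [|th [Hth _]] := H_KS (g := fun x => c3 x *: col l e2).
    split=> [x _|a x y _ _]; last by rewrite c3_lin scalerDl scalerA.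
    by case: (P2 l) => U2 FF2; split; [apply: U_scale | apply: Fil_scale].
  exists th; apply/eqP; rewrite -subr_eq0; apply/eqP/Fil3_e2.
  have := Hth e3 P3; rewrite c3_e3 scale1r connE; congr (Fil 3 _).
  by rewrite mulmxBr mulmxA -colE.
pose G : 'M[A]_(n, h) := \matrix_(i, j) th j i 0.
have gG : g *m G = 1%:M.
  apply: eq_col_matrix => l; rewrite col_mulmx.
  have -> : col l G = th l by apply/colP => i; rewrite !mxE.
  by rewrite Hth; apply/colP => i; rewrite !mxE andbT.
have inj0 (w : 'cV[A]_n) : g *m w = 0 -> w = 0.
  move=> gw; have [|th0 [_ uniq]] := H_KS (g := fun=> 0).
    split=> [x _|a x y _ _]; last by rewrite scaler0 addr0.
    by split; [apply: U_0 | apply: Fil_0].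
  have sol (w' : 'cV[A]_n) : g *m w' = 0 ->
      forall x, Hpart U Fil 3 x -> Fil 3 (conn H x *m w' - 0).
    move=> gw' x [_ /Fil3_coords[v ->]].
    rewrite subr0 connZ connE mulmxDl -scalemxAl -[e2 *m g *m w']mulmxA gw' mulmx0 scaler0 addr0.
    rewrite -mulmxA (mx11_scalar (dform v *m w')) mul_mx_scalar.
    by case: P3 => _ ?; apply: Fil_scale.
  rewrite -(uniq w (sol w gw)); apply: uniq; apply: sol; exact: mulmx0.
exists G; split=> //; apply/eqP; rewrite -subr_eq0; apply/eqP; apply: eq_col_matrix => j.
rewrite [RHS]col0; apply: inj0; rewrite -col_mulmx mulmxBr mulmxA gG mul1mx mulmx1 subrr.
exact: col0.
Qed.

Lemma e0_mulmx_inj m (w w' : 'M[A]_(1, m)) : e0 *m w = e0 *m w' -> w = w'.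
Proof.
move=> ww; apply: eq_col_matrix => l.
have : e *m col_mx (col_mx (col l w) 0) (col_mx 0 0) =
       e *m col_mx (col_mx (col l w') 0) (col_mx 0 0).
  by rewrite !mul_basis !mulmx0 !addr0 -!col_mulmx ww.
by move=> /basis_inj/eq_col_mx[/eq_col_mx[]].
Qed.

(** Since nabla e0 = 0 and F e0 = e0, both sides of nabla F = (phi (x) F) nabla at the i-th vector
    of e1 are multiples of e0; the identity compares their coefficients of dt_l. *)
Lemma frobenius_horizontal (phi : frob_lift sigma n) (g : 'M[A]_(h, n)) (a b : A) i :
  (forall j, Dop H j e0 = 0) -> (forall j, Dop H j (col i e1) = g i j *: e0) ->
  frobs H phi e0 = e0 -> frobs H phi (col i e1) = a *: e0 + b *: col i e1 ->
  (forall l, mps_deriv l b = 0) ->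
  forall l, mps_deriv l a + b * g i l =
    \sum_j phi (g i j) * mps_deriv l (phi (mpsX W j)).
Proof.
move=> D0 D1 F0 F1 db l.
have [[connD connZ _ _] hor _ _] : is_fcrystal H by case: (cy3_hodge H_CY3).
have c0 : conn H e0 = 0.
  by apply: eq_col_matrix => j; rewrite col0; apply: D0.
have c1 : conn H (col i e1) = e0 *m row i g.
  apply: eq_col_matrix => j; rewrite col_mulmx (_ : col j (row i g) = (g i j)%:M).
    by rewrite mul_mx_scalar; apply: D1.
  by apply/matrixP => x y; rewrite !ord1 !mxE.
have b0 : dform b = 0 by apply/rowP => j; rewrite !mxE db.
have := hor phi (col i e1); rewrite F1 connD !connZ c0 c1 b0 mulmx0 scaler0 addr0 add0r.
rewrite scalemxAr -mulmxDr.
rewrite (eq_bigr (fun j => e0 *m (phi (g i j) *: dform (phi (mpsX W j))))) => [|j _]; last first.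
  have FZ : frobs H phi (g i j *: e0) = phi (g i j) *: e0.
    by rewrite /frobs map_mxZ -scalemxAr; congr (_ *: _); exact: F0.
  by rewrite D1 FZ -scalemxAl scalemxAr.
rewrite -mulmx_sumr => /e0_mulmx_inj/rowP/(_ l); rewrite !mxE summxE => ->.
by apply: eq_bigr => j _; rewrite !mxE.
Qed.
End OrdinaryCY3.

(** * The canonical lift *)

Section CanonicalLift.
Variables (p : nat) (k : closedFieldType) (W : witt_vectors p k).
Hypotheses (char_k : p \in [pchar k]) (p_gt3 : (3 < p)%N).
Local Notation K := {fraction W}.
Variables (sigma : {rmorphism W -> W}) (s : {rmorphism K -> K}).
Hypotheses (sigma_frob : is_frobenius sigma) (sE : sigmaK sigma =1 s).
Variable n : nat.
Local Notation A := {mps W[n]}.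
Local Notation AK := {mps K[n]}.

Lemma W_nat_eq0 (w : W) l : w *+ l.+1 = 0 -> w = 0.
Proof.
move=> e; apply: (@toK_inj p k W); rewrite rmorph0.
apply: (mulIf (K_nat_neq0 W char_k l)); rewrite mul0r mulr_natr -rmorphMn e.
exact: rmorph0.
Qed.

Lemma mps_deriv_eq0 (f : A) : (forall l, mps_deriv l f = 0) -> f = mpsC n (f 0%MM).
Proof.
move=> df; apply: mpsP => m /=; have [->//|m0] := eqVneq m 0%MM.
have [i mi] := mnm_neq0 m0.
have := congr1 (fun h : A => h (m - U_(i))%MM) (df i).
by rewrite mps_derivE submK ?lep1mP // mps0 => /W_nat_eq0.
Qed.

Lemma deriv_period_exp (tau : AK) (q g : A) (c : W) (j : 'I_n) :
  toAK q = mpsC n (toK c) * fexp (tau - mpsC n (tau 0%MM)) ->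
  mps_deriv j tau = toAK g -> mps_deriv j q = q * g.
Proof.
move=> Hq dtau; apply: (@toAK_inj p k W n).
have -> : toAK (mps_deriv j q) = mps_deriv j (toAK q) by exact: mps_map_deriv.
rewrite Hq mps_derivM mps_derivC mul0r add0r.
rewrite (fexp_deriv (K_nat_neq0 W char_k)) ?mps_sub_const0 //.
by rewrite raddfB /= mps_derivC subr0 dtau mulrA -Hq rmorphM.
Qed.

Lemma period_exp_const (tau : AK) (q : A) (c : W) :
  toAK q = mpsC n (toK c) * fexp (tau - mpsC n (tau 0%MM)) -> q 0%MM = c.
Proof.
move=> Hq; apply: (@toK_inj p k W).
have := congr1 (fun f : AK => f 0%MM) Hq.
by rewrite mpsCMl fexp_0 mulr1.
Qed.

Variable phi : frob_lift sigma n.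
Variables (tau tau' : AK) (q d : A) (c : W) (g : 'I_n -> A).
Hypotheses (dtau : forall j, mps_deriv j tau = toAK (g j)) (tau0 : padicK 1 (tau 0%MM)).
Hypotheses (Hc : is_pexp (tau 0%MM) (toK c)).
Hypothesis (Hq : toAK q = mpsC n (toK c) * fexp (tau - mpsC n (tau 0%MM))).
Hypotheses (phiq : phi q = q ^+ p) (Htau : frob_ext phi tau tau').
Hypothesis (Hd : tau' = p%:R * tau + p%:R * toAK d).
Hypothesis horizontal : forall l,
  mps_deriv l (p%:R * d) + p%:R * g l = \sum_j phi (g j) * mps_deriv l (phi (mpsX W j)).

(* Comparing the logarithmic derivatives of phi(q) = q^p with the horizontality
   of F shows that p d is constant; its value phi(tau)(0) - p tau(0) is 0 since
   phi(tau)(0) and p tau(0) both have the exponential q(0)^p. *)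
Lemma canonical_period : d = 0.
Proof.
have p_gt0 : (0 < p)%N by apply/prime_gt0/(pcharf_prime char_k).
have q0 := period_exp_const Hq.
have c1 : padicW 1 (c - 1).
  apply/padicK_toK; rewrite rmorphB rmorph1; exact: (is_pexp_int Hc tau0).
have uq : q ^+ p \is a GRing.unit.
  apply: unitrX; rewrite (mps_unitE char_k) q0 -[c](subrK 1) rmorphD rmorph1.
  by move/(residue_eq0 char_k): c1 => /= ->; rewrite add0r oner_eq0.
have dpd l : mps_deriv l (p%:R * d) = 0.
  have := frob_lift_chain_rule char_k phi l q.
  rewrite {1}phiq mps_derivX (deriv_period_exp Hq (dtau l)).
  rewrite (eq_bigr (fun j => phi q * (phi (g j) * mps_deriv l (phi (mpsX W j))))); last first.
    by move=> j _; rewrite (deriv_period_exp Hq (dtau j)) rmorphM mulrA.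
  rewrite -mulr_sumr -horizontal phiq.
  have -> : p%:R * q ^+ p.-1 * (q * g l) = q ^+ p * (p%:R * g l).
    by have := exprSr q p.-1; rewrite prednK // => ->; ring.
  move/(mulrI uq) => /eqP; rewrite -subr_eq0 opprD addrCA subrr addr0 oppr_eq0.
  by move/eqP.
have pdC := mps_deriv_eq0 dpd.
have [t1 Ht] := frob_lift_exp_at0 char_k p_gt3 sigma_frob sE Htau tau0 dtau Hc Hq.
have := is_pexpMn char_k p_gt3 p tau0 Hc.
rewrite phiq mpsX0 q0 rmorphXn in Ht => Hcp.
have tp1 : padicK 1 (tau 0%MM *+ p).
  by rewrite -mulr_natl; apply: (padicK_mul0 (padicK_int_nat W p)).
have := is_pexp_inj char_k p_gt3 t1 tp1 Ht Hcp.
rewrite Hd mpsD !mps_natMl mulr_natl => /eqP; rewrite -subr_eq0 addrAC subrr add0r.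
rewrite mulf_eq0 (negbTE (K_p_neq0 W char_k)) /= => /eqP d0.
have {}d0 : d 0%MM = 0 by apply: (@toK_inj p k W); rewrite rmorph0.
apply: mpsP => m; have := congr1 (fun f : A => f m) pdC.
rewrite !mps_natMl d0 mulr0 rmorph0 mps0 => /eqP.
by rewrite mulf_eq0 (negbTE (witt_p_neq0 W char_k)) => /eqP.
Qed.
End CanonicalLift.

Theorem theorem2p4
  (p : nat) (k : closedFieldType) (W : witt_vectors p k)
  (sigma : {rmorphism W -> W}) (n h r : nat)
  (H : fcrystal_data sigma n r) (U Fil : nat -> 'cV[{mps W[n]}]_r -> Prop)
  (form : 'cV[{mps W[n]}]_r -> 'cV[{mps W[n]}]_r -> {mps W[n]})
  (e0 : 'cV[{mps W[n]}]_r) (e1 e2 : 'M[{mps W[n]}]_(r, h))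
  (e3 : 'cV[{mps W[n]}]_r)
  (Z : {mps {fraction W}[n]}) (tau23 tau13 : 'cV[{mps {fraction W}[n]}]_h)
  (tau12 : 'M[{mps {fraction W}[n]}]_h)
  (char_k : p \in [pchar k]) (p_gt3 : (3 < p)%N)
  (sigma_frob : is_frobenius sigma)
  (H_CY3 : is_ordinary_CY3 h H U Fil form)
  (H_KS : kodaira_spencer_iso H U Fil)
  (e_adapted : is_adapted_basis H U Fil form e0 e1 e2 e3
                 (cy3_periods Z tau23 tau13 tau12)) :
  exists q : 'I_h -> {mps W[n]},
    [/\ forall i, is_exp (tau23 i 0) (toAK (q i)),
        forall i, padicW 1 (q i 0%MM - 1),
        regular_parameters (p%:R :: [seq q i - 1 | i <- enum 'I_h]) /\
          power_series_coordinates (fun i => q i - 1),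
        exists phi : frob_lift sigma n, forall i, phi (q i) = q i ^+ p &
        forall phi : frob_lift sigma n, (forall i, phi (q i) = q i ^+ p) ->
          exists phiZ : {mps {fraction W}[n]},
            [/\ frob_ext phi Z phiZ,
                toAK (form e3 (frobs H phi e3)) = phiZ - p%:R ^+ 3 * Z &
                exists a : {mps W[n]},
                  mpsC n (p%:R ^- 3) * phiZ - Z = toAK a]].
Proof.
have [s sE] := sigmaK_rmorphism sigma_frob.
have [E [eE Ee]] := basis_inverse e_adapted.
have [g [dtau Hg]] := connection_basis H_CY3 e_adapted eE Ee.
have [|G [gG Gg]] := kodaira_spencer_inverse H_CY3 e_adapted eE Ee H_KS (g := g).
  by move=> j; case: (Hg j).
(* A two-sided inverse of a rectangular matrix over a nonzero commutative ring forces the two sizes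
   to agree. *)
have nh : n = h by apply/eqP; rewrite eqn_leq (mulmx1_min Gg) (mulmx1_min gG).
subst h.
have [psi psiX] : exists psi : frob_lift sigma n, forall i, psi (mpsX W i) = mpsX W i ^+ p.
  exact: standard_lift_exists.
have Fb := frobenius_basis char_k p_gt3 sigma_frob sE H_CY3 e_adapted eE Ee.
have /choice[qc Hqc] i : exists qc : {mps W[n]} * W,
    [/\ padicK 1 (tau23 i 0 0%MM), is_pexp (tau23 i 0 0%MM) (toK qc.2) &
      toAK qc.1 = mpsC n (toK qc.2) * fexp (tau23 i 0 - mpsC n (tau23 i 0 0%MM))].
  (* The series q_i do not depend on a lift; the standard one is chosen because Dwork's lemma
     applies to it. *)
  have [tau' [phiZ [d [a [Ht _ Hd _ _]]]]] := Fb psi.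
  have := Ht i; rewrite Hd => /(period_exp char_k p_gt3 sigma_frob sE psiX).
  by case=> t0 [q [c [Hc Hq]]]; exists (q, c).
pose q i := (qc i).1; pose c i := (qc i).2.
have tau0 i : padicK 1 (tau23 i 0 0%MM) by case: (Hqc i).
have Hc i : is_pexp (tau23 i 0 0%MM) (toK (c i)) by case: (Hqc i).
have Hq i : toAK (q i) = mpsC n (toK (c i)) * fexp (tau23 i 0 - mpsC n (tau23 i 0 0%MM)).
  by case: (Hqc i).
move: q c Hc Hq => q c Hc Hq {qc Hqc}.
have q0 i : q i 0%MM = c i := period_exp_const (Hq i).
have q1 i : padicW 1 (q i 0%MM - 1).
  rewrite q0; apply/padicK_toK; rewrite rmorphB rmorph1.
  exact: (is_pexp_int (Hc i) (tau0 i)).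
have x1 i : Iad 1 (q i - 1) by apply/Iad1P; rewrite mpsD mpsN mps1 eqxx.
(* The Jacobian at 0 has entries c_i g_ij(0) with c_i = 1 modulo p, so G(0) inverts it modulo p. *)
pose L : 'M[W]_n := \matrix_(i, j) G i j 0%MM.
have HL : map_mx (@residue p k W) (L *m jacobian0 (fun i => q i - 1)) = 1%:M.
  have -> : jacobian0 (fun i => q i - 1) = \matrix_(i, j) (c i * g i j 0%MM).
    apply/matrixP => i j; rewrite !mxE mpsD mpsN mps1 mnm1_eq0 subr0.
    have := congr1 (fun f : {mps W[n]} => f 0%MM)
      (deriv_period_exp char_k (Hq i) (dtau i j)).
    by rewrite mps_derivE add0m mnm0E mulr1n mpsM0 q0.
  have GgE i j : \sum_l G i l 0%MM * g l j 0%MM = ((i == j)%:R : {mps W[n]}) 0%MM.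
    have := congr1 (fun M : 'M[{mps W[n]}]_n => M i j 0%MM) Gg; rewrite !mxE => <-.
    by rewrite mps_sum; apply: eq_bigr => l _; rewrite mpsM0.
  apply/matrixP => i j; rewrite !mxE rmorph_sum.
  have -> : (i == j)%:R = residue (((i == j)%:R : {mps W[n]}) 0%MM) :> k.
    by rewrite mps_natE eqxx rmorph_nat.
  rewrite -GgE rmorph_sum; apply: eq_bigr => l _; rewrite !mxE !rmorphM /=.
  have -> : residue (c l) = 1; last by rewrite mul1r.
  apply/eqP; rewrite -subr_eq0 -(rmorph1 (@residue p k W)) -rmorphB /= -q0; apply/eqP.
  exact/(residue_eq0 char_k)/q1.
exists q; split.
- move=> i; exists (toK (c i)); first exact: (has_sum_pexp char_k p_gt3 (tau0 i) (Hc i)).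
  by move=> m; rewrite Hq mpsCMl.
- exact: q1.
- by split; [apply: (regular_parametersP char_k x1 HL) | apply: (power_series_coordinatesP char_k x1 HL)].
(* In the coordinates q_i - 1 the lift must send q_i - 1 to q_i^p - 1, which is (q_i - 1)^p modulo
   p. *)
- have [|phi Hphi] := frob_lift_exists char_k sigma_frob (z := fun i => q i ^+ p - 1) x1 HL.
    by move=> i; rewrite !rmorphB !rmorph1 rmorphXn (frobenius_A0 char_k) expr1n.
  by exists phi => i; have := Hphi i; rewrite rmorphB rmorph1 => /addIr.
move=> phi phiq.
have [tau' [phiZ [d [a [Ht HZ Hd [F0 F1] [formE formZ]]]]]] := Fb phi.
have d0 i : d i = 0.
  apply: (canonical_period char_k p_gt3 sigma_frob sE (dtau i) (tau0 i) (Hc i) (Hq i)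
           (phiq i) (Ht i) (Hd i)).
  apply: (frobenius_horizontal H_CY3 Ee (i := i) _ _ F0 (F1 i)) => j.
  - by case: (Hg j).
  - by case: (Hg j).
  - by rewrite -(rmorph_nat (@mpsC n W)); exact: mps_derivC.
have formZ0 := formZ d0.
exists phiZ; split=> //; exists a.
have p3 : (p%:R : {fraction W}) ^+ 3 != 0 by rewrite expf_neq0 // K_p_neq0.
have pC : mpsC n (p%:R ^- 3) * p%:R ^+ 3 = 1 :> {mps {fraction W}[n]}.
  have -> : (p%:R ^+ 3 : {mps {fraction W}[n]}) = mpsC n (p%:R ^+ 3).
    by rewrite rmorphXn rmorph_nat.
  by rewrite -rmorphM mulVf // rmorph1.
have -> : mpsC n (p%:R ^- 3) * phiZ - Z = mpsC n (p%:R ^- 3) * (phiZ - p%:R ^+ 3 * Z).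
  by rewrite mulrBr mulrA pC mul1r.
rewrite -formZ0 formE.
have -> : toAK (p%:R ^+ 3 * a) = p%:R ^+ 3 * toAK a by rewrite rmorphM rmorphXn rmorph_nat.
by rewrite mulrA pC mul1r.
Qed.
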